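(* Let $X$ be a compact connected Riemann surface of genus $g\ge1$ and let $\beta\in H^0(X,K_X)\setminus\{0\}$ be a nonzero holomorphic $1$-form. Let $X_0=\{x\in X:\beta(x)\neq0\}$. Then the symplectic manifold $T^*X_0=K_{X_0}$, equipped with the Liouville symplectic form, has a natural deformation quantization. It is locally given by the Moyal–Weyl deformation quantization of $(\mathbb{C}^2,\omega_0)=(T^*\mathbb{C},\omega_0)$, where $\omega_0=dz_2\wedge dz_1$: for every connected open $U\subset X_0$ and every holomorphic embedding $f_U:U\to\mathbb{C}$ with $df_U=\beta|_U$, its restriction to $T^*U$ is the pullback of the Moyal–Weyl product by the embedding $F_U:T^*U\to\mathbb{C}^2$, $F_U(u,\lambda\beta(u))=(f_U(u),\lambda)$. These locally defined deformation quantizations patch together compatibly to define a global deformation quantization of $K_{X_0}$.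
   Context: **Deformation quantization.** Let $(Y,\Theta)$ be a connected complex manifold with a holomorphic symplectic form. Let $\eta:TY\to T^*Y$ be the isomorphism with $\eta(w)(v)=\Theta(v,w)$, and put $\tau=\eta^{-1}$. For holomorphic functions $f_1,f_2$ on an open subset, the Poisson bracket is $\{f_1,f_2\}:=\Theta(\tau(df_1),\tau(df_2))$. Let $\mathcal{H}(Y)$ be the algebra of locally defined holomorphic functions on $Y$ (operations being taken over common open domains, compatibly with restriction), and $\mathcal{A}(Y):=\mathcal{H}(Y)[[h]]$ the formal power series $\sum_{i\ge0}h^if_i$ with $f_i\in\mathcal{H}(Y)$. A deformation quantization of $(Y,\Theta)$ is an associative algebra operation $\star$ on $\mathcal{A}(Y)$ such that, writing $\mathbf f=\sum h^if_i$, $\mathbf g=\sum h^ig_i$, $\mathbf f\star\mathbf g=\sum h^i\alpha_i$: (1) each $\alpha_i$ is a polynomial in the derivatives, of arbitrary order, of $\{f_j\}_{j\ge0}$ and $\{g_j\}_{j\ge0}$, the polynomial itself being independent of $\mathbf f,\mathbf g$; (2) $\alpha_0=f_0g_0$; (3) $1\star t=t=t\star 1$ for all $t\in\mathcal{H}(Y)$; (4) $\mathbf f\star\mathbf g-\mathbf g\star\mathbf f=\sqrt{-1}\,h\{f_0,g_0\}+h^2\gamma$ for some $\gamma\in\mathcal{A}(Y)$ depending on $\mathbf f,\mathbf g$. **Moyal–Weyl product.** Let $V$ be an even-dimensional complex vector space with a constant symplectic form. There is a unique constant-coefficient differential operator $D:\mathcal{H}(V\times V)\to\mathcal{H}(V\times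 V)$ with $\{f_1,f_2\}=\Delta^*D(f_1\otimes f_2)$ for all $f_1,f_2\in\mathcal{H}(V)$, where $\Delta:V\to V\times V$ is the diagonal and $(f_1\otimes f_2)(v,w)=f_1(v)f_2(w)$. The Moyal–Weyl product is $f_1\star f_2=\Delta^*\exp(\sqrt{-1}hD/2)(f_1\otimes f_2)$, extended bilinearly in $h$ to $\mathcal{A}(V)$. It is a deformation quantization of $V$. Here $V=\mathbb{C}^2$ with coordinates $(z_1,z_2)$ and symplectic form $\omega_0=dz_2\wedge dz_1$; $\mathbb{C}^2$ is identified with $T^*\mathbb{C}$ by sending $u\cdot dz\in T_c^*\mathbb{C}$ to $(c,u)$. **Pullback.** The pullback of the product by $F_U$ is the product on $\mathcal{A}(T^*U)$ defined by: if $\big(\sum h^i(f_i\circ F_U^{-1})\big)\star\big(\sum h^i(g_i\circ F_U^{-1})\big)=\sum h^ib_i$ (Moyal–Weyl product over the open subset $F_U(T^*U)\subset\mathbb{C}^2$), then $\big(\sum h^if_i\big)\star\big(\sum h^ig_i\big)=\sum h^i(b_i\circ F_U)$. $K_X$ is the holomorphic cotangent bundle of $X$; $K_{X_0}=T^*X_0$ denotes the total space of its restriction to $X_0$. The Liouville symplectic form is the exterior derivative of the tautological $1$-form on the cotangent bundle. *)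

(* Defs.v *)
From HB Require Import structures.
From mathcomp Require Import all_boot all_order all_algebra.
From mathcomp Require Import complex.
From mathcomp Require Import boolp classical_sets functions reals topology normedtype derive.

Set Implicit Arguments.
Unset Strict Implicit.
Unset Printing Implicit Defensive.

Import Order.TTheory GRing.Theory Num.Theory.
Import numFieldNormedType.Exports.

Local Open Scope classical_set_scope.
Local Open Scope ring_scope.

(* Naming the field as a numClosedFieldType gives it the canonical norm and
   topology of MathComp-Analysis, which the bare type R[i] does not carry. *)
Definition cplx (R : realType) : numClosedFieldType := R[i].

(* [transport D phi f] is f \o (phi|_D)^-1 on phi @` D, for phi injective on D,
   and 0 elsewhere. *)
Definition transport {S T : Type} {V : zmodType} (D : set S) (phi : S -> T)
    (f : S -> V) (q : T) : V :=
  xget 0 [set f y | y in [set y | D y /\ phi y = q]].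

Record atlas (R : realType) (E : normedModType (cplx R)) (M : topologicalType) :=
  Atlas {
    idx : Type;
    dom : idx -> set M;
    crd : idx -> M -> E
  }.

Section Manifold.
Context {R : realType} {E : normedModType (cplx R)} {M : topologicalType}.
Variable A : atlas E M.
Local Notation C := (cplx R).

Definition rep {V : zmodType} (i : idx A) (f : M -> V) : E -> V :=
  transport (dom i) (crd i) f.

(* [differentiable] is Fréchet differentiability over C. Functions on an open
   set W are total functions on M of which only the values on W matter. *)
Definition holo {V : normedModType C} (W : set M) (f : M -> V) : Prop :=
  forall (i : idx A) (y : M), W y -> dom i y ->
    differentiable (rep i f) (crd i y).

Record complex_manifold : Prop := ComplexManifold {
  mfd_hausdorff : hausdorff_space M;
  mfd_countable : @second_countable M;
  mfd_cover : forall y : M, exists i : idx A, dom i y;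
  mfd_dom_open : forall i : idx A, open (dom i);
  mfd_crd_inj : forall (i : idx A) (y y' : M),
    dom i y -> dom i y' -> crd i y = crd i y' -> y = y';
  mfd_crd_continuous : forall (i : idx A) (y : M),
    dom i y -> {for y, continuous (crd i)};
  mfd_crd_open : forall (i : idx A) (W : set M),
    open W -> W `<=` dom i -> open (crd i @` W);
  mfd_crd_holo : forall j : idx A, holo (dom j) (crd j)
}.

Definition holo_embedding {V : normedModType C} (U : set M) (f : M -> V) : Prop :=
  [/\ holo U f,
      (forall y y', U y -> U y' -> f y = f y' -> y = y'),
      (forall (i : idx A) y, U y -> dom i y ->
         injective ('d (rep i f) (crd i y))) &
      (forall W, open W -> W `<=` U ->
         exists2 O : set V, open O & f @` W = O `&` f @` U)].

End Manifold.

(* A bilinear form on C^n with matrix B is (v, w) |-> v *m B *m w^T. *)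
Section LinearAlgebra.
Context {K : fieldType} {n : nat}.
Implicit Types (p q : 'rV[K]_n) (B : 'M[K]_n).

Definition wedge p q : 'M[K]_n := p^T *m q - q^T *m p.

(* The inverse of eta : w |-> B(-, w) = w *m B^T. *)
Definition tau B p : 'rV[K]_n := p *m invmx B^T.

Definition bracket_form B p q : K := (tau B p *m B *m (tau B q)^T) 0 0.

Lemma bracket_form_sum B p q : bracket_form B p q =
  \sum_a \sum_b p 0 a * q 0 b * bracket_form B 'e_a 'e_b.
Proof.
rewrite {1}[p]row_sum_delta {1}[q]row_sum_delta /bracket_form /tau.
rewrite !mulmx_suml summxE; apply: eq_bigr => a _.
rewrite linear_sum mulmx_sumr summxE; apply: eq_bigr => b _.
by rewrite -!scalemxAl linearZ /= -scalemxAr !mxE mulrA.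
Qed.

End LinearAlgebra.

Section Symplectic.
Context {R : realType} {n : nat} {M : topologicalType}.
Local Notation C := (cplx R).
Variable A : atlas 'rV[C]_n M.

Definition dword (w : seq 'I_n) (f : 'rV[C]_n -> C) : 'rV[C]_n -> C :=
  foldr (fun (a : 'I_n) (u : 'rV[C]_n -> C) => 'D_('e_a) u) f w.

Definition pderiv (i : idx A) (w : seq 'I_n) (f : M -> C) (y : M) : C :=
  dword w (rep i f) (crd i y).

Definition grad (i : idx A) (f : M -> C) (y : M) : 'rV[C]_n :=
  \row_a pderiv i [:: a] f y.

(* One- and two-forms are given by their coefficients in each chart. *)
Definition ext_deriv (theta : idx A -> M -> 'rV[C]_n) (i : idx A) (y : M) :
    'M[C]_n :=
  \matrix_(a, b) (pderiv i [:: a] (fun x => theta i x 0 b) y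
                - pderiv i [:: b] (fun x => theta i x 0 a) y).

Record symplectic_form (Theta : idx A -> M -> 'M[C]_n) : Prop :=
  SymplecticForm {
    symp_tensor : forall (i j : idx A) (y : M), dom i y -> dom j y ->
      let J := jacobian (rep i (crd j)) (crd i y) in
      Theta i y = J *m Theta j y *m J^T;
    symp_holo : forall (i : idx A) (a b : 'I_n),
      holo A (dom i) (fun y => Theta i y a b);
    symp_alt : forall (i : idx A) (y : M), dom i y ->
      (Theta i y)^T = - Theta i y;
    symp_nondeg : forall (i : idx A) (y : M), dom i y ->
      Theta i y \in unitmx;
    symp_closed : forall (i : idx A) (y : M) (a b c : 'I_n), dom i y ->
      pderiv i [:: a] (fun x => Theta i x b c) y
      + pderiv i [:: b] (fun x => Theta i x c a) y
      + pderiv i [:: c] (fun x => Theta i x a b) y = 0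
  }.

(* The connected open submanifold D of (M, Theta). *)
Definition symplectic_manifold (Theta : idx A -> M -> 'M[C]_n) (D : set M) :
    Prop :=
  [/\ complex_manifold A, symplectic_form Theta, open D & connected D].

Definition poisson (Theta : idx A -> M -> 'M[C]_n) (i : idx A)
    (f1 f2 : M -> C) (y : M) : C :=
  bracket_form (Theta i y) (grad i f1 y) (grad i f2 y).

Local Notation fseries := (nat -> M -> C).

Definition holo_series (W : set M) (f : fseries) : Prop :=
  forall k, holo A W (f k).

Definition eq_on (W : set M) (f g : fseries) : Prop :=
  forall k y, W y -> f k y = g k y.

Definition sconst (t : M -> C) : fseries := fun k => if k is 0%N then t else cst 0.

Definition sadd (f g : fseries) : fseries := fun k y => f k y + g k y.

(* Multiplication by the scalar series \sum_j h^j c_j. *)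
Definition sscale (c : nat -> C) (f : fseries) : fseries :=
  fun k y => \sum_(j < k.+1) c j * f (k - j)%N y.

(* A polynomial in the derivatives of the f_j and g_j is a sum of monomials
   coef * \prod_(j, I) d^I f_j * \prod_(j, I) d^I g_j. *)
Record monomial := Monomial {
  mcoef : M -> C;
  mleft : seq (nat * seq 'I_n);
  mright : seq (nat * seq 'I_n)
}.

Definition poly_eval (i : idx A) (N : nat) (P : 'I_N -> monomial)
    (f g : fseries) (y : M) : C :=
  \sum_(l < N) mcoef (P l) y
    * (\prod_(jI <- mleft (P l)) pderiv i jI.2 (f jI.1) y)
    * (\prod_(jI <- mright (P l)) pderiv i jI.2 (g jI.1) y).

(* [star W] is the product over the open subset W of D. *)
Record deformation_quantization (Theta : idx A -> M -> 'M[C]_n) (D : set M)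
    (star : set M -> fseries -> fseries -> fseries) : Prop :=
  DeformationQuantization {
    dq_manifold : symplectic_manifold Theta D;
    dq_holo : forall W f g, open W -> W `<=` D ->
      holo_series W f -> holo_series W g -> holo_series W (star W f g);
    dq_ext : forall W f f' g g', open W -> W `<=` D ->
      holo_series W f -> holo_series W g -> eq_on W f f' -> eq_on W g g' ->
      eq_on W (star W f g) (star W f' g');
    dq_restrict : forall W W' f g, open W -> open W' -> W `<=` D -> W' `<=` W ->
      holo_series W f -> holo_series W g ->
      eq_on W' (star W f g) (star W' f g);
    dq_addl : forall W f f' g, open W -> W `<=` D ->
      holo_series W f -> holo_series W f' -> holo_series W g ->
      eq_on W (star W (sadd f f') g) (sadd (star W f g) (star W f' g));
    dq_addr : forall W f g g', open W -> W `<=` D ->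
      holo_series W f -> holo_series W g -> holo_series W g' ->
      eq_on W (star W f (sadd g g')) (sadd (star W f g) (star W f g'));
    dq_scalel : forall W c f g, open W -> W `<=` D ->
      holo_series W f -> holo_series W g ->
      eq_on W (star W (sscale c f) g) (sscale c (star W f g));
    dq_scaler : forall W c f g, open W -> W `<=` D ->
      holo_series W f -> holo_series W g ->
      eq_on W (star W f (sscale c g)) (sscale c (star W f g));
    dq_assoc : forall W f g u, open W -> W `<=` D ->
      holo_series W f -> holo_series W g -> holo_series W u ->
      eq_on W (star W (star W f g) u) (star W f (star W g u));
    dq_poly : forall (k : nat) (i : idx A),
      exists (N : nat) (P : 'I_N -> monomial),
        (forall l, holo A (D `&` dom i) (mcoef (P l))) /\
        (forall W f g y, open W -> W `<=` D ->
           holo_series W f -> holo_series W g -> W y -> dom i y ->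
           star W f g k y = poly_eval i P f g y);
    dq_zero : forall W f g y, open W -> W `<=` D ->
      holo_series W f -> holo_series W g -> W y ->
      star W f g 0%N y = f 0%N y * g 0%N y;
    dq_one : forall W (t : M -> C), open W -> W `<=` D -> holo A W t ->
      eq_on W (star W (sconst (cst 1)) (sconst t)) (sconst t) /\
      eq_on W (star W (sconst t) (sconst (cst 1))) (sconst t);
    dq_commutator : forall W f g, open W -> W `<=` D ->
      holo_series W f -> holo_series W g ->
      exists2 gamma : fseries, holo_series W gamma &
        forall (i : idx A) (k : nat) (y : M), W y -> dom i y ->
          star W f g k y - star W g f k y =
          match k with
          | 0 => 0
          | 1 => 'i * poisson Theta i (f 0%N) (g 0%N) y
          | k'.+2 => gamma k' y
          end
  }.

End Symplectic.

Section PartialDerivatives.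
Context {K : numFieldType} {V : normedModType K}.
Implicit Types f g : V -> K.

Lemma derive_fst f g (x y a : V) : differentiable f x ->
  'D_(a, (0 : V)) (fun p : V * V => f p.1 * g p.2) (x, y) = 'D_a f x * g y.
Proof.
move=> df; rewrite /derive; apply: (cvg_lim (@norm_hausdorff _ K)).
rewrite (_ : (fun h => _) = (fun h => h^-1 *: (f (h *: a + x) - f x) * g y)).
  by apply: cvgMr_tmp; exact: (@diff_derivable _ _ _ f x a).
apply/funext => h /=; rewrite scaler0 add0r -mulrBl.
by rewrite /GRing.scale /= mulrA.
Qed.

Lemma derive_snd f g (x y b : V) : differentiable g y ->
  'D_((0 : V), b) (fun p : V * V => f p.1 * g p.2) (x, y) = f x * 'D_b g y.
Proof.
move=> dg; rewrite /derive; apply: (cvg_lim (@norm_hausdorff _ K)).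
rewrite (_ : (fun h => _) = (fun h => f x *: (h^-1 *: (g (h *: b + y) - g y)))).
  by apply: cvgZl_tmp; exact: (@diff_derivable _ _ _ g y b).
apply/funext => h /=; rewrite scaler0 add0r -mulrBr.
by rewrite /GRing.scale /= mulrCA.
Qed.

End PartialDerivatives.

Section Moyal.
Context {R : realType} {n : nat}.
Local Notation C := (cplx R).
Local Notation V := 'rV[C]_n.
Variable omega : 'M[C]_n.

Definition tensor (f g : V -> C) : V * V -> C := fun p => f p.1 * g p.2.

(* In the coordinates (v, w) of V x V, D is the sum over a, b of
   {z_a, z_b} d/dv_a d/dw_b. *)
Definition moyalD (F : V * V -> C) : V * V -> C := fun p =>
  \sum_(a < n) \sum_(b < n)
    bracket_form omega 'e_a 'e_b * 'D_(('e_a : V), (0 : V)) ('D_((0 : V), ('e_b : V)) F) p.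

Lemma moyalD_tensor (f g : V -> C) (v : V) :
  (forall u, differentiable f u) -> (forall u, differentiable g u) ->
  moyalD (tensor f g) (v, v) =
  bracket_form omega (\row_a 'D_('e_a) f v) (\row_b 'D_('e_b) g v).
Proof.
move=> df dg.
have D2 (b : 'I_n) : 'D_((0 : V), ('e_b : V)) (tensor f g) =
    tensor f ('D_('e_b) g).
  by apply/funext => -[x y]; rewrite /tensor derive_snd.
have D1 (a b : 'I_n) :
    'D_(('e_a : V), (0 : V)) (tensor f ('D_('e_b) g)) (v, v) =
    'D_('e_a) f v * 'D_('e_b) g v.
  exact: (derive_fst ('D_('e_b) g) v 'e_a (df v)).
pose p : V := \row_a 'D_('e_a) f v; pose q : V := \row_b 'D_('e_b) g v.
have pE a : p 0 a = 'D_('e_a) f v by rewrite mxE.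
have qE b : q 0 b = 'D_('e_b) g v by rewrite mxE.
change (moyalD (tensor f g) (v, v) = bracket_form omega p q).
clearbody p q.
rewrite bracket_form_sum; apply: eq_bigr => a _; apply: eq_bigr => b _.
by rewrite D2 D1 pE qE mulrC.
Qed.

Definition moyal_coef (k : nat) (f g : V -> C) (v : V) : C :=
  ('i / 2%:R) ^+ k / k`!%:R * iter k moyalD (tensor f g) (v, v).

Definition moyal (f g : nat -> V -> C) (m : nat) (v : V) : C :=
  \sum_(k < m.+1) \sum_(i < m.+1) \sum_(j < m.+1 | (k + i + j == m)%N)
    moyal_coef k (f i) (g j) v.

End Moyal.

(* dz_2 /\ dz_1; the coordinates z_1, z_2 of C^2 have indices 0 and 1. *)
Definition omega0 (R : realType) : 'M[cplx R]_2 := wedge 'e_1 'e_0.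

(* The product at a point depends only on germs there, so the Moyal-Weyl product
   over the open set F @` W is given by [moyal] itself. *)
Definition pullback_moyal {R : realType} {Y : Type} (F : Y -> 'rV[cplx R]_2)
    (W : set Y) (f g : nat -> Y -> cplx R) : nat -> Y -> cplx R :=
  fun k y => moyal (omega0 R) (fun j => transport W F (f j))
                              (fun j => transport W F (g j)) k (F y).

Section Curve.
Context {R : realType} {X : topologicalType}.
Local Notation C := (cplx R).
Variable A : atlas C X.

Definition compact_riemann_surface : Prop :=
  [/\ complex_manifold A, connected [set: X] & compact [set: X]].

(* A cotangent vector at x is a family of coefficients z i, one for each chart
   around x, such that z i dz_i = z j dz_j; irrelevant coefficients are 0. *)
Definition covector (x : X) (z : idx A -> C) : Prop :=
  (forall i, ~ dom i x -> z i = 0) /\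
  (forall i j, dom i x -> dom j x ->
     z i = z j * derive1 (rep i (crd j)) (crd i x)).

Definition holo_oneform (b : X -> idx A -> C) : Prop :=
  (forall x, covector x (b x)) /\
  (forall i, holo A (dom i) (b ^~ i)).

(* The genus is the dimension of H^0(X, K_X). *)
Definition has_genus (g : nat) : Prop :=
  exists e : 'I_g -> X -> idx A -> C,
    (forall k, holo_oneform (e k)) /\
    (forall b, holo_oneform b ->
       exists! c : 'I_g -> C, forall x i, b x i = \sum_(k < g) c k * e k x i).

Definition nonvanishing (b : X -> idx A -> C) : set X :=
  [set x | b x <> (fun _ => 0)].

Record cotangent := Cotangent {
  base : X;
  cov : idx A -> C;
  _ : covector base cov
}.

HB.instance Definition _ := gen_eqMixin cotangent.
HB.instance Definition _ := gen_choiceMixin cotangent.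

Definition pt2 (a b : C) : 'rV[C]_2 := \row_k (if k == 0 then a else b).

Definition cot_crd (i : idx A) (y : cotangent) : 'rV[C]_2 :=
  pt2 (crd i (base y)) (cov y i).

(* W is open when its image in each chart is open in the image of the chart. *)
Definition cot_open (W : set cotangent) : Prop :=
  forall (i : idx A) (y : cotangent), W y -> dom i (base y) ->
    \forall p \near cot_crd i y, forall y' : cotangent,
      dom i (base y') -> cot_crd i y' = p -> W y'.

Let cot_openT : cot_open setT.
Proof. by move=> i y _ _; exact: filterE. Qed.

Let cot_openI : setI_closed cot_open.
Proof.
move=> W1 W2 o1 o2 i y [w1 w2] di.
apply: filterS2 (o1 i y w1 di) (o2 i y w2 di) => p h1 h2 y' dy' yp.
by split; [exact: h1|exact: h2].
Qed.

Let cot_open_bigU (I : Type) (f : I -> set cotangent) :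
  (forall i, cot_open (f i)) -> cot_open (\bigcup_i f i).
Proof.
move=> fo i y [k _ fky] di.
by apply: filterS (fo k i y fky di) => p h y' dy' yp; exists k => //; exact: h.
Qed.

HB.instance Definition _ :=
  isOpenTopological.Build cotangent cot_openT cot_openI cot_open_bigU.

Definition cot_atlas : atlas 'rV[C]_2 cotangent :=
  @Atlas R 'rV[C]_2 cotangent (idx A) (fun i y => dom i (base y)) cot_crd.

Definition cot_over (U : set X) : set cotangent := [set y | U (base y)].

(* The tautological form at y is y \o d(base), where y = (cov y i) dz_i. *)
Definition tautological (i : idx cot_atlas) (y : cotangent) : 'rV[C]_2 :=
  cov y i *: grad i (fun y' => crd (a := A) i (base y')) y.

Definition liouville : idx cot_atlas -> cotangent -> 'M[C]_2 :=
  ext_deriv tautological.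

Definition differential_eq (U : set X) (f : X -> C) (b : X -> idx A -> C) : Prop :=
  forall (i : idx A) (x : X), U x -> dom i x -> derive1 (rep i f) (crd i x) = b x i.

Definition flat_chart (b : X -> idx A -> C) (U : set X) (f : X -> C) : Prop :=
  [/\ open U, connected U, U `<=` nonvanishing b, holo_embedding A U f &
      differential_eq U f b].

(* The scalar l with y = l *: b (base y), where b does not vanish. *)
Definition fibre_crd (b : X -> idx A -> C) (y : cotangent) : C :=
  xget 0 [set l : C | cov y = (fun i => l * b (base y) i)].

Definition flat_map (b : X -> idx A -> C) (f : X -> C) (y : cotangent) :
    'rV[C]_2 :=
  pt2 (f (base y)) (fibre_crd b y).

End Curve.

(* Main.v *)
(* In the chart (x, p) of T^*X given by a chart x of X, where beta = b(x) dx, a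
   flat chart f (a local primitive of beta) has the coordinate fields
     b^-1 d_x + p b' b^-2 d_p   and   b d_p.
   They involve beta but not f, so the Moyal-Weyl products pulled back by all
   flat charts are given in (x, p) by the same bidifferential operators, which
   makes them agree on overlaps and defines the product on all of T^*X_0. The
   flat map has Jacobian determinant 1, hence it carries the Liouville form to
   omega_0. X_0 is connected because the zeros of beta are isolated.
   Associativity of the Moyal-Weyl product: on triple tensors both bracketings
   are exp(pi_12 + pi_13 + pi_23), the pi_ij being commuting operators.
   The Cauchy formula is obtained without integrals, with bounded limits along
   an ultrafilter of midpoint sums and of means over roots of unity. *)
Require Import Defs.
From HB Require Import structures.
From mathcomp Require Import all_boot all_order all_algebra.
From mathcomp Require Import complex ring lra zify interval_inference.
From mathcomp Require Import boolp classical_sets functions cardinality reals topology normedtype landau derive.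

Set Implicit Arguments.
Unset Strict Implicit.
Unset Printing Implicit Defensive.

Import Order.TTheory GRing.Theory Num.Theory.
Import numFieldNormedType.Exports.

Local Open Scope classical_set_scope.
Local Open Scope ring_scope.

(** * Holomorphic functions of one and two variables *)

(** [holo] asks only for complex differentiability at each point, while star products involve
    derivatives of every order. The analytic core is therefore a regularity theorem: on an open
    subset of C^2 the partial derivatives of a differentiable function are differentiable and
    commute. The mean [Lam] is linear and monotone for bounds, but it cannot be interchanged with
    pointwise limits. This dictates [quad], a second-order Taylor bound uniform on a disc, which
    survives averaging and is all that the homotopy proof of the Cauchy formula uses. A
    differentiable [f] is not known to satisfy it beforehand, but a second primitive [G] of [f]
    does; the formula for [G], differentiated three times under the mean, then gives the bound for
    [f] itself.

    On the geometric side almost every axiom is an equality at a point, so it is checked on the part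
    of [W] lying over one flat chart, where it becomes an identity for the Moyal-Weyl product of
    transported series. [transport] takes default values outside the image, so the statements on C^2
    are made relative to an open set [O]. *)

Section RealNorm.
Context {R : realType}.
Local Notation C := (cplx R).
Implicit Types (x y z w : C) (r s e : R).

(** The norm of [cplx R] takes its values in [cplx R]. A real-valued modulus lets estimates be
    closed by linear arithmetic over [R]; [rc] leads back. *)
Definition nm z : R := Normc.normc z.
Definition rc r : C := (r%:C)%C.

Lemma normE z : `|z| = rc (nm z).
Proof. by rewrite /nm /rc; case: z. Qed.

Lemma nmE z : nm z = complex.Re `|z|.
Proof. by rewrite normE. Qed.

Lemma nm_ge0 z : 0 <= nm z.
Proof. by rewrite /nm; case: z => a b; exact: sqrtr_ge0. Qed.

Lemma nmM x y : nm (x * y) = nm x * nm y.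
Proof. exact: Normc.normcM. Qed.

Lemma nmV x : nm x^-1 = (nm x)^-1.
Proof. exact: Normc.normcV. Qed.

Lemma nm0 : nm 0 = 0.
Proof. exact: Normc.normc0. Qed.

Lemma nm1 : nm 1 = 1.
Proof. exact: Normc.normc1. Qed.

Lemma nm_eq0 x : (nm x == 0) = (x == 0).
Proof.
by apply/eqP/eqP => [|->]; [exact: Normc.eq0_normc|exact: nm0].
Qed.

Lemma nm_gt0 x : (0 < nm x) = (x != 0).
Proof. by rewrite lt_def nm_eq0 nm_ge0 andbT. Qed.

Lemma nmD x y : nm (x + y) <= nm x + nm y.
Proof. exact: le_normcD. Qed.

Lemma nmN x : nm (- x) = nm x.
Proof. exact: normcN. Qed.

Lemma nmX x n : nm (x ^+ n) = nm x ^+ n.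
Proof. by elim: n => [|n IH]; rewrite ?expr0 ?nm1// !exprS nmM IH. Qed.

Lemma nmB x y : nm (x - y) <= nm x + nm y.
Proof. by rewrite -(nmN y) nmD. Qed.

Lemma nmBC x y : nm (x - y) = nm (y - x).
Proof. by rewrite -opprB nmN. Qed.

Lemma nm_triang y x z : nm (x - z) <= nm (x - y) + nm (y - z).
Proof. by rewrite -[x - z](subrKA y) nmD. Qed.

Lemma nm_sub x y : nm x - nm y <= nm (x - y).
Proof. by rewrite lerBlDr -{1}(subrK y x) nmD. Qed.

Lemma nm_rc r : nm (rc r) = `|r|.
Proof. by rewrite /nm /rc /= expr0n addr0 sqrtr_sqr. Qed.

Lemma nm_nat n : nm (n%:R : C) = n%:R.
Proof.
have -> : (n%:R : C) = rc n%:R by rewrite /rc rmorph_nat.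
by rewrite nm_rc ger0_norm.
Qed.

Lemma nm_half : nm (2^-1 : C) = 2^-1.
Proof. by rewrite nmV nm_nat. Qed.

Lemma rcM r s : rc (r * s) = rc r * rc s.
Proof. by rewrite /rc rmorphM. Qed.

Lemma rc_gt0 r : (0 < rc r) = (0 < r).
Proof. exact: (ltcR 0 r). Qed.

Lemma rc_lt r s : (rc r < rc s) = (r < s).
Proof. exact: (ltcR r s). Qed.

Lemma rc_le r s : (rc r <= rc s) = (r <= s).
Proof. exact: (lecR r s). Qed.

Lemma pos_rc (e : C) : 0 < e -> e = rc (complex.Re e).
Proof. by move=> e0; rewrite /rc RRe_real// gtr0_real. Qed.

Lemma pos_Re (e : C) : 0 < e -> 0 < complex.Re e.
Proof. by move=> e0; rewrite -rc_gt0 -pos_rc. Qed.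

Lemma ball_nm x e y : ball x (rc e) y <-> nm (x - y) < e.
Proof. by rewrite -ball_normE /ball_ /= normE rc_lt. Qed.

Lemma nbhs_nm x (P : set C) :
  nbhs x P <-> exists2 e : R, 0 < e & forall y, nm (y - x) < e -> P y.
Proof.
split=> [/nbhs_ballP[e /= e0 eP]|[e e0 eP]].
  exists (complex.Re e); first exact: pos_Re.
  by move=> y yx; apply: eP; rewrite (pos_rc e0); apply/ball_nm; rewrite nmBC.
apply/nbhs_ballP; exists (rc e); first by rewrite /= rc_gt0.
by move=> y /ball_nm yx; apply: eP; rewrite nmBC.
Qed.

Lemma ler_eps (a b : R) : (forall e, 0 < e -> a <= b + e) -> a <= b.
Proof. by move=> h; apply/ler_addgt0Pr. Qed.

End RealNorm.

Arguments nm {R} z : simpl never.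
Arguments rc {R} r : simpl never.

(** * Limits of bounded sequences along an ultrafilter *)

Section UltraLimit.
Context {R : realType}.
Local Notation C := (cplx R).

(** An ultrafilter finer than the eventual filter: every bounded sequence has a limit along it, so
    sums and means get a limit before anything is known about their convergence. *)
Definition ufilt : set_system nat :=
  projT1 (cid (ultraFilterLemma (eventually_filter : ProperFilter \oo))).

Instance ufilt_ultra : UltraFilter ufilt.
Proof. by rewrite /ufilt; case: cid => /= G []. Qed.

Instance ufilt_proper : ProperFilter ufilt.
Proof. exact: ultra_proper. Qed.

Lemma ufilt_eventually (P : set nat) (N : nat) :
  (forall n, (N <= n)%N -> P n) -> ufilt P.
Proof.
move=> NP; rewrite /ufilt; case: cid => /= G [_]; apply.
by exists N => // n; exact: NP.
Qed.

Definition bounded (u : nat -> C) := exists M : R, forall n, nm (u n) <= M.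

Definition is_ulim (u : nat -> C) (l : C) :=
  forall e : R, 0 < e -> ufilt [set n | nm (u n - l) < e].

Definition ulim (u : nat -> C) : C := xget 0 [set l | is_ulim u l].

Lemma is_ulim_uniq u l l' : is_ulim u l -> is_ulim u l' -> l = l'.
Proof.
move=> ul ul'; apply/eqP; rewrite -subr_eq0 -nm_eq0; apply/negPn/negP => ll'.
have d0 : 0 < nm (l - l') / 2 by rewrite divr_gt0// lt_def ll' nm_ge0.
have [n [/= h1 h2]] := filter_ex (filterI (ul _ d0) (ul' _ d0)).
have := nm_triang (u n) l l'; rewrite [nm (l - u n)]nmBC; lra.
Qed.

Lemma ulim_eq u l : is_ulim u l -> ulim u = l.
Proof.
move=> ul; rewrite /ulim; case: xgetP => [x _ /is_ulim_uniq|/(_ l)]; first exact.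
by [].
Qed.

(** The limit is the supremum of the [x] that lie below [v n] for almost all [n]. An ultrafilter
    decides every inequality, so [sup E + e] not lying in [E] means that [v n < sup E + e] for
    almost all [n]. *)
Lemma real_ulim (v : nat -> R) (M : R) : (forall n, `|v n| <= M) ->
  exists l : R, forall e, 0 < e -> ufilt [set n | `|v n - l| < e].
Proof.
move=> vM; pose E := [set x | ufilt [set n | x <= v n]].
have vb n : - M <= v n <= M by rewrite -ler_norml.
have E0 : E (- M).
  by apply: (@ufilt_eventually _ 0) => n _ /=; case/andP: (vb n).
have Eub : ubound E M.
  move=> x Ex; have [n /= xn] := filter_ex (Ex : ufilt _).
  by apply: (le_trans xn); case/andP: (vb n).
have supE : has_sup E by split; [exists (- M)|exists M].
exists (sup E) => e e0.
have [x Ex xe] := sup_adherent e0 supE.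
have [|nE] := in_ultra_setVsetC [set n | sup E + e <= v n] ufilt_ultra.
  move=> h; have : sup E + e <= sup E by apply: ub_le_sup => //; exists M.
  by lra.
apply: filterS2 Ex nE => n /= xn /negP; rewrite -ltNge => ne.
by rewrite ltr_norml; lra.
Qed.

Lemma nm_le_ReIm (z : C) : nm z <= `|complex.Re z| + `|complex.Im z|.
Proof.
rewrite /nm; case: z => a b /=.
rewrite -(@ler_pXn2r _ 2)// ?nnegrE ?sqrtr_ge0 ?addr_ge0//.
rewrite sqr_sqrtr ?addr_ge0 ?sqr_ge0//.
rewrite sqrrD !real_normK ?num_real// lerD2r lerDl mulrn_wge0// mulr_ge0//.
Qed.

Lemma nm_ge_Re (z : C) : `|complex.Re z| <= nm z.
Proof.
rewrite /nm; case: z => a b /=.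
by rewrite -sqrtr_sqr ler_wsqrtr// lerDl sqr_ge0.
Qed.

Lemma nm_ge_Im (z : C) : `|complex.Im z| <= nm z.
Proof.
rewrite /nm; case: z => a b /=.
by rewrite -sqrtr_sqr ler_wsqrtr// lerDr sqr_ge0.
Qed.

Lemma ulimP u : bounded u -> is_ulim u (ulim u).
Proof.
move=> [M uM].
have [a ha] : exists l : R, forall e, 0 < e ->
    ufilt [set n | `|complex.Re (u n) - l| < e].
  by apply: (@real_ulim _ M) => n; exact: le_trans (nm_ge_Re _) (uM n).
have [b hb] : exists l : R, forall e, 0 < e ->
    ufilt [set n | `|complex.Im (u n) - l| < e].
  by apply: (@real_ulim _ M) => n; exact: le_trans (nm_ge_Im _) (uM n).
have ul : is_ulim u (a +i* b)%C.
  move=> e e0; have e20 : 0 < e / 2 by rewrite divr_gt0.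
  apply: filterS2 (ha _ e20) (hb _ e20) => n /= h1 h2.
  apply: le_lt_trans (nm_le_ReIm _) _.
  by case: (u n) h1 h2 => x y /= h1 h2; lra.
by rewrite (ulim_eq ul).
Qed.

Lemma bounded_cst c : bounded (fun=> c).
Proof. by exists (nm c). Qed.

Lemma boundedD u v : bounded u -> bounded v -> bounded (fun n => u n + v n).
Proof.
move=> [M uM] [N vN]; exists (M + N) => n.
by apply: le_trans (nmD _ _) _; rewrite lerD.
Qed.

Lemma ulim_near u v : (forall e : R, 0 < e ->
    exists N, forall n, (N <= n)%N -> nm (u n - v n) <= e) ->
  bounded v -> ulim u = ulim v.
Proof.
move=> uv bv; apply: ulim_eq => e e0.
have e20 : 0 < e / 2 by rewrite divr_gt0.
have [N NP] := uv _ e20.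
have NP' : ufilt [set n | nm (u n - v n) <= e / 2] by exact: ufilt_eventually NP.
apply: filterS2 NP' (ulimP bv e20) => n /= h1 h2.
have := nm_triang (v n) (u n) (ulim v); lra.
Qed.

Lemma ulim_cst c : ulim (fun=> c) = c.
Proof.
by apply: ulim_eq => e e0; apply: (@ufilt_eventually _ 0) => n _ /=;
  rewrite subrr nm0.
Qed.

Lemma ulimD u v : bounded u -> bounded v ->
  ulim (fun n => u n + v n) = ulim u + ulim v.
Proof.
move=> bu bv; apply: ulim_eq => e e0.
have e20 : 0 < e / 2 by rewrite divr_gt0.
apply: filterS2 (ulimP bu e20) (ulimP bv e20) => n /= h1 h2.
rewrite opprD addrACA; have := nmD (u n - ulim u) (v n - ulim v); lra.
Qed.

Lemma ulimZ c u : bounded u -> ulim (fun n => c * u n) = c * ulim u.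
Proof.
move=> bu; have [->|c0] := eqVneq c 0.
  rewrite mul0r -[RHS](ulim_cst 0); congr ulim.
  by apply/funext => n; rewrite mul0r.
apply: ulim_eq => e e0.
have d0 : 0 < e / nm c by rewrite divr_gt0// nm_gt0.
apply: filterS (ulimP bu d0) => n /= h1.
by rewrite -mulrBr nmM mulrC -ltr_pdivlMr// nm_gt0.
Qed.

Lemma ulim_le u (c : C) (M : R) : (forall n, nm (u n - c) <= M) ->
  nm (ulim u - c) <= M.
Proof.
move=> uM.
have bu : bounded u.
  by exists (M + nm c) => n; have := nmD (u n - c) c; rewrite subrK;
    have := uM n; lra.
apply: ler_eps => e e0.
have [n /= hn] := filter_ex (ulimP bu e0).
have := nm_triang (u n) (ulim u) c; rewrite [nm (ulim u - u n)]nmBC.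
by have := uM n; lra.
Qed.

Lemma ulim_le_eventually u (M : R) (N : nat) : bounded u ->
  (forall n, (N <= n)%N -> nm (u n) <= M) -> nm (ulim u) <= M.
Proof.
move=> bu uM; apply: ler_eps => e e0.
have [n /= [hn Mn]] :=
  filter_ex (filterI (ulimP bu e0)
    (ufilt_eventually uM : ufilt [set n | nm (u n) <= M])).
by have := nm_triang (u n) (ulim u) 0; rewrite !subr0 [nm (ulim u - u n)]nmBC; lra.
Qed.

End UltraLimit.

(** * Primitives of holomorphic functions by Goursat's bisection *)

Section Primitive.
Context {R : realType}.
Local Notation C := (cplx R).
Implicit Types (z w a b c : C) (r s e : R) (f g : C -> C).

(** The estimate is not divided by [w - z]: the case [w = z] needs no exception, and estimates
    combine linearly. *)
Definition has_deriv f (l : C) z := forall e : R, 0 < e ->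
  exists2 d : R, 0 < d & forall w, nm (w - z) < d ->
    nm (f w - f z - (w - z) * l) <= e * nm (w - z).

Definition mid z w := (z + w) / 2.

(* Midpoint sums, in place of the integral of f dz along a segment. *)
Fixpoint seg f n z w : C :=
  if n is n'.+1 then seg f n' z (mid z w) + seg f n' (mid z w) w
  else (w - z) * f (mid z w).

Lemma midC z w : mid z w = mid w z.
Proof. by rewrite /mid addrC. Qed.

Lemma segN f n z w : seg f n w z = - seg f n z w.
Proof.
elim: n z w => [|n IH] z w /=; first by rewrite midC -mulNr opprB.
by rewrite IH [seg f n (mid w z) z]IH midC opprD addrC.
Qed.

(** The midpoint rule is exact on affine integrands at every level. Hence subtracting a first-order
    Taylor polynomial does not change the sums around a triangle. *)
Lemma seg_affine (c d : C) n z w :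
  seg (fun x => c + d * x) n z w = (w - z) * (c + d * mid z w).
Proof.
elim: n z w => [//|n IH] z w /=; rewrite !IH /mid.
by field.
Qed.

Lemma segD f g n z w :
  seg (fun x => f x + g x) n z w = seg f n z w + seg g n z w.
Proof.
elim: n z w => [|n IH] z w /=; first by rewrite mulrDr.
by rewrite !IH addrACA.
Qed.

Lemma eq_seg f g n z w : f =1 g -> seg f n z w = seg g n z w.
Proof. by move=> /funext ->. Qed.

(** [seg] evaluates its integrand only at iterated midpoints of the two endpoints, so this weak form
    of convexity is enough to bound it. *)
Definition midclosed (B : set C) := forall x y, B x -> B y -> B (mid x y).

Lemma seg_le f (B : set C) (M : R) n z w : midclosed B -> B z -> B w ->
  (forall x, B x -> nm (f x) <= M) -> nm (seg f n z w) <= M * nm (w - z).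
Proof.
move=> mB + + fM; elim: n z w => [|n IH] z w Bz Bw /=.
  by rewrite nmM mulrC ler_wpM2r ?nm_ge0// fM//; exact: mB.
have Bm := mB _ _ Bz Bw.
apply: le_trans (nmD _ _) _.
have h1 : mid z w - z = (w - z) * 2^-1 by rewrite /mid; field.
have h2 : w - mid z w = (w - z) * 2^-1 by rewrite /mid; field.
have := IH _ _ Bz Bm; have := IH _ _ Bm Bw.
by rewrite h1 h2 !nmM nm_half; lra.
Qed.

Lemma midclosed_disc a r : midclosed [set z | nm (z - a) < r].
Proof.
move=> x y /= hx hy.
have -> : mid x y - a = ((x - a) + (y - a)) * 2^-1 by rewrite /mid; field.
by rewrite nmM nm_half; have := nmD (x - a) (y - a); lra.
Qed.

Lemma midclosed_cdisc a r : midclosed [set z | nm (z - a) <= r].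
Proof.
move=> x y /= hx hy.
have -> : mid x y - a = ((x - a) + (y - a)) * 2^-1 by rewrite /mid; field.
by rewrite nmM nm_half; have := nmD (x - a) (y - a); lra.
Qed.

Lemma midclosedI (A B : set C) :
  midclosed A -> midclosed B -> midclosed (A `&` B).
Proof. by move=> mA mB x y [? ?] [? ?]; split; [exact: mA|exact: mB]. Qed.

Definition tri f n a b c := seg f n a b + seg f n b c + seg f n c a.

(** The midpoints of the sides cut the triangle into four similar ones; each inner edge is run
    through in both directions and cancels by [segN]. The identity is exact at each level, with no
    limit involved. *)
Lemma triS f n a b c : tri f n.+1 a b c =
  tri f n a (mid a b) (mid c a) + tri f n (mid a b) b (mid b c)
  + tri f n (mid c a) (mid b c) c + tri f n (mid b c) (mid c a) (mid a b).
Proof.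
rewrite /tri /= (segN f n (mid a b) (mid c a)) (segN f n (mid a b) (mid b c)).
rewrite (segN f n (mid b c) (mid c a)).
by ring.
Qed.

(** The sums exceed [e] at arbitrarily fine levels. The negation is an eventual bound, so
    convergence of the sums is never an issue. *)
Definition bad f (e : R) (t : C * C * C) :=
  forall N, exists2 n, (N <= n)%N & e < nm (tri f n t.1.1 t.1.2 t.2).

Lemma not_bad f e t : ~ bad f e t ->
  exists N, forall n, (N <= n)%N -> nm (tri f n t.1.1 t.1.2 t.2) <= e.
Proof.
move=> nb; apply: contrapT => h; apply: nb => N; apply: contrapT => h'.
apply: h; exists N => n Nn; rewrite leNgt; apply/negP => en.
by apply: h'; exists n.
Qed.

Lemma bad_sub f e t : bad f e t -> exists t', bad f (e / 4) t' /\
  nm (t'.1.1 - t.1.1) <= Num.max (nm (t.1.2 - t.1.1)) (nm (t.2 - t.1.1)) /\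
  Num.max (nm (t'.1.2 - t'.1.1)) (nm (t'.2 - t'.1.1)) <=
        Num.max (nm (t.1.2 - t.1.1)) (nm (t.2 - t.1.1)) / 2.
Proof.
case: t => -[a b] c /= bt; apply: contrapT => nt.
set s := Num.max _ _ in nt.
have sb : nm (b - a) <= s by rewrite le_max lexx.
have sc : nm (c - a) <= s by rewrite le_max lexx orbT.
have good t' : nm (t'.1.1 - a) <= s -> nm (t'.1.2 - t'.1.1) <= s / 2 ->
    nm (t'.2 - t'.1.1) <= s / 2 ->
    exists N, forall n, (N <= n)%N -> nm (tri f n t'.1.1 t'.1.2 t'.2) <= e / 4.
  move=> h1 h2 h3; apply: not_bad => h; apply: nt; exists t'; split=> //.
  by split=> //; rewrite ge_max h2.
have hb : nm ((b - a) / 2) <= s / 2 by rewrite nmM nm_half; lra.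
have hc : nm ((c - a) / 2) <= s / 2 by rewrite nmM nm_half; lra.
have s0 : 0 <= s by exact: le_trans (nm_ge0 _) sb.
have [|||N1 h1] := good (a, mid a b, mid c a) => /=.
- by rewrite subrr nm0.
- by rewrite (_ : _ - _ = (b - a) / 2)//; rewrite /mid; field.
- by rewrite (_ : _ - _ = (c - a) / 2)//; rewrite /mid; field.
have [|||N2 h2] := good (mid a b, b, mid b c) => /=.
- by rewrite (_ : _ - _ = (b - a) / 2); [lra|rewrite /mid; field].
- by rewrite (_ : _ - _ = (b - a) / 2)//; rewrite /mid; field.
- by rewrite (_ : _ - _ = (c - a) / 2)//; rewrite /mid; field.
have [|||N3 h3] := good (mid c a, mid b c, c) => /=.
- by rewrite (_ : _ - _ = (c - a) / 2); [lra|rewrite /mid; field].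
- by rewrite (_ : _ - _ = (b - a) / 2)//; rewrite /mid; field.
- by rewrite (_ : _ - _ = (c - a) / 2)//; rewrite /mid; field.
have [|||N4 h4] := good (mid b c, mid c a, mid a b) => /=.
- rewrite (_ : _ - _ = (b - a) / 2 + (c - a) / 2); last by rewrite /mid; field.
  by apply: le_trans (nmD _ _) _; lra.
- by rewrite (_ : _ - _ = - ((b - a) / 2)) ?nmN//; rewrite /mid; field.
- by rewrite (_ : _ - _ = - ((c - a) / 2)) ?nmN//; rewrite /mid; field.
(* [triS] lowers the level by one, and the sum of the four thresholds dominates each of them. *)
have [[|n] Nn] := bt (N1 + N2 + N3 + N4).+1; first by [].
rewrite triS => /=; apply/negP; rewrite -leNgt.
have l1 := h1 n ltac:(lia); have l2 := h2 n ltac:(lia).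
have l3 := h3 n ltac:(lia); have l4 := h4 n ltac:(lia).
rewrite /= in l1 l2 l3 l4.
apply: le_trans (nmD _ _) _; apply: le_trans (lerD (nmD _ _) (lexx _)) _.
apply: le_trans (lerD (lerD (nmD _ _) (lexx _)) (lexx _)) _.
by lra.
Qed.

Lemma bad_seq f e t (s : R) : bad f e t ->
  nm (t.1.2 - t.1.1) <= s -> nm (t.2 - t.1.1) <= s ->
  exists T : nat -> C * C * C,
    [/\ T 0%N = t,
        (forall k, bad f (e / 4 ^+ k) (T k)),
        (forall k, nm ((T k.+1).1.1 - (T k).1.1) <= s / 2 ^+ k),
        (forall k, nm ((T k).1.2 - (T k).1.1) <= s / 2 ^+ k) &
        (forall k, nm ((T k).2 - (T k).1.1) <= s / 2 ^+ k)].
Proof.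
move=> bt t1 t2.
pose m (u : C * C * C) := Num.max (nm (u.1.2 - u.1.1)) (nm (u.2 - u.1.1)).
have next (p : R * (C * C * C)) : exists t', bad f p.1 p.2 ->
    bad f (p.1 / 4) t' /\ nm (t'.1.1 - p.2.1.1) <= m p.2 /\ m t' <= m p.2 / 2.
  have [bp|nb] := pselect (bad f p.1 p.2); last by exists p.2.
  by have [t' h] := bad_sub bp; exists t'.
have [N NP] := choice next.
pose S := fix S k := if k is k'.+1 then N (e / 4 ^+ k', S k') else t.
have Sbad k : bad f (e / 4 ^+ k) (S k).
  elim: k => [|k IH]; first by rewrite expr0 divr1.
  have [/= + _] := NP (_, S k) IH.
  by rewrite exprSr invfM mulrA.
have Sm k : m (S k) <= s / 2 ^+ k.
  elim: k => [|k IH]; first by rewrite expr0 divr1 ge_max t1.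
  have [/= _ [_]] := NP (_, S k) (Sbad k).
  rewrite exprSr invfM => h; apply: le_trans h _.
  by rewrite mulrA ler_wpM2r// invr_ge0.
exists S; split=> // k.
- have [/= _ [h _]] := NP (_, S k) (Sbad k).
  by apply: le_trans h _; exact: Sm.
- by apply: le_trans (Sm k); rewrite le_max lexx.
- by apply: le_trans (Sm k); rewrite le_max lexx orbT.
Qed.

Lemma exp2_small (s d : R) : 0 < d -> exists k, s / 2 ^+ k < d.
Proof.
move=> d0; pose k := Num.bound (`|s| / d).
exists k; rewrite ltr_pdivrMr ?exprn_gt0// mulrC -ltr_pdivrMr//.
have h : `|s| / d < k%:R by apply: archi_boundP; rewrite divr_ge0// ltW.
apply: le_lt_trans (lt_le_trans h _).
  by rewrite ler_pM2r ?invr_gt0// ler_norm.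
by rewrite -natrX ler_nat ltnW// ltn_expl.
Qed.

Lemma tri_le f (B : set C) (M s : R) n a b c : midclosed B -> B a -> B b -> B c ->
  (forall x, B x -> nm (f x) <= M) -> 0 <= M ->
  nm (b - a) <= s -> nm (c - a) <= s -> nm (tri f n a b c) <= M * (4 * s).
Proof.
move=> mB Ba Bb Bc fM M0 hb hc.
have h1 := @seg_le f B M n a b mB Ba Bb fM.
have h2 := @seg_le f B M n b c mB Bb Bc fM.
have h3 := @seg_le f B M n c a mB Bc Ba fM.
have hbc : nm (c - b) <= s + s.
  by have := nm_triang a c b; rewrite [nm (a - b)]nmBC; lra.
have hca : nm (a - c) <= s by rewrite nmBC.
have k1 : M * nm (b - a) <= M * s by rewrite ler_wpM2l.
have k2 : M * nm (c - b) <= M * (s + s) by rewrite ler_wpM2l.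
have k3 : M * nm (a - c) <= M * s by rewrite ler_wpM2l.
rewrite /tri; apply: le_trans (nmD _ _) _.
by apply: le_trans (lerD (nmD _ _) (lexx _)) _; lra.
Qed.

Lemma tri_affine (c d : C) n x y z : tri (fun u => c + d * u) n x y z = 0.
Proof. by rewrite /tri !seg_affine /mid; field. Qed.

(** Nested bad triangles shrink to a point [p]. There [f] is affine up to a remainder of smaller
    order; the affine part has zero sums, and the remainder is too small for triangles whose size is
    halved while their badness is only divided by 4. The sides are at most [2 * r], so [p] is within
    [4 * r] of [a], whence the radius [5 * r]. *)
Lemma goursat f f' (z0 : C) r a b c :
  (forall z, nm (z - z0) < 5 * r -> has_deriv f (f' z) z) ->
  nm (a - z0) < r -> nm (b - z0) < r -> nm (c - z0) < r ->
  forall e, 0 < e -> exists N, forall n, (N <= n)%N -> nm (tri f n a b c) <= e.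
Proof.
move=> df ra rb rc0 e e0.
apply: (@not_bad f e (a, b, c)) => bt.
have r0 : 0 < r by exact: le_lt_trans (nm_ge0 _) ra.
pose s := 2 * r.
have sb : nm (b - a) <= s.
  by have := nm_triang z0 b a; rewrite [nm (z0 - a)]nmBC /s; lra.
have sc : nm (c - a) <= s.
  by have := nm_triang z0 c a; rewrite [nm (z0 - a)]nmBC /s; lra.
have [T [T0 Tbad T1 T2 T3]] := bad_seq bt sb sc.
pose v k := (T k).1.1.
have s0 : 0 < s by rewrite /s; lra.
have p2 k : (0 : R) < 2 ^+ k by rewrite exprn_gt0.
(* A geometric series: the step from index [k + l] moves the vertex by at most
   [s / 2 ^+ (k + l)]. *)
have vv k j : nm (v (k + j)%N - v k) <= s / 2 ^+ k * (2 - 2 / 2 ^+ j).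
  elim: j => [|j IH]; first by rewrite addn0 expr0 subrr nm0 divr1 subrr mulr0.
  rewrite addnS; have := nm_triang (v (k + j)%N) (v (k + j).+1) (v k).
  have := T1 (k + j)%N; rewrite -/(v _) -/(v _).
  have -> : s / 2 ^+ (k + j) = s / 2 ^+ k / 2 ^+ j by rewrite exprD invfM mulrA.
  have -> : s / 2 ^+ k * (2 - 2 / 2 ^+ j.+1) = s / 2 ^+ k * 2 - s / 2 ^+ k / 2 ^+ j.
    by rewrite exprS; field; rewrite !gt_eqF.
  have E : s / 2 ^+ k * (2 - 2 / 2 ^+ j) = s / 2 ^+ k * 2 - 2 * (s / 2 ^+ k / 2 ^+ j).
    by field; rewrite !gt_eqF.
  by move: IH; rewrite E; lra.
have vle k n : (k <= n)%N -> nm (v n - v k) <= 2 * s / 2 ^+ k.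
  move=> kn; rewrite -(subnKC kn); apply: le_trans (vv _ _) _.
  have h : 0 <= s / 2 ^+ k / 2 ^+ (n - k).
    by rewrite !divr_ge0// ?ltW.
  have -> : 2 * s / 2 ^+ k = 2 * (s / 2 ^+ k) by rewrite mulrA.
  by move: h; set q := (_ ^+ (n - k))^-1; set q' := s / _; lra.
have bv : bounded v.
  exists (2 * s + nm (v 0%N)) => n.
  have := nm_sub (v n) (v 0%N); have := vle 0%N n (leq0n _).
  by rewrite expr0 divr1; lra.
pose p := ulim v.
have pv k : nm (p - v k) <= 2 * s / 2 ^+ k.
  rewrite -[v k]ulim_cst.
  have -> : p - ulim (fun=> v k) = ulim (fun n => v n - v k).
    rewrite (ulimD (v := fun=> - v k)) ?ulim_cst//; exact: bounded_cst.
  apply: (@ulim_le_eventually _ _ _ k); last by move=> n; exact: vle.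
  exact/boundedD/bounded_cst.
have pz : nm (p - z0) < 5 * r.
  have := nm_triang a p z0; have := pv 0%N.
  by rewrite expr0 divr1 /v T0 /= /s; lra.
(* [tri_le] will bound the sums by [12 * h * q ^+ 2] with [q = s / 2 ^+ k]; the factor 40 brings
   this below [e / 4 ^+ k]. *)
pose h := e / (40 * s * s).
have h0 : 0 < h by rewrite divr_gt0// mulr_gt0// mulr_gt0.
have [d d0 dP] := df _ pz _ h0.
have [k kd] := exp2_small (8 * s) d0.
have hk : nm (p - v k) <= 2 * (s / 2 ^+ k) by rewrite mulrA.
set q := s / 2 ^+ k in hk.
have q0 : 0 < q by rewrite divr_gt0.
have qd : 8 * q < d by rewrite /q mulrA.
have hT2 : nm ((T k).1.2 - v k) <= q by exact: T2.
have hT3 : nm ((T k).2 - v k) <= q by exact: T3.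
pose B := [set z | nm (z - p) <= 3 * q].
have B1 : B (v k) by rewrite /B /= nmBC; lra.
have B2 : B (T k).1.2.
  by have := nm_triang (v k) (T k).1.2 p; rewrite /B /= [nm (v k - p)]nmBC; lra.
have B3 : B (T k).2.
  by have := nm_triang (v k) (T k).2 p; rewrite /B /= [nm (v k - p)]nmBC; lra.
pose rem z := f z - f p - (z - p) * f' p.
have remB z : B z -> nm (rem z) <= h * (3 * q).
  move=> Bz; apply: le_trans (dP _ _) _; first by rewrite /B /= in Bz; lra.
  by rewrite ler_wpM2l// ltW.
have tE n x y u : tri f n x y u = tri rem n x y u.
  rewrite -[RHS]addr0 -(tri_affine (f p - p * f' p) (f' p) n x y u).
  rewrite /tri [RHS]addrACA [X in _ = X + _]addrACA -!segD.
  by congr (_ + _ + _); apply: eq_seg => w; rewrite /rem; ring.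
have [n _] := Tbad k 0%N.
rewrite tE => /=; apply/negP; rewrite -leNgt.
have hq : 0 <= h * (3 * q) by rewrite mulr_ge0 ?ltW// mulr_gt0.
apply: le_trans (tri_le n (midclosed_cdisc (a:=p) (r:=3 * q))
   B1 B2 B3 remB hq hT2 hT3) _.
have -> : (4 : R) ^+ k = 2 ^+ k * 2 ^+ k.
  by rewrite -exprMn; congr (_ ^+ _); ring.
have := p2 k; rewrite /q /h; move: (2 ^+ k) => P P0.
have -> : e / (40 * s * s) * (3 * (s / P)) * (4 * (s / P)) =
    12 / 40 * (e / (P * P)).
  by field; rewrite ?gt_eqF.
have : 0 < e / (P * P) by rewrite divr_gt0// mulr_gt0.
by lra.
Qed.

(** [F w] is the limit of the midpoint sums from the centre [z0]; Goursat on the triangle [z0], [z],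
    [w] turns [F w - F z] into the limit of the sums from [z] to [w]. The constant [c] is left free
    for three uses: [c = 0] gives a Lipschitz bound, [c = f z] differentiability, and [c = f z] with
    a Lipschitz [f] a quadratic remainder. *)
Lemma primitive f f' (z0 : C) r M :
  (forall z, nm (z - z0) < 5 * r -> has_deriv f (f' z) z) ->
  (forall z, nm (z - z0) < r -> nm (f z) <= M) ->
  exists F : C -> C, forall z w c K,
    nm (z - z0) < r -> nm (w - z0) < r ->
    (forall x, nm (x - z0) < r -> nm (x - z) <= nm (w - z) ->
       nm (f x - c) <= K) ->
    nm (F w - F z - (w - z) * c) <= K * nm (w - z).
Proof.
move=> df fM; pose L z w := ulim (fun n => seg f n z w).
have mD := @midclosed_disc z0 r.
have segM n z w : nm (z - z0) < r -> nm (w - z0) < r ->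
    nm (seg f n z w) <= M * nm (w - z).
  by move=> hz hw; apply: (seg_le n mD).
have bL z w : nm (z - z0) < r -> nm (w - z0) < r ->
    bounded (fun n => seg f n z w).
  by move=> hz hw; exists (M * nm (w - z)) => n; exact: segM.
exists (L z0) => z w c K hz hw fK.
have r0 : 0 < r by exact: le_lt_trans (nm_ge0 _) hz.
have hz0 : nm (z0 - z0) < r by rewrite subrr nm0.
have -> : L z0 w - L z0 z = L z w.
  have -> : L z0 w = ulim (fun n => seg f n z0 z + seg f n z w).
    apply: ulim_near; last by apply: boundedD; exact: bL.
    move=> e e0; have [N NP] := goursat df hz0 hz hw e0.
    exists N => n Nn; rewrite nmBC; apply: le_trans (NP n Nn).
    by rewrite /tri (segN f n z0 w).
  by rewrite ulimD; [rewrite addrAC subrr add0r|exact: bL|exact: bL].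
apply: ulim_le => n.
have -> : seg f n z w - (w - z) * c = seg (fun x => f x - c) n z w.
  rewrite (segD f (fun=> - c)); congr (_ + _).
  rewrite (@eq_seg _ (fun x => - c + 0 * x)); last by move=> x; ring.
  by rewrite seg_affine; ring.
apply: (@seg_le _ ([set x | nm (x - z0) < r] `&`
                   [set x | nm (x - z) <= nm (w - z)])).
- exact: midclosedI mD (@midclosed_cdisc _ _).
- by split=> //=; rewrite subrr nm0 nm_ge0.
- by split=> /=.
- by move=> x [/=]; exact: fK.
Qed.

End Primitive.

(** * The Cauchy formula for functions with a uniform quadratic remainder *)

Section CauchyFormula.
Context {R : realType}.
Local Notation C := (cplx R).
Implicit Types (z w : C) (r s e K M : R) (f g : C -> C).

(** One constant serves the whole disc. Such a bound passes through the mean by [Lam_le], which a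
    pointwise derivative need not do. *)
Definition quad z0 r f (f' : C -> C) K := forall z w,
  nm (z - z0) < r -> nm (w - z0) < r ->
  nm (f w - f z - (w - z) * f' z) <= K * nm (w - z) ^+ 2.

Lemma has_deriv_cont f l z : has_deriv f l z -> forall e, 0 < e ->
  exists2 d : R, 0 < d & forall w, nm (w - z) < d -> nm (f w - f z) < e.
Proof.
move=> df e e0; have [d d0 dP] := df 1 ltr01.
have l1 : 0 < nm l + 1 by have := nm_ge0 l; lra.
exists (Num.min d (e / (nm l + 1))).
  by rewrite lt_min d0 divr_gt0.
move=> w; rewrite lt_min ltr_pdivlMr// => /andP[wd we].
have := nmD (f w - f z - (w - z) * l) ((w - z) * l); rewrite subrK nmM.
by have := dP w wd; rewrite mul1r; lra.
Qed.

(** Each use of [primitive] costs a factor 5 in the radius, hence 25. The first primitive is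
    [M]-Lipschitz because [f] is bounded by [M], and a primitive of a Lipschitz function has a
    quadratic remainder: a merely differentiable [f] thus leads to a function satisfying [quad]. *)
Lemma double_primitive f f' z0 r M :
  (forall z, nm (z - z0) < 25 * r -> has_deriv f (f' z) z) ->
  (forall z, nm (z - z0) < 5 * r -> nm (f z) <= M) ->
  exists F G B, [/\ quad z0 r G F M,
    forall z, nm (z - z0) < r -> has_deriv F (f z) z &
    forall z, nm (z - z0) < r -> nm (G z) <= B /\ nm (F z) <= B].
Proof.
move=> df fM.
have df5 z : nm (z - z0) < 5 * (5 * r) -> has_deriv f (f' z) z.
  by rewrite mulrA -natrM; exact: df.
have [F FP] := primitive df5 fM.
have dF z : nm (z - z0) < 5 * r -> has_deriv F (f z) z.
  move=> hz e e0.
  have r0 : 0 < r by have := nm_ge0 (z - z0); lra.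
  have dfz : has_deriv f (f' z) z by apply: df; lra.
  have [d d0 dP] := has_deriv_cont dfz e0.
  exists (Num.min d (5 * r - nm (z - z0))).
    by rewrite lt_min d0 subr_gt0.
  move=> w; rewrite lt_min => /andP[wd wr]; apply: FP => //.
    by have := nm_triang z w z0; lra.
  by move=> x _ xw; apply/ltW/dP; exact: le_lt_trans wd.
have lipF x z : nm (x - z0) < 5 * r -> nm (z - z0) < 5 * r ->
    nm (F x - F z) <= M * nm (x - z).
  move=> hx hz; have := FP z x 0 M hz hx; rewrite mulr0 subr0; apply.
  by move=> y hy _; rewrite subr0; exact: fM.
(* For [r <= 0] the discs are empty and any witnesses do. *)
have [r0|r0] := ltP 0 r; last first.
  by exists F, F, 0; split=> [z w|z|z]; have := nm_ge0 (z - z0); lra.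
have FM z : nm (z - z0) < r -> nm (F z) <= nm (F z0) + M * r.
  move=> hz; have hz0 : nm (z0 - z0) < 5 * r by rewrite subrr nm0; lra.
  have M0 : 0 <= M by exact: le_trans (nm_ge0 _) (fM _ hz0).
  have hz5 : nm (z - z0) < 5 * r by lra.
  have := lipF _ _ hz5 hz0; have := nm_sub (F z) (F z0).
  have : M * nm (z - z0) <= M * r by rewrite ler_wpM2l// ltW.
  by lra.
have [G GP] := primitive dF FM.
have M0 : 0 <= M.
  by apply: le_trans (nm_ge0 _) (fM z0 _); rewrite subrr nm0; lra.
have qG : quad z0 r G F M.
  move=> z w hz hw; rewrite expr2 mulrA; apply: GP => //.
  move=> x hx xw; apply: le_trans (lipF _ _ _ _) _; [lra|lra|].
  by rewrite ler_wpM2l.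
have hz0 : nm (z0 - z0) < r by rewrite subrr nm0.
pose B0 := nm (F z0) + M * r.
have B0_ge0 : 0 <= B0 by rewrite addr_ge0 ?nm_ge0 ?mulr_ge0 ?(ltW r0).
exists F, G, (nm (G z0) + r * B0 + M * r ^+ 2 + B0); split=> //.
  by move=> z hz; apply: dF; lra.
move=> z hz; have := qG _ _ hz0 hz.
have h1 : M * nm (z - z0) ^+ 2 <= M * r ^+ 2.
  by rewrite ler_wpM2l// lerXn2r ?nnegrE ?nm_ge0 ?(ltW r0)// ltW.
have h2 : nm ((z - z0) * F z0) <= r * B0.
  by rewrite nmM ler_pM ?nm_ge0 ?(ltW hz) ?FM.
have := nmD (G z - G z0 - (z - z0) * F z0) ((z - z0) * F z0); rewrite subrK.
have := nm_sub (G z) (G z0); have := nm_ge0 (G z0); have := FM _ hz.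
have : 0 <= M * r ^+ 2 by rewrite mulr_ge0 ?sqr_ge0.
have : 0 <= r * B0 by rewrite mulr_ge0 ?(ltW r0).
rewrite -/B0; lra.
Qed.

(** By the parallelogram identity the squared distances of the two roots from [-1] add up to 4, so
    one of them is at least 2. *)
Lemma unit_sqrt (x : C) : nm x = 1 -> exists y,
  [/\ y ^+ 2 = x, nm y = 1 & 2 <= nm (y + 1) ^+ 2].
Proof.
move=> x1; have sx : sqrtC x ^+ 2 = x by rewrite sqrtCK.
have y1 : nm (sqrtC x) = 1.
  apply/eqP; rewrite -(@eqrXn2 _ 2)// ?nm_ge0//.
  by rewrite -nmX sx x1 expr1n.
have par : nm (sqrtC x + 1) ^+ 2 + nm (- sqrtC x + 1) ^+ 2 = 4.
  have sq (u : C) : nm u ^+ 2 = complex.Re u ^+ 2 + complex.Im u ^+ 2.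
    by rewrite /nm; case: u => a b /=; rewrite sqr_sqrtr// addr_ge0 ?sqr_ge0.
  move: y1 => /(congr1 (fun t => t ^+ 2)); rewrite !sq.
  by case: (sqrtC x) => a b /=; rewrite expr1n; lra.
have [h|h] := leP 2 (nm (sqrtC x + 1) ^+ 2); first by exists (sqrtC x).
by exists (- sqrtC x); split; [rewrite sqrrN|rewrite nmN|lra].
Qed.

(** Iterated square roots of [-1], always on the side away from [-1]. If [y ^+ 2 = x], then
    [|y - 1| |y + 1| = |x - 1|]; with [|y + 1|^2 >= 2] the squared distance to 1 is at least halved
    at each step. Roots of unity tending to 1 are obtained in this way without the exponential
    function. *)
Lemma roots_of_unity : exists om : nat -> C, forall n,
  [/\ nm (om n) = 1, om n ^+ (2 ^ n.+1) = 1, om n != 1 &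
      nm (om n - 1) ^+ 2 <= 4 / 2 ^+ n].
Proof.
have next (x : C) : exists y, nm x = 1 ->
    [/\ y ^+ 2 = x, nm y = 1 & 2 <= nm (y + 1) ^+ 2].
  have [/unit_sqrt[y h]|h] := pselect (nm x = 1); first by exists y.
  by exists x.
have [S SP] := choice next.
exists (fun n => iter n S (- 1)); elim=> [|n [h1 h2 h3 h4]].
  split => /=; first by rewrite nmN nm1.
  - by rewrite expn1 sqrrN expr1n.
  - by rewrite eq_sym -subr_eq0 opprK (_ : 1 + 1 = 2%:R)// pnatr_eq0.
  - by rewrite -opprD nmN (_ : 1 + 1 = 2%:R)// nm_nat expr0 divr1; lra.
rewrite iterS; move: (iter n S _) h1 h2 h3 h4 => x h1 h2 h3 h4.
have [s1 s2 s3] := SP x h1; split=> //.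
- by rewrite expnS exprM s1.
- by apply/eqP => s; move: h3; rewrite -s1 s expr1n eqxx.
have E : nm (S x - 1) ^+ 2 * nm (S x + 1) ^+ 2 = nm (x - 1) ^+ 2.
  by rewrite -exprMn -nmM -subr_sqr expr1n s1.
rewrite (exprS 2) invfM mulrCA.
have : nm (S x - 1) ^+ 2 * 2 <= nm (S x - 1) ^+ 2 * nm (S x + 1) ^+ 2.
  by rewrite ler_wpM2l// exprn_ge0// nm_ge0.
rewrite E; lra.
Qed.

Definition om : nat -> C := projT1 (cid roots_of_unity).

Lemma omP n : [/\ nm (om n) = 1, om n ^+ (2 ^ n.+1) = 1, om n != 1 &
      nm (om n - 1) ^+ 2 <= 4 / 2 ^+ n].
Proof. by rewrite /om; case: cid => /= o; exact. Qed.

Definition avg n f : C := (2 ^ n.+1)%:R^-1 * \sum_(k < 2 ^ n.+1) f (om n ^+ k).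

(* A generalized mean over the unit circle, standing in for the Cauchy integral. *)
Definition Lam f : C := ulim (fun n => avg n f).

Lemma avg_le n f M : (forall u, nm u = 1 -> nm (f u) <= M) -> nm (avg n f) <= M.
Proof.
move=> fM; rewrite /avg nmM nmV nm_nat mulrC ler_pdivrMr; last first.
  by rewrite ltr0n expn_gt0.
have {fM} fM (k : nat) : nm (f (om n ^+ k)) <= M.
  by apply: fM; rewrite nmX; case: (omP n) => ->; rewrite expr1n.
elim: (2 ^ n.+1)%N => [|m IH]; first by rewrite big_ord0 nm0 mulr0.
rewrite big_ord_recr/=; apply: le_trans (nmD _ _) _.
by rewrite -natr1 mulrDr mulr1 lerD.
Qed.

Definition ubounded f := exists M, forall u, nm u = 1 -> nm (f u) <= M.

Lemma avg_bounded f : ubounded f -> bounded (fun n => avg n f).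
Proof. by move=> [M fM]; exists M => n; exact: avg_le. Qed.

Lemma eq_avg n f g : (forall u, nm u = 1 -> f u = g u) -> avg n f = avg n g.
Proof.
move=> fg; rewrite /avg; congr (_ * _); apply: eq_bigr => k _; apply: fg.
by rewrite nmX; case: (omP n) => ->; rewrite expr1n.
Qed.

Lemma eq_Lam f g : (forall u, nm u = 1 -> f u = g u) -> Lam f = Lam g.
Proof.
by move=> fg; rewrite /Lam; congr ulim; apply/funext => n; exact: eq_avg.
Qed.

Lemma Lam_le f M : (forall u, nm u = 1 -> nm (f u) <= M) -> nm (Lam f) <= M.
Proof.
move=> fM; have := @ulim_le _ (fun n => avg n f) 0 M; rewrite subr0; apply.
by move=> n; rewrite subr0; exact: avg_le.
Qed.

Lemma LamD f g : ubounded f -> ubounded g ->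
  Lam (fun u => f u + g u) = Lam f + Lam g.
Proof.
move=> bf bg; rewrite /Lam -ulimD; [|exact: avg_bounded|exact: avg_bounded].
by congr ulim; apply/funext => n; rewrite /avg -mulrDr -big_split.
Qed.

Lemma LamZ c f : ubounded f -> Lam (fun u => c * f u) = c * Lam f.
Proof.
move=> bf; rewrite /Lam -ulimZ; last exact: avg_bounded.
congr ulim; apply/funext => n; rewrite /avg mulrCA; congr (_ * _).
by rewrite mulr_sumr.
Qed.

Lemma Lam_cst c : Lam (fun=> c) = c.
Proof.
rewrite /Lam -[RHS]ulim_cst; congr ulim; apply/funext => n.
rewrite /avg sumr_const card_ord -[c *+ _]mulr_natl mulrA mulVf ?mul1r//.
Qed.

Lemma uboundedD f g : ubounded f -> ubounded g -> ubounded (fun u => f u + g u).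
Proof.
move=> [M fM] [N gN]; exists (M + N) => u u1.
by apply: le_trans (nmD _ _) _; rewrite lerD ?fM ?gN.
Qed.

Lemma uboundedM f g : ubounded f -> ubounded g -> ubounded (fun u => f u * g u).
Proof.
move=> [M fM] [N gN]; exists (M * N) => u u1.
by rewrite nmM ler_pM ?nm_ge0 ?fM ?gN.
Qed.

Lemma ubounded_cst c : ubounded (fun=> c).
Proof. by exists (nm c). Qed.

Lemma ubounded_id : ubounded id.
Proof. by exists 1 => u ->. Qed.

Lemma LamB f g : ubounded f -> ubounded g ->
  Lam (fun u => f u - g u) = Lam f - Lam g.
Proof.
move=> bf bg; rewrite (LamD bf (g := fun u => - g u)); last first.
  by case: bg => N gN; exists N => u u1; rewrite nmN gN.
congr (_ + _); rewrite -mulN1r -LamZ//.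
by apply: eq_Lam => u _; rewrite mulN1r.
Qed.

(* The sums of h (w u) - h u over the powers of a root of unity w telescope. *)
Lemma Lam_telescope (h h' : C -> C) K :
  (forall u u', nm u = 1 -> nm u' = 1 ->
     nm (h u' - h u - (u' - u) * h' u) <= K * nm (u' - u) ^+ 2) ->
  Lam (fun u => u * h' u) = 0.
Proof.
move=> hK.
have K0 : 0 <= K.
  have := hK 1 (-1); rewrite nmN nm1 => /(_ erefl erefl) /(le_trans (nm_ge0 _)).
  by rewrite -opprD nmN (_ : 1 + 1 = 2%:R)// nm_nat -natrX pmulr_lge0.
rewrite /Lam -(ulim_cst (0 : C)); apply: ulim_near; last exact: bounded_cst.
move=> e e0.
(* The mean will turn out to be at most [K * nm (om n - 1)], whose square is at most
   [4 * K ^+ 2 / 2 ^+ n]. *)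
have [N hN] := exp2_small (4 * K ^+ 2) (exprn_gt0 2 e0).
exists N => n Nn; rewrite subr0.
have [w1 w2 w3 w4] := omP n.
have d0 : 0 < nm (om n - 1) by rewrite nm_gt0 subr_eq0.
have shift : avg n (fun u => h (om n * u) - h u) = 0.
  rewrite /avg sumrB (eq_bigr (fun k : 'I__ => h (om n ^+ k.+1))); last first.
    by move=> k _; rewrite exprS.
  have -> : \sum_(k < 2 ^ n.+1) h (om n ^+ k.+1) =
      \sum_(k < 2 ^ n.+1) h (om n ^+ k).
    apply: (addrI (h (om n ^+ 0))).
    rewrite -(big_ord_recl _ (fun k : 'I_(2 ^ n.+1).+1 => h (om n ^+ k))).
    by rewrite big_ord_recr /= w2 expr0 addrC.
  by rewrite subrr mulr0.
have E : (om n - 1) * avg n (fun u => u * h' u) =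
    - avg n (fun u => h (om n * u) - h u - (om n * u - u) * h' u).
  rewrite /avg; under [in RHS]eq_bigr do rewrite -/(_ - _).
  rewrite [in RHS]sumrB mulrBr -/(avg n (fun u => h (om n * u) - h u)) shift.
  rewrite sub0r opprK mulrCA; congr (_ * _); rewrite mulr_sumr.
  by apply: eq_bigr => k _; ring.
have : nm (om n - 1) * nm (avg n (fun u => u * h' u)) <=
    nm (om n - 1) * (K * nm (om n - 1)).
  rewrite -nmM E nmN; apply: avg_le => u u1.
  apply: le_trans (hK _ _ u1 _) _; first by rewrite nmM w1 u1 mulr1.
  have -> : om n * u - u = (om n - 1) * u by ring.
  by rewrite nmM u1 mulr1 expr2 mulrCA.
rewrite ler_pM2l// => /le_trans; apply.
rewrite -(@ler_pXn2r _ 2)// ?nnegrE ?mulr_ge0 ?nm_ge0 ?(ltW e0)//.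
apply: le_trans (ltW hN); rewrite exprMn.
apply: le_trans (ler_wpM2l (sqr_ge0 _) w4) _.
rewrite mulrA [_ * 4]mulrC ler_wpM2l ?mulr_ge0 ?sqr_ge0//.
by rewrite lef_pV2 ?posrE ?exprn_gt0// ler_eXn2l// ltr1n.
Qed.

(** Cutting the unit interval into [n] equal pieces bounds the total change by [n * (K / n ^+ 2)].
    In the two homotopies below this replaces the argument that a function with zero derivative is
    constant. *)
Lemma holder2_const (phi : R -> C) K :
  (forall s t, 0 <= s <= 1 -> 0 <= t <= 1 ->
     nm (phi t - phi s) <= K * (t - s) ^+ 2) -> phi 0 = phi 1.
Proof.
move=> phiK.
have step (n j : nat) : (j <= n)%N -> (0 < n)%N ->
    nm (phi (j%:R / n%:R) - phi 0) <= j%:R * (K / n%:R ^+ 2).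
  move=> + n0; elim: j => [|j IH] jn; first by rewrite !mul0r subrr nm0.
  have rg (m : nat) : (m <= n)%N -> 0 <= (m%:R / n%:R : R) <= 1.
    by move=> mn; rewrite divr_ge0//= ler_pdivrMr ?ltr0n// mul1r ler_nat.
  have := phiK _ _ (rg _ (ltnW jn)) (rg _ jn).
  rewrite -natr1 mulrDl (addrC (j%:R / _)) addrK mul1r exprVn.
  have := IH (ltnW jn).
  have := nm_triang (phi (j%:R / n%:R)) (phi (n%:R^-1 + j%:R / n%:R)) (phi 0).
  by rewrite [(j%:R + 1) * _]mulrDl mul1r; lra.
have K0 : 0 <= K.
  have := phiK 0 1; rewrite !lexx !ler01 => /(_ isT isT)/(le_trans (nm_ge0 _)).
  by rewrite subr0 expr1n mulr1.
apply/eqP; rewrite eq_sym -subr_eq0 -nm_eq0 eq_le nm_ge0 andbT.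
apply: ler_eps => e e0; rewrite add0r.
have n0 : 0 < ((Num.bound (K / e)).+1)%:R :> R by rewrite ltr0n.
have := step _ _ (leqnn (Num.bound (K / e)).+1) isT.
rewrite divff ?gt_eqF// => /le_trans; apply.
rewrite (_ : _ * (K / _) = K / (Num.bound (K / e)).+1%:R); last first.
  by field; rewrite gt_eqF.
rewrite ler_pdivrMr// mulrC -ler_pdivrMr//.
have : K / e < (Num.bound (K / e))%:R by apply: archi_boundP; rewrite divr_ge0// ltW.
by move/ltW/le_trans; apply; rewrite ler_nat.
Qed.

Lemma inv_quad (d : R) (x x' : C) : 0 < d -> d <= nm x -> d <= nm x' ->
  nm (x'^-1 - x^-1 + (x' - x) * x^-1 ^+ 2) <= d^-1 ^+ 3 * nm (x' - x) ^+ 2.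
Proof.
move=> d0 dx dx'.
have x0 : x != 0 by rewrite -nm_gt0; exact: lt_le_trans dx.
have x0' : x' != 0 by rewrite -nm_gt0; exact: lt_le_trans dx'.
have -> : x'^-1 - x^-1 + (x' - x) * x^-1 ^+ 2 =
    (x' - x) ^+ 2 * (x^-1 ^+ 2 * x'^-1).
  by field; rewrite x0 x0'.
rewrite nmM nmX mulrC ler_wpM2r ?sqr_ge0// nmM nmX !nmV [d^-1 ^+ 3]exprSr.
by rewrite ler_pM ?exprn_ge0 ?invr_ge0 ?nm_ge0// ?lerXn2r ?nnegrE ?invr_ge0
  ?nm_ge0 ?(ltW d0)// lef_pV2// posrE (lt_le_trans d0).
Qed.

Lemma circ_ge (r : R) (y u : C) : nm y < r -> nm u = 1 ->
  r - nm y <= nm (rc r * u - y).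
Proof.
move=> yr u1; have := nm_sub (rc r * u) y; rewrite nmM u1 mulr1 nm_rc.
by rewrite ger0_norm//; exact: le_trans (nm_ge0 y) (ltW yr).
Qed.

(** Homotopy along [s * y]: the [s]-derivative of the integrand is [rc r * y] times
    [u / (rc r * u - s * y) ^+ 2], that is [u] times a derivative in [u], of mean 0 by
    [Lam_telescope]. So the mean changes only to second order in [s], is constant, and equals 1 at
    [s = 0]. *)
Lemma Lam_kernel r (y : C) : nm y < r ->
  Lam (fun u => rc r * u / (rc r * u - y)) = 1.
Proof.
move=> yr; have r0 : 0 < r by exact: le_lt_trans (nm_ge0 _) yr.
pose d := r - nm y; have d0 : 0 < d by rewrite subr_gt0.
have sy (s : R) : 0 <= s <= 1 -> nm (rc s * y) <= nm y.
  move=> /andP[s0 s1]; rewrite nmM nm_rc ger0_norm//.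
  by rewrite ler_piMl ?nm_ge0.
have dle s u : 0 <= s <= 1 -> nm u = 1 -> d <= nm (rc r * u - rc s * y).
  move=> hs u1; have := sy _ hs => h.
  apply: le_trans (circ_ge _ u1); last exact: le_lt_trans yr.
  by rewrite /d; lra.
have bV s : 0 <= s <= 1 -> ubounded (fun u => (rc r * u - rc s * y)^-1).
  move=> hs; exists d^-1 => u u1; rewrite nmV lef_pV2 ?posrE ?dle//.
  exact: lt_le_trans (dle _ _ hs u1).
have bru : ubounded (fun u => rc r * u).
  exact/uboundedM/ubounded_id/ubounded_cst.
pose phi s := Lam (fun u => rc r * u / (rc r * u - rc s * y)).
have -> : Lam (fun u => rc r * u / (rc r * u - y)) = phi 1.
  by apply: eq_Lam => u _; rewrite /rc mul1r.
rewrite -(@holder2_const phi (r * (d^-1 ^+ 3 * nm y ^+ 2))).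
  rewrite /phi -(Lam_cst 1); apply: eq_Lam => u u1.
  rewrite /rc mul0r subr0 divff// -nm_gt0 nmM u1 mulr1 nm_rc.
  by rewrite ger0_norm// ltW.
move=> s t hs ht; rewrite /phi -LamB; [|exact: uboundedM bru (bV _ _)..].
have tel : Lam (fun u => u * (rc r * u - rc s * y)^-1 ^+ 2) = 0.
  apply: (@Lam_telescope (fun u => - (rc r)^-1 * (rc r * u - rc s * y)^-1) _
    (r * d^-1 ^+ 3)).
  move=> u u' u1 u1'.
  have rr : rc r != 0 by rewrite -nm_gt0 nm_rc normr_gt0 gt_eqF.
  have := inv_quad d0 (dle _ _ hs u1) (dle _ _ hs u1').
  set a := rc s * y; set x := _^-1 - _ + _ => h.
  have -> : - (rc r)^-1 * (rc r * u' - a)^-1 - - (rc r)^-1 * (rc r * u - a)^-1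
     - (u' - u) * (rc r * u - a)^-1 ^+ 2 = - (rc r)^-1 * x.
    by rewrite /x; move: (rc r * u' - a)^-1 (rc r * u - a)^-1 => X Y; field.
  rewrite nmM nmN nmV nm_rc ger0_norm ?(ltW r0)// mulrC ler_pdivrMr//.
  apply: le_trans h _.
  rewrite (_ : rc r * u' - a - (rc r * u - a) = rc r * (u' - u)); last by ring.
  by rewrite nmM nm_rc ger0_norm ?(ltW r0)//; lra.
have bV2 : ubounded (fun u => u * (rc r * u - rc s * y)^-1 ^+ 2).
  apply: uboundedM; first exact: ubounded_id.
  under [X in ubounded X]funext do rewrite expr2.
  by apply: uboundedM; exact: bV.
rewrite -[X in nm X]subr0 -[X in nm (_ - X)](mulr0 (rc r * (rc (t - s) * y))).
rewrite -tel -LamZ// -LamB; last 2 first.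
- rewrite -/(GRing.opp _); have := uboundedM bru (bV _ ht).
  move=> [A hA]; have [B hB] := uboundedM bru (bV _ hs).
  exists (A + B) => u u1; apply: le_trans (nmB _ _) _.
  by rewrite lerD ?hA ?hB.
- exact: uboundedM (ubounded_cst _) bV2.
apply: Lam_le => u u1.
have := inv_quad d0 (dle _ _ hs u1) (dle _ _ ht u1).
have -> : rc r * u - rc t * y - (rc r * u - rc s * y) = - (rc (t - s) * y).
  by rewrite /rc rmorphB; ring.
move: (rc r * u - rc t * y)^-1 (rc r * u - rc s * y)^-1 => X Y.
rewrite nmN nmM nm_rc exprMn real_normK ?num_real//.
move=> h.
rewrite (_ : rc r * u * X - rc r * u * Y -
  rc r * (rc (t - s) * y) * (u * Y ^+ 2) =
  rc r * u * (X - Y + - (rc (t - s) * y) * Y ^+ 2)); last by ring.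
rewrite 2!nmM u1 mulr1 nm_rc ger0_norm ?(ltW r0)//.
rewrite -mulrA ler_pM2l//; apply: le_trans h _; lra.
Qed.

(** The circle is contracted to [z] by [ga]. Differentiating [f (ga s u)] in [s] produces the factor
    [rc r * u - (z - z0)], which cancels the denominator of the kernel and leaves
    [rc r * u * f' (ga s u)], of mean 0 by [Lam_telescope]. At [s = 0] the claim is [Lam_kernel]. *)
Lemma cauchy_quad f f' z0 rho r K M z :
  quad z0 rho f f' K ->
  (forall z, nm (z - z0) < rho -> nm (f z) <= M /\ nm (f' z) <= M) ->
  r < rho -> nm (z - z0) < r ->
  f z = Lam (fun u => f (z0 + rc r * u) * (rc r * u / (rc r * u - (z - z0)))).
Proof.
move=> qf fM rrho zr; have r0 : 0 < r by exact: le_lt_trans (nm_ge0 _) zr.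
pose d := r - nm (z - z0); have d0 : 0 < d by rewrite subr_gt0.
pose ga s u := z + rc s * (z0 + rc r * u - z).
have gaE s u : ga s u - z0 = rc (1 - s) * (z - z0) + rc s * (rc r * u).
  by rewrite /ga /rc rmorphB rmorph1; ring.
have ga_in s u : 0 <= s <= 1 -> nm u = 1 -> nm (ga s u - z0) < rho.
  move=> /andP[s0 s1] u1; rewrite gaE; apply: le_lt_trans (nmD _ _) _.
  rewrite !nmM u1 !nm_rc !ger0_norm ?subr_ge0 ?(ltW r0)// mulr1.
  have : (1 - s) * nm (z - z0) <= (1 - s) * r by rewrite ler_wpM2l ?subr_ge0// ltW.
  by lra.
have bfga s : 0 <= s <= 1 -> ubounded (fun u => f (ga s u)).
  by move=> hs; exists M => u u1; case: (fM _ (ga_in _ _ hs u1)).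
have bf'ga s : 0 <= s <= 1 -> ubounded (fun u => f' (ga s u)).
  by move=> hs; exists M => u u1; case: (fM _ (ga_in _ _ hs u1)).
have bru : ubounded (fun u => rc r * u).
  exact/uboundedM/ubounded_id/ubounded_cst.
have bker : ubounded (fun u => rc r * u / (rc r * u - (z - z0))).
  apply: uboundedM bru _; exists d^-1 => u u1.
  rewrite nmV lef_pV2 ?posrE ?circ_ge//.
  by apply: lt_le_trans d0 _; exact: circ_ge.
have K0 : 0 <= K.
  have h1 : nm (z0 - z0) < rho by rewrite subrr nm0; lra.
  have h2 : nm (z0 + rc r - z0) < rho.
    by rewrite addrAC subrr add0r nm_rc ger0_norm ?(ltW r0).
  have := le_trans (nm_ge0 _) (qf _ _ h1 h2).
  rewrite addrAC subrr add0r nm_rc pmulr_lge0// exprn_gt0//.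
  by rewrite normr_gt0 gt_eqF.
pose phi s := Lam (fun u => f (ga s u) * (rc r * u / (rc r * u - (z - z0)))).
have phi1 : phi 1 =
    Lam (fun u => f (z0 + rc r * u) * (rc r * u / (rc r * u - (z - z0)))).
  apply: eq_Lam => u _; congr (f _ * _); rewrite /ga /rc mul1r; ring.
have phi0 : phi 0 = f z.
  rewrite -[RHS]mulr1 -(Lam_kernel zr) -LamZ//.
  by apply: eq_Lam => u _; rewrite /ga /rc mul0r addr0.
rewrite -phi0 -phi1; apply: (@holder2_const _ (K * (2 * r * r))).
move=> s t hs ht; rewrite /phi -LamB; [|exact: uboundedM (bfga _ _) bker..].
have tel : Lam (fun u => u * f' (ga s u)) = 0.
  (* For [s > 0] the antiderivative in [u] is [f (ga s u) / (s * r)]; for [s = 0] the contracted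
     circle is a point and [f' z * u] takes its place. *)
  have [s0|s0] := eqVneq s 0.
    apply: (@Lam_telescope (fun u => f' z * u) _ 0) => u u' u1 u1'.
    rewrite s0 /ga /rc mul0r addr0 mul0r.
    rewrite (_ : _ - _ - _ = 0); first by rewrite nm0.
    by ring.
  have sr0 : 0 < s * r by rewrite mulr_gt0// lt_def s0; case/andP: hs.
  have src : rc (s * r) != 0 by rewrite -nm_gt0 nm_rc normr_gt0 gt_eqF.
  apply: (@Lam_telescope (fun u => (rc (s * r))^-1 * f (ga s u)) _
    (K * (s * r))) => u u' u1 u1'.
  have := qf _ _ (ga_in _ _ hs u1) (ga_in _ _ hs u1').
  have -> : ga s u' - ga s u = rc (s * r) * (u' - u).
    by rewrite /ga /rc rmorphM; ring.
  move: (f (ga s u')) (f (ga s u)) (f' (ga s u)) => a b c h.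
  have -> : (rc (s * r))^-1 * a - (rc (s * r))^-1 * b - (u' - u) * c =
      (rc (s * r))^-1 * (a - b - rc (s * r) * (u' - u) * c).
    by rewrite mulrBr mulrBr -[rc (s * r) * _ * c]mulrA mulKf.
  rewrite nmM nmV nm_rc ger0_norm ?(ltW sr0)// mulrC ler_pdivrMr//.
  apply: le_trans h _; rewrite nmM nm_rc ger0_norm ?(ltW sr0)//; lra.
rewrite -[X in nm X]subr0 -[X in nm (_ - X)](mulr0 (rc r * rc (t - s))).
have buf : ubounded (fun u => u * f' (ga s u)).
  by apply: uboundedM; [exact: ubounded_id|exact: bf'ga].
rewrite -tel -LamZ// -LamB; last 2 first.
- have [A hA] := uboundedM (bfga _ ht) bker.
  have [B hB] := uboundedM (bfga _ hs) bker.
  exists (A + B) => u u1; apply: le_trans (nmB _ _) _.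
  by rewrite lerD ?hA ?hB.
- exact: uboundedM (ubounded_cst _) buf.
apply: Lam_le => u u1.
have := qf _ _ (ga_in _ _ hs u1) (ga_in _ _ ht u1).
have -> : ga t u - ga s u = rc (t - s) * (rc r * u - (z - z0)).
  by rewrite /ga /rc rmorphB; ring.
move: (f (ga t u)) (f (ga s u)) (f' (ga s u)) => a b c h.
set x := rc r * u - (z - z0) in h *.
have x0 : 0 < nm x by apply: lt_le_trans d0 _; exact: circ_ge.
have xn0 : x != 0 by rewrite -nm_gt0.
have x2 : nm x <= 2 * r.
  apply: le_trans (nmB _ _) _; rewrite nmM u1 nm_rc ger0_norm ?(ltW r0)//.
  by lra.
have -> : a * (rc r * u / x) - b * (rc r * u / x) -
    rc r * rc (t - s) * (u * c) =
    rc r * u / x * (a - b - rc (t - s) * x * c) by field.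
rewrite 3!nmM u1 mulr1 nmV nm_rc ger0_norm ?(ltW r0)//.
rewrite mulrAC ler_pdivrMr//.
apply: le_trans (ler_wpM2l (ltW r0) h) _.
rewrite nmM nm_rc exprMn real_normK ?num_real//.
have : nm x ^+ 2 <= 2 * r * nm x by rewrite expr2 ler_wpM2r// ltW.
move: (nm x) (nm x ^+ 2) => X X2 XX.
have -> : r * (K * ((t - s) ^+ 2 * X2)) = r * K * (t - s) ^+ 2 * X2 by ring.
have -> : K * (2 * r * r) * (t - s) ^+ 2 * X =
  r * K * (t - s) ^+ 2 * (2 * r * X) by ring.
by rewrite ler_wpM2l// mulr_ge0 ?sqr_ge0// mulr_ge0// ltW.
Qed.

End CauchyFormula.

(** * Regularity of holomorphic functions of one and two variables *)

Section Regularity.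
Context {R : realType}.
Local Notation C := (cplx R).
Implicit Types (z w u v : C) (r s e K M B : R).

Lemma quad_deriv z0 r (f f' : C -> C) K z : quad z0 r f f' K ->
  nm (z - z0) < r -> has_deriv f (f' z) z.
Proof.
move=> qf zr e e0; pose d := e / (`|K| + 1).
have K1 : 0 < `|K| + 1 by rewrite ltr_wpDl.
exists (Num.min d (r - nm (z - z0))).
  by rewrite lt_min divr_gt0// subr_gt0.
move=> w; rewrite lt_min => /andP[wd wr].
have hw : nm (w - z0) < r by have := nm_triang z w z0; lra.
apply: le_trans (qf _ _ zr hw) _; rewrite expr2 mulrA ler_wpM2r ?nm_ge0//.
apply: (@le_trans _ _ ((`|K| + 1) * nm (w - z))).
  rewrite ler_wpM2r ?nm_ge0//; apply: le_trans (ler_norm _) _; lra.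
by rewrite mulrC -ler_pdivlMr// ltW.
Qed.

Lemma has_deriv_uniq (f : C -> C) l l' z :
  has_deriv f l z -> has_deriv f l' z -> l = l'.
Proof.
move=> h h'; apply/eqP; rewrite -subr_eq0 -nm_eq0 eq_le nm_ge0 andbT.
apply: ler_eps => e e0; rewrite add0r.
have e20 : 0 < e / 2 by rewrite divr_gt0.
have [d d0 dP] := h _ e20; have [d' d0' dP'] := h' _ e20.
pose t := Num.min d d' / 2.
have t0 : 0 < t by rewrite divr_gt0// lt_min d0.
have : t < d /\ t < d'.
  by rewrite /t; split; rewrite ltr_pdivrMr//; have [] := leP d d'; lra.
move=> [td td']; have E : z + rc t - z = rc t by rewrite addrAC subrr add0r.
have := dP (z + rc t); have := dP' (z + rc t); rewrite E nm_rc (ger0_norm (ltW t0)).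
move=> /(_ td') h1 /(_ td) h2; rewrite -(ler_pM2l t0).
rewrite -[X in X * nm _](ger0_norm (ltW t0)) -(nm_rc t).
rewrite -(nmM (rc t)).
have -> : rc t * (l - l') = (f (z + rc t) - f z - rc t * l') -
  (f (z + rc t) - f z - rc t * l) by ring.
by apply: le_trans (nmB _ _) _; lra.
Qed.

(** The two factors have independent increments [h] and [k], so one estimate serves both for
    products of functions of the same variable, where [h = k], and for products of kernels in two
    different variables. *)
Lemma leibniz_quad (f0 f1 f' g0 g1 g' h k : C) K1 K2 B :
  nm (f1 - f0 - h * f') <= K1 * nm h ^+ 2 ->
  nm (g1 - g0 - k * g') <= K2 * nm k ^+ 2 ->
  nm f0 <= B -> nm f' <= B -> nm g1 <= B -> nm g' <= B ->
  nm h <= B -> 0 <= K1 -> 0 <= K2 ->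
  nm (f1 * g1 - f0 * g0 - (h * f' * g0 + k * f0 * g')) <=
    (K1 * B + B * K2 + (B * B + B * K2 * B)) * (nm h + nm k) ^+ 2.
Proof.
move=> hf hg f0B f'B g1B g'B hB K10 K20.
have B0 : 0 <= B by exact: le_trans (nm_ge0 _) hB.
pose E1 := f1 - f0 - h * f'; pose E2 := g1 - g0 - k * g'.
have -> : f1 * g1 - f0 * g0 - (h * f' * g0 + k * f0 * g') =
    E1 * g1 + f0 * E2 + (h * k * (f' * g') + h * f' * E2).
  by rewrite /E1 /E2; ring.
have hh : nm h ^+ 2 <= (nm h + nm k) ^+ 2.
  by rewrite lerXn2r ?nnegrE ?addr_ge0 ?nm_ge0// lerDl nm_ge0.
have kk : nm k ^+ 2 <= (nm h + nm k) ^+ 2.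
  by rewrite lerXn2r ?nnegrE ?addr_ge0 ?nm_ge0// lerDr nm_ge0.
have hk : nm h * nm k <= (nm h + nm k) ^+ 2.
  have := nm_ge0 h; have := nm_ge0 k; move: (nm h) (nm k) => x y x0 y0; nra.
have e1 : nm E1 <= K1 * (nm h + nm k) ^+ 2.
  by apply: le_trans hf _; rewrite ler_wpM2l.
have e2 : nm E2 <= K2 * (nm h + nm k) ^+ 2.
  by apply: le_trans hg _; rewrite ler_wpM2l.
move: ((nm h + nm k) ^+ 2) hh kk hk e1 e2 => T hh kk hk e1 e2.
clearbody E1 E2.
rewrite !mulrDl; apply: le_trans (nmD _ _) _; apply: lerD.
  apply: le_trans (nmD _ _) _; rewrite !nmM; apply: lerD.
    by rewrite mulrAC; apply: ler_pM; rewrite ?nm_ge0.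
  by rewrite -mulrA; apply: ler_pM; rewrite ?nm_ge0.
apply: le_trans (nmD _ _) _; rewrite !nmM; apply: lerD.
  rewrite mulrC; apply: ler_pM; rewrite ?mulr_ge0 ?nm_ge0//.
  by apply: ler_pM; rewrite ?nm_ge0.
have -> : B * K2 * B * T = B * B * (K2 * T) by ring.
apply: ler_pM; rewrite ?mulr_ge0 ?nm_ge0//.
by apply: ler_pM; rewrite ?nm_ge0.
Qed.

Lemma quadM z0 r (f f' g g' : C -> C) K1 K2 B :
  quad z0 r f f' K1 -> quad z0 r g g' K2 -> 0 <= K1 -> 0 <= K2 ->
  (forall z, nm (z - z0) < r -> [/\ nm (f z) <= B, nm (f' z) <= B,
     nm (g z) <= B & nm (g' z) <= B]) -> 2 * r <= B ->
  quad z0 r (fun z => f z * g z) (fun z => f' z * g z + f z * g' z)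
    (4 * (K1 * B + B * K2 + (B * B + B * K2 * B))).
Proof.
move=> qf qg K10 K20 fgB rB z w hz hw.
have [z1 z2 z3 z4] := fgB _ hz; have [w1 w2 w3 w4] := fgB _ hw.
have hB : nm (w - z) <= B.
  by have := nm_triang z0 w z; rewrite [nm (z0 - z)]nmBC; lra.
have := leibniz_quad (qf _ _ hz hw) (qg _ _ hz hw) z1 z2 w3 z4 hB K10 K20.
set Q := _ + _; have -> : (nm (w - z) + nm (w - z)) ^+ 2 = 4 * nm (w - z) ^+ 2.
  by ring.
move=> h; rewrite /= -mulrA mulrCA [X in nm X](_ : _ = f w * g w - f z * g z -
  ((w - z) * f' z * g z + (w - z) * f z * g' z)) //; ring.
Qed.

(** The Cauchy kernel belonging to the point [z0 + rc r * u] of the circle. Its derivatives in [z]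
    are multiples of its powers. *)
Definition ker (r : R) z0 u z : C := (rc r * u - (z - z0))^-1.

Lemma ker_bound r z0 u z : nm u = 1 -> nm (z - z0) < r / 2 ->
  nm (ker r z0 u z) <= 2 / r.
Proof.
move=> u1 hz; have r0 : 0 < r by have := nm_ge0 (z - z0); lra.
have zr : nm (z - z0) < r by lra.
have h := circ_ge zr u1; rewrite /ker nmV.
have -> : 2 / r = (r / 2)^-1 by field; rewrite gt_eqF.
by rewrite lef_pV2 ?posrE; lra.
Qed.

Lemma ker_quad r z0 u : 0 < r -> nm u = 1 ->
  quad z0 (r / 2) (ker r z0 u) (fun z => ker r z0 u z ^+ 2) ((2 / r) ^+ 3).
Proof.
move=> r0 u1 z w hz hw.
have dz : r / 2 <= nm (rc r * u - (z - z0)).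
  have zr : nm (z - z0) < r by lra.
  by have := circ_ge zr u1; lra.
have dw : r / 2 <= nm (rc r * u - (w - z0)).
  have zr : nm (w - z0) < r by lra.
  by have := circ_ge zr u1; lra.
have r20 : 0 < r / 2 by rewrite divr_gt0.
have := inv_quad r20 dz dw.
have -> : rc r * u - (w - z0) - (rc r * u - (z - z0)) = - (w - z) by ring.
have -> : (r / 2)^-1 = 2 / r by field; rewrite gt_eqF.
by rewrite mulNr nmN.
Qed.

(** [K] is chosen before [u], since the bound is to be averaged over the circle. The power is raised
    by one with the product rule [quadM]. *)
Lemma kerX_quad r z0 n : 0 < r -> exists2 K, 0 <= K & forall u, nm u = 1 ->
  quad z0 (r / 2) (fun z => ker r z0 u z ^+ n.+1)
    (fun z => n.+1%:R * ker r z0 u z ^+ n.+2) K.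
Proof.
move=> r0; have q0 : 0 <= 2 / r by rewrite divr_ge0// ltW.
elim: n => [|n [K K0 KP]].
  exists ((2 / r) ^+ 3); first by rewrite exprn_ge0.
  move=> u u1 z w hz hw; rewrite mul1r; exact: ker_quad.
pose B := r + 2 / r + (2 / r) ^+ 2 + (2 / r) ^+ n.+1 + n.+1%:R * (2 / r) ^+ n.+2.
pose K3 := (2 / r) ^+ 3.
have K30 : 0 <= K3 by rewrite exprn_ge0.
exists (4 * (K * B + B * K3 + (B * B + B * K3 * B))).
  have B0 : 0 <= B.
    have := exprn_ge0 2 q0; have := exprn_ge0 n.+1 q0.
    have := mulr_ge0 (ler0n R n.+1) (exprn_ge0 n.+2 q0).
    by rewrite /B; lra.
  have := mulr_ge0 K0 B0; have := mulr_ge0 B0 B0; have := mulr_ge0 B0 K30.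
  by have := mulr_ge0 (mulr_ge0 B0 K30) B0; lra.
move=> u u1.
have h := @quadM z0 (r / 2) _ _ _ _ K K3 B (KP u u1) (ker_quad r0 u1) K0 K30.
have {}h := h _ _ => // z w hz hw.
have := h _ _ z w hz hw => {h}.
have E (x : C) : n.+1%:R * x ^+ n.+2 * x + x ^+ n.+1 * x ^+ 2 =
    n.+2%:R * x ^+ n.+3.
  by rewrite -[n.+2%:R]natr1 !exprS; ring.
rewrite E -!exprSr; apply; last first.
  have := exprn_ge0 2 q0; have := exprn_ge0 n.+1 q0.
  have := mulr_ge0 (ler0n R n.+1) (exprn_ge0 n.+2 q0).
  by rewrite /B; lra.
move=> x hx; have kb := ker_bound u1 hx.
have kX m : nm (ker r z0 u x ^+ m) <= (2 / r) ^+ m.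
  by rewrite nmX lerXn2r ?nnegrE ?nm_ge0.
have := kX n.+1; have := kX n.+2; have := kX 2 => k2 k3 k4.
have k5 : nm (n.+1%:R * ker r z0 u x ^+ n.+2) <= n.+1%:R * (2 / r) ^+ n.+2.
  by rewrite nmM nm_nat ler_wpM2l.
have := exprn_ge0 2 q0; have := exprn_ge0 n.+1 q0.
have := mulr_ge0 (ler0n R n.+1) (exprn_ge0 n.+2 q0).
by rewrite /B; split; lra.
Qed.

(** Differentiation under the mean: by linearity the remainder is the mean of the remainders, and
    these are bounded uniformly in [u]. *)
Lemma Lam_quad (phi : C -> C) (k k' : C -> C -> C) z0 r K M B :
  (forall u, nm u = 1 -> quad z0 r (k u) (k' u) K) ->
  (forall u, nm u = 1 -> nm (phi u) <= M) ->
  (forall u z, nm u = 1 -> nm (z - z0) < r ->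
     nm (k u z) <= B /\ nm (k' u z) <= B) ->
  quad z0 r (fun z => Lam (fun u => phi u * k u z))
    (fun z => Lam (fun u => phi u * k' u z)) (M * K).
Proof.
move=> qk phiM kB z w hz hw.
have bphi : ubounded phi by exists M.
have bk x : nm (x - z0) < r -> ubounded (fun u => k u x).
  by move=> hx; exists B => u u1; case: (kB u x u1 hx).
have bk' : ubounded (fun u => k' u z).
  by exists B => u u1; case: (kB u z u1 hz).
have b1 : ubounded (fun u => phi u * k u w) by apply: uboundedM => //; exact: bk.
have b2 : ubounded (fun u => phi u * k u z) by apply: uboundedM => //; exact: bk.
have b3 : ubounded (fun u => phi u * k' u z) by exact: uboundedM.
rewrite -(LamZ _ b3) -(LamB b1 b2) -LamB; last first.
- exact: uboundedM (ubounded_cst _) b3.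
- have [N1 h1] := b1; have [N2 h2] := b2; exists (N1 + N2) => u u1.
  by apply: le_trans (nmB _ _) _; rewrite lerD ?h1 ?h2.
apply: Lam_le => u u1.
have -> : phi u * k u w - phi u * k u z - (w - z) * (phi u * k' u z) =
  phi u * (k u w - k u z - (w - z) * k' u z) by ring.
rewrite nmM -mulrA; apply: ler_pM; rewrite ?nm_ge0//; first exact: phiM.
exact: qk.
Qed.

Lemma Lam_kerX_quad (phi : C -> C) z0 r M n : 0 < r ->
  (forall u, nm u = 1 -> nm (phi u) <= M) ->
  exists K, quad z0 (r / 2) (fun z => Lam (fun u => phi u * ker r z0 u z ^+ n.+1))
    (fun z => n.+1%:R * Lam (fun u => phi u * ker r z0 u z ^+ n.+2)) K.
Proof.
move=> r0 phiM; have [K K0 KP] := kerX_quad z0 n r0.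
have q0 : 0 <= 2 / r by rewrite divr_ge0// ltW.
have kX m u x : nm u = 1 -> nm (x - z0) < r / 2 ->
    nm (ker r z0 u x ^+ m) <= (2 / r) ^+ m.
  by move=> u1 hx; rewrite nmX lerXn2r ?nnegrE ?nm_ge0 ?ker_bound.
exists (M * K) => z w hz hw.
have := @Lam_quad phi (fun u z => ker r z0 u z ^+ n.+1)
  (fun u z => n.+1%:R * ker r z0 u z ^+ n.+2) z0 (r / 2) K M
  ((2 / r) ^+ n.+1 + n.+1%:R * (2 / r) ^+ n.+2) KP phiM _ z w hz hw.
rewrite -(LamZ n.+1%:R); last first.
  exists (M * (2 / r) ^+ n.+2) => u u1; rewrite nmM.
  by apply: ler_pM; rewrite ?nm_ge0 ?phiM ?kX.
have -> : Lam (fun u => phi u * (n.+1%:R * ker r z0 u z ^+ n.+2)) =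
    Lam (fun u => n.+1%:R * (phi u * ker r z0 u z ^+ n.+2)).
  by apply: eq_Lam => u _; rewrite mulrCA.
apply=> u x u1 hx; rewrite nmM nm_nat.
have := kX n.+1 _ _ u1 hx; have := kX n.+2 _ _ u1 hx => h2 h1.
have : n.+1%:R * nm (ker r z0 u x ^+ n.+2) <= n.+1%:R * (2 / r) ^+ n.+2.
  by rewrite ler_wpM2l.
have := exprn_ge0 n.+1 q0; have := mulr_ge0 (ler0n R n.+1) (exprn_ge0 n.+2 q0).
by split; lra.
Qed.

Lemma Lam_kerX_bound (phi : C -> C) z0 r M n z : 0 < r ->
  (forall u, nm u = 1 -> nm (phi u) <= M) -> nm (z - z0) < r / 2 ->
  nm (Lam (fun u => phi u * ker r z0 u z ^+ n)) <= M * (2 / r) ^+ n.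
Proof.
move=> r0 phiM hz; apply: Lam_le => u u1; rewrite nmM nmX.
have q0 : 0 <= 2 / r by rewrite divr_ge0// ltW.
apply: ler_pM; rewrite ?nm_ge0 ?exprn_ge0 ?nm_ge0 ?phiM//.
by rewrite lerXn2r ?nnegrE ?nm_ge0 ?ker_bound.
Qed.

Lemma quad_sub z0 r r' (f f' g g' : C -> C) K : r' <= r ->
  (forall z, nm (z - z0) < r' -> f z = g z /\ f' z = g' z) ->
  quad z0 r f f' K -> quad z0 r' g g' K.
Proof.
move=> rr fg qf z w hz hw.
have [<- <-] := fg _ hz; have [<- _] := fg _ hw; apply: qf; lra.
Qed.

(** The second primitive [G] satisfies the Cauchy formula. [step] differentiates a kernel
    representation once and identifies the result by uniqueness of derivatives; applied to [G], [F]
    and [f] it represents [f'] as well and provides the quadratic remainder of [f]. *)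
Theorem holo_quad f f' z0 r M : 0 < r ->
  (forall z, nm (z - z0) < 25 * r -> has_deriv f (f' z) z) ->
  (forall z, nm (z - z0) < 5 * r -> nm (f z) <= M) ->
  exists K B, quad z0 (r / 4) f f' K /\
    forall z, nm (z - z0) < r / 4 -> nm (f z) <= B /\ nm (f' z) <= B.
Proof.
move=> r0 df fM; have [F [G [B [qG dF GFB]]]] := double_primitive df fM.
pose s := r / 2; have s0 : 0 < s by rewrite divr_gt0.
have s2 : s / 2 = r / 4 by rewrite /s; field.
pose phi u := G (z0 + rc s * u) * (rc s * u).
have phiB u : nm u = 1 -> nm (phi u) <= B * s.
  move=> u1; have su : nm (rc s * u) = s by rewrite nmM u1 mulr1 nm_rc ger0_norm// ltW.
  rewrite /phi nmM su (ler_wpM2r (ltW s0))//.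
  have [|//] := GFB (z0 + rc s * u).
  by rewrite addrAC subrr add0r su /s; lra.
have GE z : nm (z - z0) < s / 2 ->
    G z = Lam (fun u => phi u * ker s z0 u z ^+ 1).
  move=> hz; rewrite (cauchy_quad qG GFB (r := s)); [|rewrite /s; lra|lra].
  by apply: eq_Lam => u _; rewrite /phi /ker mulrA.
have step (g g' : C -> C) n (c : C) :
    (forall z, nm (z - z0) < s / 2 ->
       g z = c * Lam (fun u => phi u * ker s z0 u z ^+ n.+1)) ->
    (forall z, nm (z - z0) < s / 2 -> has_deriv g (g' z) z) ->
    (exists K, quad z0 (s / 2) g g' K) /\ forall z, nm (z - z0) < s / 2 ->
      g' z = c * n.+1%:R * Lam (fun u => phi u * ker s z0 u z ^+ n.+2).
  move=> gE dg; have [K KP] := Lam_kerX_quad z0 n s0 phiB.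
  have qg : quad z0 (s / 2) g
     (fun z => c * n.+1%:R * Lam (fun u => phi u * ker s z0 u z ^+ n.+2)) (nm c * K).
    move=> z w hz hw; rewrite !gE//.
    have := KP z w hz hw; set a := Lam _; set b := Lam _; set d := Lam _ => h.
    have -> : c * a - c * b - (w - z) * (c * n.+1%:R * d) =
      c * (a - b - (w - z) * (n.+1%:R * d)) by ring.
    by rewrite nmM -mulrA ler_wpM2l ?nm_ge0.
  have g'E z : nm (z - z0) < s / 2 ->
      g' z = c * n.+1%:R * Lam (fun u => phi u * ker s z0 u z ^+ n.+2).
    by move=> hz; exact: has_deriv_uniq (dg _ hz) (quad_deriv qg hz).
  split=> //; exists (nm c * K); apply: quad_sub qg => // z hz.
  by rewrite g'E.
have GE' z : nm (z - z0) < s / 2 ->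
    G z = 1 * Lam (fun u => phi u * ker s z0 u z ^+ 1).
  by move=> hz; rewrite mul1r GE.
have dG z : nm (z - z0) < s / 2 -> has_deriv G (F z) z.
  by move=> hz; apply: quad_deriv qG _; lra.
have dF' z : nm (z - z0) < s / 2 -> has_deriv F (f z) z.
  by move=> hz; apply: dF; lra.
have df' z : nm (z - z0) < s / 2 -> has_deriv f (f' z) z.
  by move=> hz; apply: df; lra.
have [_ FE] := step _ _ _ _ GE' dG.
have [_ fE] := step _ _ _ _ FE dF'.
have [[K qf] f'E] := step _ _ _ _ fE df'.
rewrite s2 in qf f'E fE.
pose b := B * s * (2 / s) ^+ 4.
exists K, (M + nm (1 * 1%:R * 2%:R * 3%:R : C) * b); split=> // z hz.
have hz5 : nm (z - z0) < 5 * r by lra.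
have hz2 : nm (z - z0) < s / 2 by rewrite s2.
have := Lam_kerX_bound 4 s0 phiB hz2; rewrite -/b => hb.
have b0 := le_trans (nm_ge0 _) hb.
have h0 : 0 <= nm (1 * 1%:R * 2%:R * 3%:R : C) * b by rewrite mulr_ge0 ?nm_ge0.
have M0 := le_trans (nm_ge0 _) (fM _ hz5).
split; first by have := fM _ hz5; lra.
rewrite f'E// nmM; set x := nm (_ * 3%:R) in h0 *.
have : x * nm (Lam (fun u => phi u * ker s z0 u z ^+ 4)) <= x * b.
  by rewrite ler_wpM2l ?nm_ge0.
by lra.
Qed.

Corollary cauchy_formula f f' z0 r M z : 0 < r ->
  (forall z, nm (z - z0) < 25 * r -> has_deriv f (f' z) z) ->
  (forall z, nm (z - z0) < 5 * r -> nm (f z) <= M) ->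
  nm (z - z0) < r / 8 ->
  f z = Lam (fun u => f (z0 + rc (r / 8) * u) * (rc (r / 8) * u) *
                      ker (r / 8) z0 u z).
Proof.
move=> r0 df fM hz; have [K [B [qf fB]]] := holo_quad r0 df fM.
rewrite (cauchy_quad qf fB _ hz); last lra.
by apply: eq_Lam => u _; rewrite /ker mulrA.
Qed.

(** The Cauchy integral over a torus as an iterated mean: [phi] carries the boundary values, [k] and
    [l] the kernels of the two variables. *)
Definition Lam2 (phi : C -> C -> C) (k l : C -> C) : C :=
  Lam (fun u => k u * Lam (fun v => phi u v * l v)).

Lemma Lam2_quad (phi : C -> C -> C) (k k' l l' : C -> C -> C) z0 w0 r K M B :
  0 < r -> 0 <= K -> 2 * r <= B ->
  (forall u, nm u = 1 -> quad z0 r (k u) (k' u) K) ->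
  (forall v, nm v = 1 -> quad w0 r (l v) (l' v) K) ->
  (forall u v, nm u = 1 -> nm v = 1 -> nm (phi u v) <= M) ->
  (forall u z, nm u = 1 -> nm (z - z0) < r ->
     nm (k u z) <= B /\ nm (k' u z) <= B) ->
  (forall u z, nm u = 1 -> nm (z - w0) < r ->
     nm (l u z) <= B /\ nm (l' u z) <= B) ->
  exists K', forall z w z' w', nm (z - z0) < r -> nm (w - w0) < r ->
    nm (z' - z0) < r -> nm (w' - w0) < r ->
    nm (Lam2 phi (k ^~ z') (l ^~ w') - Lam2 phi (k ^~ z) (l ^~ w)
        - ((z' - z) * Lam2 phi (k' ^~ z) (l ^~ w)
           + (w' - w) * Lam2 phi (k ^~ z) (l' ^~ w)))
    <= K' * (nm (z' - z) + nm (w' - w)) ^+ 2.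
Proof.
move=> r0 K0 rB qk ql phiM kB lB.
exists (M * (K * B + B * K + (B * B + B * K * B))) => z w z' w' hz hw hz' hw'.
have bphi u : nm u = 1 -> ubounded (phi u) by move=> u1; exists M => v; exact: phiM.
have M0 : 0 <= M by exact: le_trans (nm_ge0 _) (phiM _ _ (nm1) (nm1)).
have bin (x y : C -> C) : (forall u, nm u = 1 -> nm (x u) <= B) ->
    (forall u, nm u = 1 -> nm (y u) <= B) ->
    ubounded (fun u => x u * Lam (fun v => phi u v * y v)).
  move=> hx hy; exists (B * (M * B)) => u u1; rewrite nmM.
  apply: ler_pM; rewrite ?nm_ge0 ?hx//; apply: Lam_le => v v1; rewrite nmM.
  by apply: ler_pM; rewrite ?nm_ge0 ?phiM ?hy.
have bl (y : C -> C) u : nm u = 1 -> (forall u, nm u = 1 -> nm (y u) <= B) ->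
    ubounded (fun v => phi u v * y v).
  by move=> u1 hy; apply: uboundedM; [exact: bphi|exists B].
have k1 u : nm u = 1 -> nm (k u z) <= B by move=> u1; case: (kB u z u1 hz).
have k2 u : nm u = 1 -> nm (k' u z) <= B by move=> u1; case: (kB u z u1 hz).
have k3 u : nm u = 1 -> nm (k u z') <= B by move=> u1; case: (kB u z' u1 hz').
have l1 u : nm u = 1 -> nm (l u w) <= B by move=> u1; case: (lB u w u1 hw).
have l2 u : nm u = 1 -> nm (l' u w) <= B by move=> u1; case: (lB u w u1 hw).
have l3 u : nm u = 1 -> nm (l u w') <= B by move=> u1; case: (lB u w' u1 hw').
have b1 := bin _ _ k3 l3; have b2 := bin _ _ k1 l1.
have b3 := bin _ _ k2 l1; have b4 := bin _ _ k1 l2.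
rewrite /Lam2 -(LamZ _ b3) -(LamZ _ b4) -(LamB b1 b2).
have b3' := uboundedM (ubounded_cst (z' - z)) b3.
have b4' := uboundedM (ubounded_cst (w' - w)) b4.
have b12 := uboundedD b1 (uboundedM (ubounded_cst (-1)) b2).
rewrite -(LamD b3' b4') -LamB; last 2 first.
- by case: b12 => N hN; exists N => u u1; rewrite -[X in _ - X]mul1r -mulNr; exact: hN.
- exact: uboundedD.
rewrite -mulrA; apply: Lam_le => u u1.
have bb1 := bl _ _ u1 l3; have bb2 := bl _ _ u1 l1; have bb3 := bl _ _ u1 l2.
rewrite -(LamZ _ bb1) -(LamZ _ bb2) -(LamZ (k' u z) bb2) -(LamZ (k u z) bb3).
have c1 x := uboundedM (ubounded_cst x) bb1.
have c2 x := uboundedM (ubounded_cst x) bb2.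
have c3 x := uboundedM (ubounded_cst x) bb3.
rewrite -(LamZ (z' - z) (c2 _)) -(LamZ (w' - w) (c3 _)).
have d1 := uboundedM (ubounded_cst (z' - z)) (c2 (k' u z)).
have d2 := uboundedM (ubounded_cst (w' - w)) (c3 (k u z)).
have d3 := uboundedD (c1 (k u z')) (uboundedM (ubounded_cst (-1)) (c2 (k u z))).
rewrite -(LamB (c1 _) (c2 _)) -(LamD d1 d2) -LamB; last 2 first.
- by case: d3 => N hN; exists N => v v1; rewrite -[X in _ - X]mul1r -mulNr; exact: hN.
- exact: uboundedD.
apply: Lam_le => v v1.
have hB : nm (z' - z) <= B.
  by have := nm_triang z0 z' z; rewrite [nm (z0 - z)]nmBC; lra.
have := leibniz_quad (qk u u1 _ _ hz hz') (ql v v1 _ _ hw hw')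
  (k1 u u1) (k2 u u1) (l3 v v1) (l2 v v1) hB K0 K0.
set T := (_ + _) ^+ 2; set Q := _ + (_ + _).
have -> : k u z' * (phi u v * l v w') - k u z * (phi u v * l v w) -
  ((z' - z) * (k' u z * (phi u v * l v w)) +
   (w' - w) * (k u z * (phi u v * l' v w))) =
  phi u v * (k u z' * l v w' - k u z * l v w -
   ((z' - z) * k' u z * l v w + (w' - w) * k u z * l' v w)) by ring.
by move=> h; rewrite nmM; apply: ler_pM; rewrite ?nm_ge0 ?phiM.
Qed.

Definition quad2 z0 w0 r (f f1 f2 : C -> C -> C) := exists K,
  forall z w z' w', nm (z - z0) < r -> nm (w - w0) < r ->
    nm (z' - z0) < r -> nm (w' - w0) < r ->
    nm (f z' w' - f z w - ((z' - z) * f1 z w + (w' - w) * f2 z w))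
    <= K * (nm (z' - z) + nm (w' - w)) ^+ 2.

(** The Cauchy formula in each variable separately represents [f] on a bidisc by [G 1 1], where
    [G i j] contains the kernel powers [i] and [j]. A derivative in [z] or [w] raises [i] or [j] by
    one, with the old exponent as factor. Both mixed derivatives are therefore [G 2 2], which is why
    a single [g12] occurs in the statement. *)
Theorem holo2_quad (f f1 f2 : C -> C -> C) z0 w0 r M : 0 < r ->
  (forall z w, nm (z - z0) < 25 * r -> nm (w - w0) < 25 * r ->
     has_deriv (f ^~ w) (f1 z w) z /\ has_deriv (f z) (f2 z w) w) ->
  (forall z w, nm (z - z0) < 5 * r -> nm (w - w0) < 5 * r -> nm (f z w) <= M) ->
  exists s g g1 g2 g11 g12 g22, 0 < s /\
    [/\ forall z w, nm (z - z0) < s -> nm (w - w0) < s -> f z w = g z w,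
        quad2 z0 w0 s g g1 g2, quad2 z0 w0 s g1 g11 g12 &
        quad2 z0 w0 s g2 g12 g22].
Proof.
move=> r0 df fM; pose s := r / 8; have s0 : 0 < s by rewrite divr_gt0.
pose phi u v := f (z0 + rc s * u) (w0 + rc s * v) * (rc s * v) * (rc s * u).
have su u : nm u = 1 -> nm (rc s * u) = s.
  by move=> u1; rewrite nmM u1 mulr1 nm_rc ger0_norm// ltW.
have zu (a u : C) : nm u = 1 -> nm (a + rc s * u - a) = s.
  by move=> u1; rewrite addrAC subrr add0r su.
have phiM u v : nm u = 1 -> nm v = 1 -> nm (phi u v) <= M * s * s.
  move=> u1 v1; rewrite /phi nmM nmM !su// ler_wpM2r ?(ltW s0)//.
  by rewrite ler_wpM2r ?(ltW s0)// fM ?zu//; rewrite /s; lra.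
pose G i j z w := Lam2 phi (fun u => ker s z0 u z ^+ i) (fun v => ker s w0 v w ^+ j).
have fE z w : nm (z - z0) < s / 2 -> nm (w - w0) < s / 2 -> f z w = G 1%N 1%N z w.
  move=> hz hw.
  have dfz x : nm (x - z0) < 25 * r -> has_deriv (f ^~ w) (f1 x w) x.
    by move=> hx; have [|//] := df x w hx; rewrite /s in hw; lra.
  have fMz x : nm (x - z0) < 5 * r -> nm (f x w) <= M.
    by move=> hx; apply: fM => //; rewrite /s in hw; lra.
  rewrite (cauchy_formula r0 dfz fMz); last by rewrite /s in hz *; lra.
  apply: eq_Lam => u u1; rewrite expr1 -/s [RHS]mulrC; congr (_ * _).
  have dfw x : nm (x - w0) < 25 * r ->
      has_deriv (f (z0 + rc s * u)) (f2 (z0 + rc s * u) x) x.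
    by move=> hx; have [|//] := df (z0 + rc s * u) x _ hx; rewrite zu// /s; lra.
  have fMw x : nm (x - w0) < 5 * r -> nm (f (z0 + rc s * u) x) <= M.
    by move=> hx; apply: fM => //; rewrite zu// /s; lra.
  rewrite (cauchy_formula r0 dfw fMw) -?/s; last lra.
  rewrite mulrC -LamZ.
    by apply: eq_Lam => v _; rewrite /phi expr1; ring.
  apply: uboundedM; last first.
    by exists (2 / s) => v v1; apply: ker_bound.
  exists (M * s) => v v1; rewrite nmM su// ler_wpM2r ?(ltW s0)//.
  by apply: fMw; rewrite zu// /s; lra.
have q0 : 0 <= 2 / s by rewrite divr_ge0// ltW.
have GS i j : quad2 z0 w0 (s / 2) (G i.+1 j.+1)
    (fun z w => i.+1%:R * G i.+2 j.+1 z w)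
    (fun z w => j.+1%:R * G i.+1 j.+2 z w).
  have [K K0 KP] := kerX_quad z0 i s0; have [L L0 LP] := kerX_quad w0 j s0.
  pose B := s + (2 / s) ^+ i.+1 + i.+1%:R * (2 / s) ^+ i.+2
    + (2 / s) ^+ j.+1 + j.+1%:R * (2 / s) ^+ j.+2.
  have s20 : 0 < s / 2 by rewrite divr_gt0.
  have KL0 : 0 <= K + L by rewrite addr_ge0.
  have kX z1 m u x : nm u = 1 -> nm (x - z1) < s / 2 ->
      nm (ker s z1 u x ^+ m) <= (2 / s) ^+ m.
    by move=> u1 hx; rewrite nmX lerXn2r ?nnegrE ?nm_ge0 ?ker_bound.
  have kX' z1 m u x : nm u = 1 -> nm (x - z1) < s / 2 ->
      nm (m.+1%:R * ker s z1 u x ^+ m.+2) <= m.+1%:R * (2 / s) ^+ m.+2.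
    by move=> u1 hx; rewrite nmM nm_nat ler_wpM2l// kX.
  have p1 := exprn_ge0 i.+1 q0; have p2 := exprn_ge0 j.+1 q0.
  have p3 := mulr_ge0 (ler0n R i.+1) (exprn_ge0 i.+2 q0).
  have p4 := mulr_ge0 (ler0n R j.+1) (exprn_ge0 j.+2 q0).
  have [|||||K' K'P] := @Lam2_quad phi (fun u z => ker s z0 u z ^+ i.+1)
    (fun u z => i.+1%:R * ker s z0 u z ^+ i.+2)
    (fun u z => ker s w0 u z ^+ j.+1)
    (fun u z => j.+1%:R * ker s w0 u z ^+ j.+2) z0 w0 (s / 2) (K + L) _ B
    s20 KL0 _ _ _ phiM.
  - by rewrite /B; lra.
  - move=> u u1 z w hz hw; apply: le_trans (KP u u1 z w hz hw) _.
    by rewrite ler_wpM2r ?sqr_ge0// lerDl.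
  - move=> u u1 z w hz hw; apply: le_trans (LP u u1 z w hz hw) _.
    by rewrite ler_wpM2r ?sqr_ge0// lerDr.
  - move=> u z u1 hz; have := kX _ i.+1 _ _ u1 hz; have := kX' _ i _ _ u1 hz.
    by rewrite /B; split; lra.
  - move=> u z u1 hz; have := kX _ j.+1 _ _ u1 hz; have := kX' _ j _ _ u1 hz.
    by rewrite /B; split; lra.
  exists K' => z w z' w' hz hw hz' hw'.
  have E1 : i.+1%:R * G i.+2 j.+1 z w =
      Lam2 phi (fun u => i.+1%:R * ker s z0 u z ^+ i.+2)
        (fun v => ker s w0 v w ^+ j.+1).
    rewrite /G /Lam2 -LamZ; first by apply: eq_Lam => u _; rewrite mulrA.
    exists ((2 / s) ^+ i.+2 * (M * s * s * (2 / s) ^+ j.+1)) => u u1.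
    rewrite nmM; apply: ler_pM; rewrite ?nm_ge0 ?kX//.
    by apply: Lam_kerX_bound => // v v1; exact: phiM.
  have E2 : j.+1%:R * G i.+1 j.+2 z w =
      Lam2 phi (fun u => ker s z0 u z ^+ i.+1)
        (fun v => j.+1%:R * ker s w0 v w ^+ j.+2).
    rewrite /G /Lam2 -LamZ.
      apply: eq_Lam => u u1; rewrite mulrCA -(LamZ j.+1%:R).
        by congr (_ * _); apply: eq_Lam => v _; rewrite mulrCA.
      apply: uboundedM; last by exists ((2 / s) ^+ j.+2) => v v1; exact: kX.
      by exists (M * s * s) => v v1; exact: phiM.
    exists ((2 / s) ^+ i.+1 * (M * s * s * (2 / s) ^+ j.+2)) => u u1.
    rewrite nmM; apply: ler_pM; rewrite ?nm_ge0 ?kX//.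
    by apply: Lam_kerX_bound => // v v1; exact: phiM.
  by rewrite E1 E2; exact: K'P.
clearbody G.
exists (s / 2), (G 1%N 1%N), (G 2 1%N), (G 1%N 2),
  (fun z w => 2%:R * G 3 1%N z w), (G 2 2), (fun z w => 2%:R * G 1%N 3 z w).
split; first by rewrite divr_gt0.
have mul1 (H : C -> C -> C) : (fun z w => 1%:R * H z w) = H.
  by apply/funext => z; apply/funext => w; rewrite mul1r.
split=> //.
- rewrite -(mul1 (G 2 1%N)) -(mul1 (G 1%N 2)); exact: (GS 0%N 0%N).
- rewrite -(mul1 (G 2 2)); exact: (GS 1%N 0%N).
- rewrite -(mul1 (G 2 2)); exact: (GS 0%N 1%N).
Qed.

End Regularity.

(** * Fréchet differentials by explicit error estimates *)

Section Differentiability.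
Context {K : numFieldType}.

Lemma diff_intro (V W : normedModType K) (f : V -> W) (L : {linear V -> W}) x :
  continuous L ->
  (forall e : K, 0 < e ->
     \forall h \near (0 : V), `|f (h + x) - f x - L h| <= e * `|h|) ->
  differentiable f x /\ 'd f x = L :> (V -> W).
Proof.
move=> cL fL.
have E : f \o shift x = cst (f x) + (L : V -> W) +o_ (0 : V) id.
  apply/eqaddoP => e e0; apply: filterS (fL e e0) => h /=.
  rewrite /cst !fctE opprD addrA; exact.
have dfL := diff_unique cL E; split=> //; apply/diff_locallyP.
by rewrite dfL; split.
Qed.

Lemma diff_elim (V W : normedModType K) (f : V -> W) x :
  differentiable f x -> forall e : K, 0 < e ->
    \forall h \near (0 : V), `|f (h + x) - f x - 'd f x h| <= e * `|h|.
Proof.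
move=> /diff_locallyP[_ /eqaddoP dfx] e e0; apply: filterS (dfx e e0) => h /=.
by rewrite /cst !fctE opprD addrA.
Qed.

Lemma near_diff (V W : normedModType K) (f g : V -> W) x :
  (\near x, f x = g x) -> differentiable f x ->
  differentiable g x /\ 'd g x = 'd f x :> (V -> W).
Proof.
move=> fg df; apply: diff_intro; first exact: diff_continuous.
move=> e e0; have fgx := nbhs_singleton fg.
have fg0 : \forall h \near (0 : V), f (h + x) = g (h + x).
  have : (fun h : V => h + x) @ (0 : V) --> x.
    rewrite -[X in _ --> X]add0r; apply: cvgD; [exact: cvg_id|exact: cvg_cst].
  by move=> /(_ _ fg).
by apply: filterS2 fg0 (diff_elim df e0) => h <-; rewrite fgx.
Qed.

Lemma near_differentiable (V W : normedModType K) (f g : V -> W) x :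
  (\near x, f x = g x) -> differentiable f x -> differentiable g x.
Proof. by move=> fg /(near_diff fg)[]. Qed.

Lemma near_derive (V W : normedModType K) (f g : V -> W) x v :
  (\near x, f x = g x) -> differentiable f x -> 'D_v g x = 'D_v f x.
Proof. by move=> fg df; have [dg E] := near_diff fg df; rewrite (deriveE v df) (deriveE v dg) E. Qed.

End Differentiability.

(** * Local primitives, open mapping and isolated zeros in one variable *)

Section OneVariable.
Context {R : realType}.
Local Notation C := (cplx R).
Implicit Types (z w : C) (f : C -> C).

Lemma has_derivP f l z : has_deriv f l z <-> differentiable f z /\ derive1 f z = l.
Proof.
split=> [df|[df <-]].
  have lin : linear (fun h : C => h *: (l : C)).
    by move=> u y z'; rewrite scalerDl scalerA.
  pose linM := GRing.isLinear.Build _ _ _ _ _ lin.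
  pose L : {linear C -> C} := HB.pack (fun h : C => h *: (l : C)) linM.
  have [dfz E] : differentiable f z /\ 'd f z = L :> (C -> C).
    apply: diff_intro; first exact: scalel_continuous.
    move=> e e0; have [d d0 dP] := df _ (pos_Re e0).
    apply/nbhs_nm; exists d => // h; rewrite subr0 => hd.
    have := dP (h + z); rewrite addrK => /(_ hd).
    by rewrite (pos_rc e0) !normE -rcM rc_le.
  by split=> //; rewrite derive1E' // E /L /= /GRing.scale /= mul1r.
move=> e e0; have e0' : 0 < rc e by rewrite rc_gt0.
have /nbhs_nm[d d0 dP] := diff_elim df e0'; exists d => // w wd.
have := dP (w - z); rewrite subr0 subrK => /(_ wd).
by rewrite !normE -rcM rc_le diff1E.
Qed.

Lemma diff_has_deriv f z : differentiable f z -> has_deriv f (derive1 f z) z.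
Proof. by move=> df; apply/has_derivP. Qed.

Lemma open_disc (O : set C) z : open O -> O z ->
  exists2 r : R, 0 < r & forall w, nm (w - z) < r -> O w.
Proof. by move=> oO Oz; apply/nbhs_nm; apply: open_nbhs_nbhs. Qed.

Lemma disc_open z (r : R) : open [set w : C | nm (w - z) < r].
Proof.
rewrite openE => w /= wr; apply/nbhs_nm; exists (r - nm (w - z)).
  by rewrite subr_gt0.
by move=> y yw /=; have := nm_triang w y z; lra.
Qed.

(** Puts a function into the form required by [double_primitive] and [holo_quad]: the radius is
    divided by 25 in advance, and the bound comes from continuity at [z]. *)
Lemma holo_disc f (O : set C) z : open O -> O z ->
  (forall w, O w -> differentiable f w) ->
  exists r M : R, [/\ 0 < r,
    (forall w, nm (w - z) < 25 * r -> O w /\ has_deriv f (derive1 f w) w) &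
    forall w, nm (w - z) < 5 * r -> nm (f w) <= M].
Proof.
move=> oO Oz df; have [r r0 rO] := open_disc oO Oz.
have [d d0 dP] := has_deriv_cont (diff_has_deriv (df _ Oz)) (@ltr01 R).
pose s := Num.min r d / 25.
have sr : 25 * s <= r /\ 25 * s <= d.
  by rewrite /s mulrC divfK ?pnatr_eq0//; split; rewrite ge_min lexx ?orbT.
have s0 : 0 < s by rewrite divr_gt0// lt_min r0.
exists s, (nm (f z) + 1); split=> // [w wr|w wr].
  have Ow : O w by apply: rO; lra.
  by split=> //; exact/diff_has_deriv/df.
have := dP w; have := nm_sub (f w) (f z).
by move=> h1 h2; have := h2 ltac:(lra); lra.
Qed.

Lemma local_primitive f (O : set C) z : open O -> O z ->
  (forall w, O w -> differentiable f w) ->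
  exists2 r : R, 0 < r & exists F, forall w, nm (w - z) < r ->
    O w /\ has_deriv F (f w) w.
Proof.
move=> oO Oz df; have [r [M [r0 dr fM]]] := holo_disc oO Oz df.
have dr' w : nm (w - z) < 25 * r -> has_deriv f (derive1 f w) w.
  by move=> /dr[].
have [F [G [B [_ dF _]]]] := double_primitive dr' fM.
exists r => //; exists F => w wr; split; last exact: dF.
by have [|] := dr w; first lra.
Qed.

(** The derivative varies little: the Taylor remainders from [w] to [z] and from [z] to [w] add up
    to [(w - z) * (f' w - f' z)]. So near [z] the function differs from its linear part by at most
    half of that part, the input for injectivity and surjectivity below. *)
Lemma quad_linear f (f' : C -> C) z (r K : R) : 0 < r -> quad z r f f' K ->
  f' z != 0 ->
  exists2 s : R, 0 < s <= r & (forall w, nm (w - z) < s -> f' w != 0) /\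
    forall w w', nm (w - z) < s -> nm (w' - z) < s ->
      nm (f w' - f w - (w' - w) * f' z) <= nm (f' z) / 2 * nm (w' - w).
Proof.
move=> r0 qf a0; have na : 0 < nm (f' z) by rewrite nm_gt0.
have K1 : 0 < `|K| + 1 by rewrite ltr_wpDl.
have KK : K <= `|K| + 1 by apply: le_trans (ler_norm K) _; lra.
(* With 12, the variation of [f'] and the Taylor remainder contribute at most a sixth of [nm (f' z)]
   each, together less than the half allowed. *)
pose s := Num.min r (nm (f' z) / (`|K| + 1) / 12).
have s0 : 0 < s by rewrite lt_min !divr_gt0// r0.
have sr : s <= r by rewrite ge_min lexx.
have sK : (`|K| + 1) * s <= nm (f' z) / 12.
  have : s <= nm (f' z) / (`|K| + 1) / 12 by rewrite ge_min lexx orbT.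
  by rewrite mulrAC ler_pdivlMr// mulrC.
have qf' w w' : nm (w - z) < s -> nm (w' - z) < s ->
    nm (f w' - f w - (w' - w) * f' w) <= (`|K| + 1) * nm (w' - w) ^+ 2.
  move=> hw hw'; apply: le_trans (qf _ _ _ _) _; [lra|lra|].
  by rewrite ler_wpM2r ?sqr_ge0.
have f'c w : nm (w - z) < s -> nm (f' w - f' z) <= 2 * ((`|K| + 1) * s).
  move=> hw; have [->|wz] := eqVneq w z.
    by rewrite subrr nm0 !mulr_ge0 ?(ltW K1) ?(ltW s0).
  have zs : nm (z - z) < s by rewrite subrr nm0.
  have := qf' _ _ hw zs; have := qf' _ _ zs hw.
  rewrite (nmBC z w).
  have wz0 : 0 < nm (w - z) by rewrite nm_gt0 subr_eq0.
  move=> h1 h2; rewrite -(ler_pM2l wz0) -nmM.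
  have -> : (w - z) * (f' w - f' z) = f w - f z - (w - z) * f' z
    + (f z - f w - (z - w) * f' w) by ring.
  apply: le_trans (nmD _ _) _; apply: le_trans (lerD h1 h2) _.
  have : (`|K| + 1) * nm (w - z) ^+ 2 <= (`|K| + 1) * (nm (w - z) * s).
    by rewrite expr2 ler_pM2l// ler_pM2l// ltW.
  by lra.
exists s; first by rewrite s0.
split=> [w hw|w w' hw hw'].
  apply/eqP => fw0; have := f'c _ hw.
  by rewrite fw0 sub0r nmN; lra.
have := qf' _ _ hw hw'; have := f'c _ hw.
have hww : nm (w' - w) <= 2 * s.
  by have := nm_triang z w' w; rewrite [nm (z - w)]nmBC; lra.
move=> h1 h2.
have -> : f w' - f w - (w' - w) * f' z = (f w' - f w - (w' - w) * f' w)
  + (w' - w) * (f' w - f' z) by ring.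
apply: le_trans (nmD _ _) _; rewrite nmM.
have n0 := nm_ge0 (w' - w).
have h3 : nm (w' - w) * nm (f' w - f' z) <= nm (w' - w) * (nm (f' z) / 6).
  by rewrite ler_wpM2l//; lra.
have h4 : (`|K| + 1) * nm (w' - w) ^+ 2 <= nm (f' z) / 6 * nm (w' - w).
  rewrite expr2 mulrA ler_wpM2r//.
  have := ler_wpM2l (ltW K1) hww; lra.
have : 0 <= nm (f' z) * nm (w' - w) by rewrite mulr_ge0// ltW.
by lra.
Qed.

Lemma near_linear f (O : set C) z : open O -> O z ->
  (forall w, O w -> differentiable f w) -> derive1 f z != 0 ->
  exists2 r : R, 0 < r & (forall w, nm (w - z) < r -> O w /\ derive1 f w != 0) /\
    forall w w', nm (w - z) < r -> nm (w' - z) < r ->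
      nm (f w' - f w - (w' - w) * derive1 f z) <=
      nm (derive1 f z) / 2 * nm (w' - w).
Proof.
move=> oO Oz df a0; have [r [M [r0 dr fM]]] := holo_disc oO Oz df.
have dr' w : nm (w - z) < 25 * r -> has_deriv f (derive1 f w) w.
  by move=> /dr[].
have [K [B [qf _]]] := holo_quad r0 dr' fM.
have r4 : 0 < r / 4 by rewrite divr_gt0.
have [s /andP[s0 sr] [s1 s2]] := quad_linear r4 qf a0.
exists s; first exact: s0.
split; last exact: s2.
move=> w ws; split; last exact: s1.
have r25 : s <= 25 * r by clear -sr r0; lra.
by case: (dr w (lt_le_trans ws r25)).
Qed.

Lemma near_linear_inj f z a (r : R) : a != 0 ->
  (forall w w', nm (w - z) < r -> nm (w' - z) < r ->
      nm (f w' - f w - (w' - w) * a) <= nm a / 2 * nm (w' - w)) ->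
  forall w w', nm (w - z) < r -> nm (w' - z) < r -> f w = f w' -> w = w'.
Proof.
move=> a0 fl w w' hw hw' fw; have := fl _ _ hw hw'.
rewrite fw subrr sub0r nmN nmM => h; apply/eqP.
rewrite eq_sym -subr_eq0 -nm_eq0 eq_le nm_ge0 andbT.
have na : 0 < nm a by rewrite nm_gt0.
by rewrite -(ler_pM2l na) mulr0; have := nm_ge0 (w' - w); lra.
Qed.

(* Newton iteration with frozen derivative. *)
Lemma near_linear_surj f z a (r : R) : a != 0 -> 0 < r ->
  (forall w w', nm (w - z) < r -> nm (w' - z) < r ->
      nm (f w' - f w - (w' - w) * a) <= nm a / 2 * nm (w' - w)) ->
  forall c, nm (c - f z) < nm a * r / 4 -> exists2 w, nm (w - z) < r & f w = c.
Proof.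
move=> a0 r0 fl c cz; have na : 0 < nm a by rewrite nm_gt0.
pose T w := w - (f w - c) / a; pose v n := iter n T z.
have Tc w w' : nm (w - z) < r -> nm (w' - z) < r ->
    nm (T w' - T w) <= nm (w' - w) / 2.
  move=> hw hw'; rewrite -(ler_pM2l na) -nmM.
  have -> : a * (T w' - T w) = - (f w' - f w - (w' - w) * a).
    by rewrite /T; field.
  by rewrite nmN; apply: le_trans (fl _ _ hw hw') _; lra.
(* The length of the first step, less than [r / 4]. Each later step is at most half the previous
   one, so the iterates stay within [2 * q] of [z], inside the disc where [T] contracts. *)
pose q := nm (c - f z) / nm a.
have qr : q < r / 4 by rewrite /q ltr_pdivrMr//; lra.
have q0 : 0 <= q by rewrite divr_ge0 ?nm_ge0.
have v1 : nm (v 1%N - v 0%N) <= q.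
  have -> : v 1%N - v 0%N = (c - f z) / a by rewrite /v /= /T; field.
  by rewrite nmM nmV.
have vP n : nm (v n - z) <= 2 * q * (1 - (2 ^+ n)^-1) /\
    nm (v n.+1 - v n) <= q / 2 ^+ n.
  elim: n => [|n [IH1 IH2]].
    split; last by rewrite expr0 divr1.
    by rewrite {1}/v /= subrr nm0 expr0 invr1 addrN mulr0.
  have p0 : 0 < (2 ^+ n.+1 : R)^-1 by rewrite invr_gt0 exprn_gt0.
  have p1 : (2 ^+ n : R)^-1 = 2 * (2 ^+ n.+1)^-1.
    by rewrite exprS invfM mulrA divff ?mul1r ?pnatr_eq0.
  have h1 : nm (v n.+1 - z) <= 2 * q * (1 - (2 ^+ n.+1)^-1).
    have := nm_triang (v n) (v n.+1) z; rewrite p1 in IH1 IH2; lra.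
  split=> //; have hn : nm (v n - z) < r.
    apply: le_lt_trans IH1 _; have : 0 <= q * (2 ^+ n)^-1.
      by rewrite mulr_ge0// invr_ge0 exprn_ge0.
    by lra.
  have hn1 : nm (v n.+1 - z) < r.
    by apply: le_lt_trans h1 _; have : 0 <= q * (2 ^+ n.+1)^-1;
      [rewrite mulr_ge0// ltW|lra].
  by apply: le_trans (Tc _ _ hn hn1) _; rewrite p1 in IH2; lra.
have vr n : nm (v n - z) <= 2 * q.
  have [h _] := vP n; apply: le_trans h _.
  have : 0 <= q * (2 ^+ n)^-1 by rewrite mulr_ge0// invr_ge0 exprn_ge0.
  by lra.
have vv n j : nm (v (n + j)%N - v n) <= 2 * q * ((2 ^+ n)^-1 - (2 ^+ (n + j))^-1).
  elim: j => [|j IH]; first by rewrite addn0 !subrr nm0 mulr0.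
  have [_ h] := vP (n + j)%N; rewrite addnS.
  have p1 : (2 ^+ (n + j) : R)^-1 = 2 * (2 ^+ (n + j).+1)^-1.
    by rewrite exprS invfM mulrA divff ?mul1r ?pnatr_eq0.
  have := nm_triang (v (n + j)%N) (v (n + j).+1) (v n).
  by rewrite p1 in IH h; lra.
have bv : bounded v.
  exists (2 * q + nm z) => n; have := nm_sub (v n) z; have := vr n; lra.
pose p := ulim v.
have pz : nm (p - z) < r.
  by apply: le_lt_trans (ulim_le vr) _; lra.
have pv n : nm (p - v n) <= 2 * q / 2 ^+ n.
  rewrite -[v n]ulim_cst.
  have -> : p - ulim (fun=> v n) = ulim (fun m => v m - v n).
    rewrite (ulimD (v := fun=> - v n)) ?ulim_cst//; exact: bounded_cst.
  apply: (@ulim_le_eventually _ _ _ n); first exact/boundedD/bounded_cst.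
  move=> m nm'; rewrite -(subnKC nm'); apply: le_trans (vv _ _) _.
  have : 0 <= q * (2 ^+ (n + (m - n)))^-1.
    by rewrite mulr_ge0// invr_ge0 exprn_ge0.
  by lra.
exists p => //; apply/eqP; rewrite -subr_eq0 -nm_eq0 eq_le nm_ge0 andbT.
apply: ler_eps => e e0; rewrite add0r.
have [n hn] := exp2_small (q * nm a * 4) e0.
have hv : nm (v n - z) < r by apply: le_lt_trans (vr n) _; lra.
have := fl _ _ hv pz.
have [_ h] := vP n.
have E : f (v n) - c = - (a * (v n.+1 - v n)).
  by rewrite {3}/v /= -/(v n) /T; field.
have h2 : nm (f (v n) - c) <= nm a * (q / 2 ^+ n).
  by rewrite E nmN nmM ler_pM2l.
have h3 : nm ((p - v n) * a) <= 2 * q / 2 ^+ n * nm a.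
  by rewrite nmM ler_pM2r.
have h4 : nm a / 2 * nm (p - v n) <= nm a / 2 * (2 * q / 2 ^+ n).
  by rewrite ler_wpM2l// divr_ge0 ?nm_ge0.
have := nm_triang (f (v n)) (f p) c.
have := nm_sub (f p - f (v n)) ((p - v n) * a).
by lra.
Qed.

Lemma holo_open_map f (O : set C) : open O ->
  (forall w, O w -> differentiable f w) -> (forall w, O w -> derive1 f w != 0) ->
  open (f @` O).
Proof.
move=> oO df f0; rewrite openE => _ [z Oz <-].
have [r r0 [rO fl]] := near_linear oO Oz df (f0 _ Oz).
have a0 : 0 < nm (derive1 f z) by rewrite nm_gt0 f0.
apply/nbhs_nm; exists (nm (derive1 f z) * r / 4).
  by rewrite divr_gt0// mulr_gt0.
move=> c /(near_linear_surj (f0 _ Oz) r0 fl)[w wr <-].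
by exists w => //; case: (rO w wr).
Qed.

(** [Lam (phi n.+1)] is the [n]-th Taylor coefficient and [g n] the remainder after [n] terms
    divided by [(w - z) ^+ n]. If all coefficients vanish, [f w] is at most [2 * M / 2 ^+ n] for
    every [n]; otherwise the first nonzero coefficient dominates its [g n] near [z]. *)
Lemma zeros_isolated f (O : set C) z : open O -> O z ->
  (forall w, O w -> differentiable f w) ->
  exists2 r : R, 0 < r & (forall w, nm (w - z) < r -> f w = 0) \/
    (forall w, nm (w - z) < r -> w != z -> f w != 0).
Proof.
move=> oO Oz df; have [r [M [r0 dr fM]]] := holo_disc oO Oz df.
have dr' w : nm (w - z) < 25 * r -> has_deriv f (derive1 f w) w.
  by move=> /dr[].
pose s := r / 8; have s0 : 0 < s by rewrite divr_gt0.
have s0' : 0 <= s by exact: ltW.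
have su u : nm u = 1 -> nm (rc s * u) = s.
  by move=> u1; rewrite nmM u1 mulr1 nm_rc ger0_norm.
pose phi n u := f (z + rc s * u) * (rc s * u) / (rc s * u) ^+ n.
have phiM n u : nm u = 1 -> nm (phi n u) <= M * s / s ^+ n.
  move=> u1; rewrite /phi nmM nmV nmX nmM su// ler_wpM2r ?invr_ge0 ?exprn_ge0//.
  by rewrite ler_wpM2r// fM// addrAC subrr add0r su// /s; lra.
pose g n w := Lam (fun u => phi n u * ker s z u w).
have gb n w : nm (w - z) < s / 2 -> nm (g n w) <= M * s / s ^+ n * (2 / s).
  move=> hw; have := @Lam_kerX_bound _ (phi n) z s _ 1 w s0 (phiM n) hw.
  by rewrite expr1.
have bphi n : ubounded (phi n) by exists (M * s / s ^+ n) => u; exact: phiM.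
have bker w : nm (w - z) < s / 2 -> ubounded (fun u => ker s z u w).
  by move=> hw; exists (2 / s) => u u1; exact: ker_bound.
have f0 w : nm (w - z) < s / 2 -> f w = g 0%N w.
  move=> hw; rewrite (cauchy_formula r0 dr' fM); last by rewrite /s in hw; lra.
  by apply: eq_Lam => u _; rewrite /phi expr0 divr1.
have gS n w : nm (w - z) < s / 2 -> g n w = Lam (phi n.+1) + (w - z) * g n.+1 w.
  move=> hw; rewrite -LamZ; last exact: uboundedM (bphi _) (bker _ hw).
  rewrite -LamD//; last first.
    apply: uboundedM; first exact: ubounded_cst.
    exact: uboundedM (bphi _) (bker _ hw).
  apply: eq_Lam => u u1; rewrite /phi /ker exprS.
  have x0 : rc s * u != 0 by rewrite -nm_gt0 su.
  have y0 : rc s * u - (w - z) != 0.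
    rewrite -nm_gt0; have ws : nm (w - z) < s by lra.
    by have := circ_ge ws u1; lra.
  move: (rc s * u) x0 y0 => x x0 y0; field.
  by rewrite y0 x0 expf_neq0.
have fg n : (forall k, (k < n)%N -> Lam (phi k.+1) = 0) ->
    forall w, nm (w - z) < s / 2 -> f w = (w - z) ^+ n * g n w.
  elim: n => [_|n IH hk] w hw; first by rewrite expr0 mul1r f0.
  rewrite IH// => [|k kn]; last by rewrite hk// ltnW.
  by rewrite gS// hk// add0r exprSr mulrA.
have [all0|] := pselect (forall k, Lam (phi k.+1) = 0).
  exists (s / 2); first by rewrite divr_gt0.
  left=> w hw; apply/eqP; rewrite -nm_eq0 eq_le nm_ge0 andbT.
  apply: ler_eps => e e0; rewrite add0r.
  have [n hn] := exp2_small (2 * M) e0.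
  rewrite (fg n)// nmM nmX.
  apply: (@le_trans _ _ ((s / 2) ^+ n * (M * s / s ^+ n * (2 / s)))).
    apply: ler_pM; rewrite ?exprn_ge0 ?nm_ge0 ?gb//.
    have s2 : 0 <= s / 2 by rewrite divr_ge0.
    by rewrite lerXn2r ?nnegrE ?nm_ge0// ltW.
  apply: le_trans _ (ltW hn); rewrite expr_div_n.
  have sn : s ^+ n != 0 by rewrite expf_neq0// gt_eqF.
  have tn : (2 : R) ^+ n != 0 by rewrite expf_neq0// pnatr_eq0.
  have sn0 : s != 0 by rewrite gt_eqF.
  move: (s ^+ n) (2 ^+ n) sn tn => x y x0 y0.
  rewrite le_eqVlt; apply/orP; left; apply/eqP.
  by clear - x0 y0 sn0; clearbody s; field; rewrite x0 y0 sn0.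
move=> /existsNP[k0 /eqP hk0].
have ex : exists k, Lam (phi k.+1) != 0 by exists k0.
case: (ex_minnP ex) => n an nmin.
have fn : forall w, nm (w - z) < s / 2 -> f w = (w - z) ^+ n * g n w.
  apply: fg => k kn; apply/eqP/negPn/negP => /nmin; by rewrite leqNgt kn.
pose B := `|M * s / s ^+ n.+1 * (2 / s)| + 1.
have B0 : 0 < B by rewrite ltr_wpDl.
(* Within [t] the term [(w - z) * g n.+1 w] is smaller than the leading coefficient and cannot
   cancel it. *)
pose t := Num.min (s / 2) (nm (Lam (phi n.+1)) / B).
exists t; first by rewrite lt_min !divr_gt0// nm_gt0.
right=> w; rewrite lt_min => /andP[w1 w2] wz; rewrite fn// mulf_neq0//.
  by rewrite expf_neq0// subr_eq0.
apply/eqP => g0; move: w2; rewrite ltr_pdivlMr// ltNge => /negP; apply.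
have := gS n w w1; rewrite g0 => /eqP; rewrite eq_sym addr_eq0 => /eqP ->.
rewrite nmN nmM ler_wpM2l ?nm_ge0//; apply: le_trans (gb _ _ w1) _.
by apply: le_trans (ler_norm _) _; rewrite lerDl.
Qed.

End OneVariable.

(** * Holomorphic functions on open subsets of C^2 *)

Section TwoVariables.
Context {R : realType}.
Local Notation C := (cplx R).
Local Notation V := 'rV[C]_2.
Implicit Types (z w : C) (p q : V) (f : V -> C).

Lemma pt20 (a b : C) : pt2 a b 0 0 = a. Proof. by rewrite mxE. Qed.
Lemma pt21 (a b : C) : pt2 a b 0 1 = b. Proof. by rewrite mxE. Qed.

Lemma pt2_eta p : p = pt2 (p 0 0) (p 0 1).
Proof.
apply/rowP => i; rewrite mxE; case: eqP => [->//|/eqP i0]; congr (p 0 _).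
by apply/val_inj; case: i i0 => [[|[|]]].
Qed.

Lemma nbhs_rv2 p (P : set V) : nbhs p P <->
  exists2 e : R, 0 < e & forall q, nm (q 0 0 - p 0 0) < e ->
    nm (q 0 1 - p 0 1) < e -> P q.
Proof.
split=> [/nbhs_ballP[e /= e0 eP]|[e e0 eP]].
  exists (complex.Re e); first exact: pos_Re.
  move=> q q0 q1; apply: eP; split=> // i j.
  rewrite (pos_rc e0); apply/ball_nm; rewrite nmBC ord1.
  case: (eqVneq j 0) => [->//|j0]; suff -> : j = 1 by [].
  by apply/val_inj; case: j j0 => [[|[|]]].
apply/nbhs_ballP; exists (rc e); first by rewrite /= rc_gt0.
move=> q [_ pq]; apply: eP; rewrite nmBC; apply/ball_nm; exact: pq.
Qed.

Lemma nm_coord p i : rc (nm (p 0 i)) <= `|p|.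
Proof.
rewrite -normE [leRHS](_ : `|p| = mx_norm p)// mx_normE -[leLHS]nngE num_le.
exact: (le_bigmax _ (fun ij : 'I_1 * 'I_2 => `|p ij.1 ij.2|%:nng) (0, i)).
Qed.

End TwoVariables.

Section TwoVariablesRegularity.
Context {R : realType}.
Local Notation C := (cplx R).
Local Notation V := 'rV[C]_2.
Implicit Types (z w : C) (p q : V) (f g : V -> C).

Lemma ord2P (i : 'I_2) : i = 0 \/ i = 1.
Proof. by case: i => [[|[|//]] i2]; [left|right]; exact/val_inj. Qed.

Lemma rv2_decomp p : p = p 0 0 *: 'e_0 + p 0 1 *: 'e_1.
Proof.
apply/rowP => i; rewrite !mxE.
by case: i => [[|[|//]] i2] /=; rewrite ?mulr1 ?mulr0 ?addr0 ?add0r;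
  congr (p _ _); apply/val_inj.
Qed.

Lemma frechet2 f p a b :
  (forall e : R, 0 < e -> exists2 d : R, 0 < d & forall q,
     nm (q 0 0 - p 0 0) < d -> nm (q 0 1 - p 0 1) < d ->
     nm (f q - f p - ((q 0 0 - p 0 0) * a + (q 0 1 - p 0 1) * b)) <=
       e * (nm (q 0 0 - p 0 0) + nm (q 0 1 - p 0 1))) ->
  [/\ differentiable f p, 'D_('e_0) f p = a & 'D_('e_1) f p = b].
Proof.
move=> fP.
have lin : linear (fun h : V => h 0 0 * a + h 0 1 * b : C).
  by move=> u y z; rewrite !mxE /GRing.scale /=; ring.
pose linM := GRing.isLinear.Build _ _ _ _ _ lin.
pose L : {linear V -> C} := HB.pack (fun h : V => h 0 0 * a + h 0 1 * b : C) linM.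
have cL : continuous L.
  have c i : continuous (fun h : V => h 0 i : C) by exact: coord_continuous.
  move=> h; suff : (fun h : V => h 0 0 * a + h 0 1 * b : C) @ h -->
    (h 0 0 * a + h 0 1 * b : C) by [].
  have ca i d : (fun h : V => h 0 i * d : C) @ h --> (h 0 i * d : C).
    exact: cvgMr_tmp (c i h).
  exact: cvgD (ca 0 a) (ca 1 b).
have [df E] : differentiable f p /\ 'd f p = L :> (V -> C).
  apply: diff_intro => // e e0.
  have e20 : 0 < complex.Re e / 2 by rewrite divr_gt0 ?pos_Re.
  have [d d0 dP] := fP _ e20.
  apply/nbhs_rv2; exists d => // h; rewrite !mxE !subr0 => h0 h1.
  have := dP (h + p); rewrite !mxE !addrK => /(_ h0 h1).
  rewrite (pos_rc e0) normE => /=.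
  have le0 := nm_coord h 0; have le1 := nm_coord h 1.
  have -> : `|h| = rc (complex.Re `|h|).
    by rewrite /rc RRe_real// normr_real.
  rewrite -rcM rc_le => /le_trans; apply.
  move: le0 le1; have -> : `|h| = rc (complex.Re `|h|).
    by rewrite /rc RRe_real// normr_real.
  rewrite !rc_le /= => le0 le1; have := pos_Re e0 => ep.
  rewrite mulrAC ler_pdivrMr// -mulrA ler_pM2l//; lra.
by split=> //; rewrite deriveE// E /= !mxE /= ?mul1r ?mul0r ?addr0 ?add0r.
Qed.

Lemma diff2E f p h : differentiable f p ->
  'd f p h = h 0 0 * 'D_('e_0) f p + h 0 1 * 'D_('e_1) f p.
Proof.
by move=> df; rewrite {1}[h]rv2_decomp linearD !linearZ !deriveE.
Qed.

Lemma diff_line (W : normedModType C) (z : C) (v w : W) :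
  differentiable (fun x : C => x *: v + w) z /\
  'd (fun x : C => x *: v + w) z = (fun h : C => h *: v) :> (C -> W).
Proof.
have [d1 d2] := is_diffD (is_diff_scalel z v) (is_diff_cst w z).
by split; [exact d1|rewrite [LHS]d2 addr0].
Qed.

Lemma chain_line (W : normedModType C) (f : W -> C) (g : C -> W) (z : C) (v : W) :
  differentiable g z -> 'd g z = (fun h : C => h *: v) :> (C -> W) ->
  differentiable f (g z) -> has_deriv (fun x => f (g x)) ('d f (g z) v) z.
Proof.
move=> dg Dg df; have dfg := differentiable_comp dg df.
apply/has_derivP; split; first exact: dfg.
have E1 : derive1 (fun x => f (g x)) z = 'd (f \o g) z 1 by exact: (derive1E' dfg).
rewrite E1.
have -> : 'd (f \o g) z 1 = 'd f (g z) ('d g z 1) by rewrite (diff_comp dg df).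
by rewrite Dg scale1r.
Qed.

Lemma partial0 f z w : differentiable f (pt2 z w) ->
  has_deriv (fun x => f (pt2 x w)) ('D_('e_0) f (pt2 z w)) z.
Proof.
move=> df.
have E : (fun x => pt2 x w) = (fun x : C => x *: ('e_0 : V) + pt2 0 w).
  apply/funext => x; apply/rowP => i; rewrite !mxE.
  by case: i => [[|[|//]] i2] /=; rewrite ?mulr1 ?mulr0 ?addr0 ?add0r.
have [dpt Dpt] : differentiable (fun x => pt2 x w) z /\
    'd (fun x => pt2 x w) z = (fun h : C => h *: ('e_0 : V)) :> (C -> V).
  by rewrite E; exact: diff_line.
by rewrite (deriveE 'e_0 df); exact: chain_line dpt Dpt df.
Qed.

Lemma partial1 f z w : differentiable f (pt2 z w) ->
  has_deriv (fun x => f (pt2 z x)) ('D_('e_1) f (pt2 z w)) w.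
Proof.
move=> df.
have E : (fun x => pt2 z x) = (fun x : C => x *: ('e_1 : V) + pt2 z 0).
  apply/funext => x; apply/rowP => i; rewrite !mxE.
  by case: i => [[|[|//]] i2] /=; rewrite ?mulr1 ?mulr0 ?addr0 ?add0r.
have [dpt Dpt] : differentiable (fun x => pt2 z x) w /\
    'd (fun x => pt2 z x) w = (fun h : C => h *: ('e_1 : V)) :> (C -> V).
  by rewrite E; exact: diff_line.
by rewrite (deriveE 'e_1 df); exact: chain_line dpt Dpt df.
Qed.

Lemma quad2_diff z0 w0 r (g g1 g2 : C -> C -> C) p : quad2 z0 w0 r g g1 g2 ->
  nm (p 0 0 - z0) < r -> nm (p 0 1 - w0) < r ->
  [/\ differentiable (fun q => g (q 0 0) (q 0 1)) p,
    'D_('e_0) (fun q => g (q 0 0) (q 0 1)) p = g1 (p 0 0) (p 0 1) &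
    'D_('e_1) (fun q => g (q 0 0) (q 0 1)) p = g2 (p 0 0) (p 0 1)].
Proof.
move=> [K qg] p0 p1; apply: frechet2 => e e0.
have K1 : 0 < `|K| + 1 by rewrite ltr_wpDl.
have KK : K <= `|K| + 1 by apply: le_trans (ler_norm K) _; lra.
pose m := Num.min (r - nm (p 0 0 - z0)) (r - nm (p 0 1 - w0)).
pose d := Num.min m (e / (`|K| + 1) / 2).
exists d; first by rewrite !lt_min !subr_gt0 p0 p1 !divr_gt0.
move=> q; rewrite !lt_min => /andP[/andP[a1 a2] a3] /andP[/andP[b1 b2] b3].
have q0 : nm (q 0 0 - z0) < r by have := nm_triang (p 0 0) (q 0 0) z0; lra.
have q1 : nm (q 0 1 - w0) < r by have := nm_triang (p 0 1) (q 0 1) w0; lra.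
apply: le_trans (qg _ _ _ _ p0 p1 q0 q1) _; rewrite expr2 mulrA.
have n0 := nm_ge0 (q 0 0 - p 0 0); have n1 := nm_ge0 (q 0 1 - p 0 1).
rewrite ler_wpM2r ?addr_ge0//.
apply: le_trans (ler_wpM2r (addr_ge0 n0 n1) KK) _.
rewrite mulrC -ler_pdivlMr//; lra.
Qed.

(** The regularity theorem on which all iterated derivatives rest: near [p] the function agrees with
    the Cauchy representation of [holo2_quad], whose two first derivatives are differentiable and
    share their mixed derivative. *)
Theorem partial_holo f (O : set V) p : open O -> O p ->
  (forall q, O q -> differentiable f q) ->
  [/\ differentiable ('D_('e_0) f) p, differentiable ('D_('e_1) f) p &
    'D_('e_0) ('D_('e_1) f) p = 'D_('e_1) ('D_('e_0) f) p].
Proof.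
move=> oO Op df.
have /nbhs_rv2[e e0 eO] : nbhs p O by exact: open_nbhs_nbhs.
have /nbhs_rv2[d d0 dP] : \forall q \near p, nm (f q - f p) < 1.
  have := differentiable_continuous (df _ Op).
  move=> /(_ [set x | nm (x - f p) < 1]); apply.
  by apply/nbhs_nm; exists 1.
pose s := Num.min e d / 25.
have [se sd] : 25 * s <= e /\ 25 * s <= d.
  by rewrite /s mulrC divfK ?pnatr_eq0//; split; rewrite ge_min lexx ?orbT.
have s0 : 0 < s by rewrite divr_gt0// lt_min e0.
have dfp z w : nm (z - p 0 0) < 25 * s -> nm (w - p 0 1) < 25 * s ->
    has_deriv (fun x => f (pt2 x w)) ('D_('e_0) f (pt2 z w)) z /\
    has_deriv (fun x => f (pt2 z x)) ('D_('e_1) f (pt2 z w)) w.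
  move=> hz hw; have dfz : differentiable f (pt2 z w).
    by apply/df/eO; rewrite ?pt20 ?pt21; lra.
  by split; [exact: partial0|exact: partial1].
have fM z w : nm (z - p 0 0) < 5 * s -> nm (w - p 0 1) < 5 * s ->
    nm (f (pt2 z w)) <= nm (f p) + 1.
  move=> hz hw; have := dP (pt2 z w); rewrite pt20 pt21.
  have h1 : nm (z - p 0 0) < d by lra.
  have h2 : nm (w - p 0 1) < d by lra.
  by move=> /(_ h1 h2); have := nm_sub (f (pt2 z w)) (f p); lra.
have [t [g [g1 [g2 [g11 [g12 [g22 [t0 [fg q0 q1 q2]]]]]]]]] :=
  @holo2_quad _ (fun z w => f (pt2 z w)) _ _ _ _ _ _ s0 dfp fM.
pose B q := nm (q 0 0 - p 0 0) < t /\ nm (q 0 1 - p 0 1) < t.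
have nB q : B q -> \forall x \near q, B x.
  move=> [h1 h2]; apply/nbhs_rv2.
  exists (Num.min (t - nm (q 0 0 - p 0 0)) (t - nm (q 0 1 - p 0 1))).
    by rewrite lt_min !subr_gt0 h1.
  move=> x; rewrite !lt_min => /andP[a1 a2] /andP[b1 b2]; split.
    by have := nm_triang (q 0 0) (x 0 0) (p 0 0); lra.
  by have := nm_triang (q 0 1) (x 0 1) (p 0 1); lra.
have D1 q : B q -> 'D_('e_0) f q = g1 (q 0 0) (q 0 1) /\
    'D_('e_1) f q = g2 (q 0 0) (q 0 1).
  move=> Bq; have [h1 h2] := Bq; have [dg <- <-] := quad2_diff q0 h1 h2.
  pose G (x : V) := g (x 0 0) (x 0 1).
  have E : \forall x \near q, G x = f x.
    apply: filterS (nB _ Bq) => x [x1 x2].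
    by rewrite [in RHS](pt2_eta x) fg.
  by rewrite (near_derive 'e_0 E dg) (near_derive 'e_1 E dg).
have Bp : B p by split; rewrite subrr nm0.
have [b1 b2] := Bp.
have [dg1 g1D0 g1D1] := quad2_diff q1 b1 b2.
have [dg2 g2D0 g2D1] := quad2_diff q2 b1 b2.
pose G1 (x : V) := g1 (x 0 0) (x 0 1); pose G2 (x : V) := g2 (x 0 0) (x 0 1).
have E1 : \forall x \near p, G1 x = 'D_('e_0) f x.
  by apply: filterS (nB _ Bp) => x /D1[-> _].
have E2 : \forall x \near p, G2 x = 'D_('e_1) f x.
  by apply: filterS (nB _ Bp) => x /D1[_ ->].
split; [exact: near_differentiable E1 dg1|exact: near_differentiable E2 dg2|].
have h1 : 'D_('e_1) ('D_('e_0) f) p = g12 (p 0 0) (p 0 1).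
  exact: (etrans (near_derive 'e_1 E1 dg1) g1D1).
have h2 : 'D_('e_0) ('D_('e_1) f) p = g12 (p 0 0) (p 0 1).
  exact: (etrans (near_derive 'e_0 E2 dg2) g2D0).
exact: (etrans h2 (esym h1)).
Qed.

Lemma dword_holo f (O : set V) (w : seq 'I_2) : open O ->
  (forall q, O q -> differentiable f q) ->
  forall q, O q -> differentiable (dword w f) q.
Proof.
move=> oO df; elim: w => [//|a w IH] q Oq /=.
have [h0 h1 _] := partial_holo oO Oq IH.
by case: (ord2P a) => ->; [exact: h0|exact: h1].
Qed.

Lemma near_dword f g q (w : seq 'I_2) (O : set V) : open O -> O q ->
  (forall q, O q -> differentiable f q) -> (forall q, O q -> f q = g q) ->
  dword w f q = dword w g q.
Proof.
move=> oO Oq df fg; elim: w q Oq => [|a w IH] q Oq /=; first exact: fg.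
have E : \forall x \near q, dword w f x = dword w g x.
  by apply: filterS (open_nbhs_nbhs (conj oO Oq)) => x Ox; exact: IH.
exact: esym (near_derive 'e_a E (dword_holo w oO df Oq)).
Qed.

(** Read off from two variables, for the function that is constant in the second coordinate. *)
Lemma derive1_holo (f : C -> C) (O : set C) z : open O -> O z ->
  (forall w, O w -> differentiable f w) -> differentiable (derive1 f) z.
Proof.
move=> oO Oz df; pose F (q : V) := f (q 0 0).
pose O' : set V := (fun q : V => q 0 0) @^-1` O.
have oO' : open O'.
  by apply: open_comp => // q _; exact: coord_continuous.
have dc (q : V) : differentiable (fun q : V => q 0 0 : C) q.
  exact: differentiable_coord.
have dF q : O' q -> differentiable F q.
  by move=> Oq; apply: (differentiable_comp (dc q)); exact: df.
have Op : O' (pt2 z 0) by rewrite /O' /= pt20.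
have [h _ _] := partial_holo oO' Op dF.
have E : \forall w \near z, 'D_('e_0) F (pt2 w 0) = derive1 f w.
  apply: filterS (open_nbhs_nbhs (conj oO Oz)) => w Ow.
  have dFw : differentiable F (pt2 w 0) by apply: dF; rewrite /O' /= pt20.
  have /has_derivP[_ <-] := partial0 dFw.
  by congr (derive1 _ w); apply/funext => x; rewrite /F pt20.
apply: near_differentiable E _.
have dpt : differentiable (fun x => pt2 x 0 : V) z.
  have -> : (fun x => pt2 x 0) = (fun x : C => x *: ('e_0 : V)).
    apply/funext => x; apply/rowP => i; rewrite !mxE.
    by case: i => [[|[|//]] i2] /=; rewrite ?mulr1 ?mulr0.
  exact: ex_diff.
exact: (differentiable_comp dpt h).
Qed.

End TwoVariablesRegularity.

(** * The Moyal-Weyl product on open subsets of C^2 *)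

Section CommutingBinomial.
Context {W : zmodType}.
Variables (A B : W -> W).
Hypotheses (AD : {morph A : x y / x + y}) (BD : {morph B : x y / x + y}).
Hypothesis AB : forall x, A (B x) = B (A x).

Lemma additive0 (D : W -> W) : {morph D : x y / x + y} -> D 0 = 0.
Proof. by move=> DD; apply: (addIr (D 0)); rewrite -DD !add0r. Qed.

Lemma additiveMn (D : W -> W) x n : {morph D : x y / x + y} ->
  D (x *+ n) = D x *+ n.
Proof.
move=> DD; elim: n => [|n IH]; first by rewrite !mulr0n additive0.
by rewrite !mulrSr DD IH.
Qed.

Lemma additive_sum (D : W -> W) n (F : 'I_n -> W) :
  {morph D : x y / x + y} -> D (\sum_(i < n) F i) = \sum_(i < n) D (F i).
Proof. by move=> DD; apply: (big_morph D DD); exact: additive0. Qed.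

Lemma iter_comm n x : iter n A (B x) = B (iter n A x).
Proof. by elim: n => //= n ->; rewrite AB. Qed.

Lemma iter_binomial n x : iter n (fun y => A y + B y) x =
  \sum_(k < n.+1) iter (n - k) A (iter k B x) *+ 'C(n, k).
Proof.
elim: n => [|n IH]; first by rewrite big_ord_recl big_ord0 /= addr0.
rewrite iterS IH (additive_sum _ AD) (additive_sum _ BD).
rewrite [in RHS]big_ord_recl /= ?subn0 ?bin0.
rewrite [X in X + _ = _]big_ord_recl /= ?subn0 ?bin0 -addrA; congr (_ + _).
rewrite [X in _ + X = _]big_ord_recr /= ?subnn ?binn.
rewrite [in RHS]big_ord_recr /= ?subnn ?binn addrA; congr (_ + _).
rewrite -big_split; apply: eq_bigr => k _ /=.
rewrite (additiveMn _ _ AD) (additiveMn _ _ BD) /bump /= !add1n binS mulrnDr; congr (_ + _).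
  by rewrite -iterS subSS -subSn.
by rewrite subSS -iter_comm.
Qed.

End CommutingBinomial.

(** Both sides expand the [n]-th iterate of the sum of the three operators, once with [P] split off
    and once with [S]. *)
Lemma iter_trinomial (W : zmodType) (P Q S : W -> W) n x :
  {morph P : x y / x + y} -> {morph Q : x y / x + y} ->
  {morph S : x y / x + y} ->
  (forall x, P (Q x) = Q (P x)) -> (forall x, P (S x) = S (P x)) ->
  (forall x, Q (S x) = S (Q x)) ->
  \sum_(k < n.+1) iter (n - k) (fun y => Q y + S y) (iter k P x) *+ 'C(n, k) =
  \sum_(k < n.+1) iter (n - k) (fun y => P y + Q y) (iter k S x) *+ 'C(n, k).
Proof.
move=> PD QD SD PQ PS QS.
have D1 : {morph (fun y => Q y + S y) : x y / x + y}.
  by move=> y z; rewrite QD SD addrACA.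
have D2 : {morph (fun y => P y + Q y) : x y / x + y}.
  by move=> y z; rewrite PD QD addrACA.
rewrite -iter_binomial => [|//|//|y]; last by rewrite PD PQ PS.
rewrite -iter_binomial => [|//|//|y]; last by rewrite SD PS QS.
congr (iter n _ x); apply/funext => y.
by rewrite [LHS]addrC addrA.
Qed.

(* A named zmodType, so that sums of arrays carry a single addition. *)
Definition arr6 (K : comNzRingType) : zmodType :=
  (nat -> nat -> nat -> nat -> nat -> nat -> K).

(** * Associativity on the level of formal jets *)

Section Arrays.
Context {K : comNzRingType}.
Local Notation W2 := (nat -> nat -> K).
Local Notation W4 := (nat -> nat -> W2).
Local Notation W6 := (arr6 K).

(* A k-fold tensor of jets is an array with two indices, the numbers of
   derivatives d/dz_1 and d/dz_2, for each factor; derivatives are shifts. *)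
Definition poisson4 (T : W4) : W4 := fun a b c d =>
  T a b.+1 c.+1 d - T a.+1 b c d.+1.

(** The Leibniz rule: a derivative of the restriction to the diagonal falls on either of the two
    factors. *)
Definition leib0 (T : W4) : W4 := fun a b c d => T a.+1 b c d + T a b c.+1 d.
Definition leib1 (T : W4) : W4 := fun a b c d => T a b.+1 c d + T a b c d.+1.

Definition pi12 (T : W6) : W6 := fun a b c d e f =>
  T a b.+1 c.+1 d e f - T a.+1 b c d.+1 e f.
Definition pi13 (T : W6) : W6 := fun a b c d e f =>
  T a b.+1 c d e.+1 f - T a.+1 b c d e f.+1.
Definition pi23 (T : W6) : W6 := fun a b c d e f =>
  T a b c d.+1 e.+1 f - T a b c.+1 d e f.+1.

Lemma fun6P (T U : W6) : (forall a b c d e f, T a b c d e f = U a b c d e f) ->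
  T = U.
Proof. by move=> TU; do 6!apply/funext => ?; exact: TU. Qed.

Lemma pi12D : {morph pi12 : x y / x + y}.
Proof.
move=> x y; apply: fun6P => a b c d e f.
rewrite [LHS](_ : _ = (x a b.+1 c.+1 d e f + y a b.+1 c.+1 d e f) -
  (x a.+1 b c d.+1 e f + y a.+1 b c d.+1 e f))//.
by rewrite opprD addrACA.
Qed.

Lemma pi13D : {morph pi13 : x y / x + y}.
Proof.
move=> x y; apply: fun6P => a b c d e f.
rewrite [LHS](_ : _ = (x a b.+1 c d e.+1 f + y a b.+1 c d e.+1 f) -
  (x a.+1 b c d e f.+1 + y a.+1 b c d e f.+1))//.
by rewrite opprD addrACA.
Qed.

Lemma pi23D : {morph pi23 : x y / x + y}.
Proof.
move=> x y; apply: fun6P => a b c d e f.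
rewrite [LHS](_ : _ = (x a b c d.+1 e.+1 f + y a b c d.+1 e.+1 f) -
  (x a b c.+1 d e f.+1 + y a b c.+1 d e f.+1))//.
by rewrite opprD addrACA.
Qed.

Lemma pi1213 x : pi12 (pi13 x) = pi13 (pi12 x).
Proof. by apply: fun6P => a b c d e f; rewrite /pi12 /pi13; ring. Qed.

Lemma pi1223 x : pi12 (pi23 x) = pi23 (pi12 x).
Proof. by apply: fun6P => a b c d e f; rewrite /pi12 /pi23; ring. Qed.

Lemma pi1323 x : pi13 (pi23 x) = pi23 (pi13 x).
Proof. by apply: fun6P => a b c d e f; rewrite /pi13 /pi23; ring. Qed.

(** The jet of the restriction of a tensor to the diagonal. Products of functions enter the algebra
    only through it. *)
Definition jmul (T : W4) : W2 := fun p q => iter p leib0 (iter q leib1 T) 0%N 0%N 0%N 0%N.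

Definition tens2 (A B : W2) : W4 := fun a b c d => A a b * B c d.

Lemma leib01 T : leib0 (leib1 T) = leib1 (leib0 T).
Proof. by do 4!apply/funext => ?; rewrite /leib0 /leib1; ring. Qed.

Lemma iter_leib01 n T : iter n leib1 (leib0 T) = leib0 (iter n leib1 T).
Proof. by elim: n => //= n ->; rewrite leib01. Qed.

Lemma jmulS0 T p q : jmul T p.+1 q = jmul (leib0 T) p q.
Proof. by rewrite /jmul iter_leib01 -iterSr. Qed.

Lemma jmulS1 T p q : jmul T p q.+1 = jmul (leib1 T) p q.
Proof. by rewrite /jmul iterSr. Qed.

Lemma leib0B T U a b c d : leib0 (fun a b c d => T a b c d - U a b c d) a b c d =
  leib0 T a b c d - leib0 U a b c d.
Proof. by rewrite /leib0; ring. Qed.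

Lemma leib1B T U a b c d : leib1 (fun a b c d => T a b c d - U a b c d) a b c d =
  leib1 T a b c d - leib1 U a b c d.
Proof. by rewrite /leib1; ring. Qed.

Lemma jmulB T U p q : jmul (fun a b c d => T a b c d - U a b c d) p q =
  jmul T p q - jmul U p q.
Proof.
rewrite /jmul.
have -> : iter q leib1 (fun a b c d => T a b c d - U a b c d) =
    (fun a b c d => iter q leib1 T a b c d - iter q leib1 U a b c d).
  elim: q => //= q ->; do 4!apply/funext => ?; exact: leib1B.
move: (iter q leib1 T) (iter q leib1 U) => {}T {}U.
have -> : iter p leib0 (fun a b c d => T a b c d - U a b c d) =
    (fun a b c d => iter p leib0 T a b c d - iter p leib0 U a b c d).
  elim: p => //= p ->; do 4!apply/funext => ?; exact: leib0B.
by [].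
Qed.

Lemma jmulZ (k : K) T p q : jmul (fun a b c d => k * T a b c d) p q = k * jmul T p q.
Proof.
rewrite /jmul.
have -> : iter q leib1 (fun a b c d => k * T a b c d) =
    (fun a b c d => k * iter q leib1 T a b c d).
  by elim: q => //= q ->; do 4!apply/funext => ?; rewrite /leib1 mulrDr.
move: (iter q leib1 T) => {}T.
have -> : iter p leib0 (fun a b c d => k * T a b c d) =
    (fun a b c d => k * iter p leib0 T a b c d).
  by elim: p => //= p ->; do 4!apply/funext => ?; rewrite /leib0 mulrDr.
by [].
Qed.

Definition mul12 (T : W6) : W4 := fun p q e f =>
  jmul (fun a b c d => T a b c d e f) p q.
Definition mul23 (T : W6) : W4 := fun a b p q => jmul (T a b) p q.

(** A bracket is a derivation: applied to a product of the first two factors, it acts on each of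
    them in turn. Together with the mirror image [poisson_mul23], this is the heart of
    associativity. *)
Lemma poisson_mul12 T : poisson4 (mul12 T) = mul12 (fun a b c d e f =>
  pi13 T a b c d e f + pi23 T a b c d e f).
Proof.
do 4!apply/funext => ?; rewrite /poisson4 /mul12 jmulS0 jmulS1 -jmulB.
congr (jmul _ _ _); do 4!apply/funext => ?.
by rewrite /leib0 /leib1 /pi13 /pi23; ring.
Qed.

Lemma poisson_mul23 T : poisson4 (mul23 T) = mul23 (fun a b c d e f =>
  pi12 T a b c d e f + pi13 T a b c d e f).
Proof.
do 4!apply/funext => ?; rewrite /poisson4 /mul23 jmulS0 jmulS1 -jmulB.
congr (jmul _ _ _); do 4!apply/funext => ?.
by rewrite /leib0 /leib1 /pi12 /pi13; ring.
Qed.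

Definition ev0 (T : W6) : K :=
  (T : nat -> nat -> nat -> nat -> nat -> nat -> K) 0%N 0%N 0%N 0%N 0%N 0%N.

Definition tens3 (A B D : W2) : W6 := fun a b c d e f => A a b * B c d * D e f.

(** Up to the scalar [kap k], [mjet] is the jet and [mval] the value of the [k]-th term of the
    product of two functions with jets [A] and [B]. The jet is needed wherever the result is
    multiplied once more. *)
Definition mjet k (A B : W2) : W2 := jmul (iter k poisson4 (tens2 A B)).
Definition mval k (A B : W2) : K := iter k poisson4 (tens2 A B) 0%N 0%N 0%N 0%N.

Lemma mval_mul12 k l (A B D : W2) : mval l (mjet k A B) D =
  ev0 (iter l (fun T => pi13 T + pi23 T) (iter k pi12 (tens3 A B D))).
Proof.
rewrite /mval.
have -> : tens2 (mjet k A B) D = mul12 (iter k pi12 (tens3 A B D)).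
  do 4!apply/funext => ?; rewrite /tens2 /mjet /mul12 mulrC -jmulZ.
  congr (jmul _ _ _); elim: k => [|k IH] /=.
    by do 4!apply/funext => ?; rewrite /tens2 /tens3 mulrC.
  do 4!apply/funext => ?.
  have E a b c d := congr1 (fun T => T a b c d) IH.
  by rewrite /poisson4 /pi12 mulrBr !E.
move: (iter k _ _) => T.
have -> : iter l poisson4 (mul12 T) = mul12 (iter l (fun T => pi13 T + pi23 T) T).
  by elim: l => //= l ->; rewrite poisson_mul12.
by [].
Qed.

Lemma mval_mul23 k l (A B D : W2) : mval l A (mjet k B D) =
  ev0 (iter l (fun T => pi12 T + pi13 T) (iter k pi23 (tens3 A B D))).
Proof.
rewrite /mval.
have -> : tens2 A (mjet k B D) = mul23 (iter k pi23 (tens3 A B D)).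
  apply/funext => a; apply/funext => b; do 2!apply/funext => ?.
  rewrite /tens2 /mjet /mul23 -jmulZ.
  congr (jmul _ _ _); elim: k => [|k IH] /=.
    by do 4!apply/funext => ?; rewrite /tens2 /tens3 mulrA.
  do 4!apply/funext => ?.
  have E c d e f := congr1 (fun T => T c d e f) IH.
  by rewrite /poisson4 /pi23 mulrBr !E.
move: (iter k _ _) => T.
have -> : iter l poisson4 (mul23 T) = mul23 (iter l (fun T => pi12 T + pi13 T) T).
  by elim: l => //= l ->; rewrite poisson_mul23.
by [].
Qed.

(* Both sides are the m-th power of pi12 + pi13 + pi23. *)
Lemma mval_assoc m (A B D : W2) :
  \sum_(k < m.+1) mval (m - k) (mjet k A B) D *+ 'C(m, k) =
  \sum_(k < m.+1) mval (m - k) A (mjet k B D) *+ 'C(m, k).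
Proof.
pose T := tens3 A B D.
have h := iter_trinomial m T pi12D pi13D pi23D pi1213 pi1223 pi1323.
have ev (n : nat) (F : 'I_n -> W6) :
    ev0 (\sum_(k < n) F k) = \sum_(k < n) ev0 (F k).
  by apply: (big_morph ev0).
have evn (x : W6) n : ev0 (x *+ n) = ev0 x *+ n.
  elim: n => [|n IH]; first by rewrite !mulr0n.
  by rewrite !mulrSr -IH.
have := congr1 ev0 h; rewrite !ev => h'.
under eq_bigr do rewrite mval_mul12 -evn.
under [RHS]eq_bigr do rewrite mval_mul23 -evn.
exact: h'.
Qed.

End Arrays.

(** * Powers of the Moyal operator as lists of derivative words *)

Section MoyalWords.
Context {R : realType}.
Local Notation C := (cplx R).
Local Notation V := 'rV[C]_2.
Local Notation om0 := (omega0 R).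
Implicit Types (f g h : V -> C) (O : set V) (u w : seq 'I_2).

Definition holo_on O f := forall q, O q -> differentiable f q.

Lemma sum_I2 (F : 'I_2 -> C) : \sum_i F i = F 0 + F 1.
Proof.
by rewrite !big_ord_recl big_ord0 addr0; congr (_ + F _); exact/val_inj.
Qed.

Lemma omega0E (a b : 'I_2) :
  om0 a b = (a == 1)%:R * (b == 0)%:R - (a == 0)%:R * (b == 1)%:R.
Proof. by rewrite /omega0 /wedge !mxE !big_ord1 !mxE !eqxx !andTb. Qed.

Lemma omega0_tr : om0^T = - om0.
Proof.
move: om0 omega0E => B entry; apply/matrixP => a b; rewrite !mxE !entry; ring.
Qed.

Lemma omega0_sqr : om0 *m om0 = - 1%:M.
Proof.
move: om0 omega0E => B entry.
apply/matrixP => a b; rewrite !mxE sum_I2 !entry.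
by case: (ord2P a) => ->; case: (ord2P b) => -> /=; ring.
Qed.

(** The matrix is antisymmetric with square -1, so its transpose has the matrix itself as inverse.
    In this convention [{z_2, z_1} = 1]. *)
Lemma bracket_omega0 (p q : V) :
  bracket_form om0 p q = p 0 1 * q 0 0 - p 0 0 * q 0 1.
Proof.
move: om0 omega0E omega0_tr omega0_sqr => B entry oT oo.
have inv : invmx B^T = B.
  have h : B^T *m B = 1%:M by rewrite oT mulNmx oo opprK.
  have := mulmx1_unit h => -[u1 _].
  by rewrite -[RHS](mulKmx u1) h mulmx1.
have e : p *m B *m B = - p by rewrite -mulmxA oo mulmxN mulmx1.
rewrite /bracket_form /tau inv e trmx_mul oT mulNmx mulNmx mulmxN opprK.
rewrite !mxE sum_I2 !mxE !sum_I2 !mxE !entry /=; ring.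
Qed.

Lemma bracket_omega0_sum (d : 'I_2 -> 'I_2 -> C) :
  \sum_a \sum_b bracket_form om0 'e_a 'e_b * d a b = d 1 0 - d 0 1.
Proof. by rewrite !sum_I2 !bracket_omega0 !mxE /=; ring. Qed.

Lemma moyalD2 (F : V * V -> C) p : moyalD om0 F p =
  'D_(('e_1 : V), (0 : V)) ('D_((0 : V), ('e_0 : V)) F) p
  - 'D_(('e_0 : V), (0 : V)) ('D_((0 : V), ('e_1 : V)) F) p.
Proof.
exact: (bracket_omega0_sum (fun a b =>
  'D_(('e_a : V), (0 : V)) ('D_((0 : V), ('e_b : V)) F) p)).
Qed.

(** A coefficient with one derivative word for each tensor factor. A power of the operator becomes
    the finite list [mlist k], to which inductions and counting arguments apply. *)
Definition mterm : Type := (C * seq 'I_2 * seq 'I_2)%type.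
Implicit Types s : seq mterm.

Definition tens s f g (p : V * V) : C :=
  \sum_(t <- s) (t.1.1 * dword t.1.2 f p.1) * dword t.2 g p.2.

Definition mstep s : seq mterm :=
  [seq (t.1.1, 1 :: t.1.2, 0 :: t.2) | t <- s] ++
  [seq (- t.1.1, 0 :: t.1.2, 1 :: t.2) | t <- s].

Definition mlist k : seq mterm := iter k mstep [:: (1, [::], [::])].

Lemma diffMC (W : normedModType C) (f g : W -> C) x : differentiable f x ->
  differentiable g x -> differentiable (fun y => f y * g y) x.
Proof. by move=> df dg; exact: (differentiableM df dg). Qed.

Lemma diffDC (W : normedModType C) (f g : W -> C) x : differentiable f x ->
  differentiable g x -> differentiable (fun y => f y + g y) x.
Proof. by move=> df dg; exact: (differentiableD df dg). Qed.

Lemma diffZC (W : normedModType C) (c : C) (f : W -> C) x : differentiable f x ->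
  differentiable (fun y => c * f y) x.
Proof. by move=> df; apply: (diffMC (differentiable_cst c x) df). Qed.

Lemma derive_DC (W : normedModType C) (f g : W -> C) x v : differentiable f x ->
  differentiable g x -> 'D_v (fun y => f y + g y) x = 'D_v f x + 'D_v g x.
Proof.
move=> df dg; rewrite (deriveE v (diffDC df dg)) (deriveE v df) (deriveE v dg).
exact (congr1 (fun F : W -> C => F v) (diffD df dg)).
Qed.

Lemma derive_MC (W : normedModType C) (f g : W -> C) x v : differentiable f x ->
  differentiable g x ->
  'D_v (fun y => f y * g y) x = 'D_v f x * g x + f x * 'D_v g x.
Proof.
move=> df dg; rewrite (deriveE v (diffMC df dg)) (deriveE v df) (deriveE v dg).
rewrite addrC [_ * g x]mulrC.
exact (congr1 (fun F : W -> C => F v) (diffM df dg)).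
Qed.

Lemma derive_cst0 (W : normedModType C) (c : C) (x v : W) :
  'D_v (fun=> c) x = 0.
Proof.
have dc := differentiable_cst c x.
rewrite (deriveE v dc).
exact (congr1 (fun F : W -> C => F v) (diff_cst c x)).
Qed.

Lemma derive_ZC (W : normedModType C) (c : C) (f : W -> C) x v :
  differentiable f x -> 'D_v (fun y => c * f y) x = c * 'D_v f x.
Proof.
move=> df; rewrite (derive_MC v (differentiable_cst c x) df).
by rewrite derive_cst0 mul0r add0r.
Qed.

Lemma tensor_diff f g x y : differentiable f x -> differentiable g y ->
  differentiable (fun p : V * V => f p.1 * g p.2) (x, y).
Proof.
move=> df dg.
have d1 : differentiable (fun p : V * V => p.1) (x, y).
  by apply: (@linear_differentiable _ _ _ fst) => z; exact: cvg_fst.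
have d2 : differentiable (fun p : V * V => p.2) (x, y).
  by apply: (@linear_differentiable _ _ _ snd) => z; exact: cvg_snd.
have e1 := @differentiable_comp _ _ _ _ (fun p : V * V => p.1) f (x, y) d1 df.
have e2 := @differentiable_comp _ _ _ _ (fun p : V * V => p.2) g (x, y) d2 dg.
exact: (diffMC e1 e2).
Qed.

Lemma tens_cons t s f g : tens (t :: s) f g =
  (fun p => (t.1.1 * dword t.1.2 f p.1) * dword t.2 g p.2 + tens s f g p).
Proof. by apply/funext => p; rewrite /tens big_cons. Qed.

Lemma tens_nil f g : tens [::] f g = (fun=> 0).
Proof. by apply/funext => p; rewrite /tens big_nil. Qed.

Lemma tens_cat s s' f g p : tens (s ++ s') f g p = tens s f g p + tens s' f g p.
Proof. by rewrite /tens big_cat. Qed.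

Lemma tens_holo s f g O x y : open O -> holo_on O f -> holo_on O g ->
  O x -> O y -> differentiable (tens s f g) (x, y).
Proof.
move=> oO hf hg Ox Oy; elim: s => [|t s IH].
  by rewrite tens_nil; exact: differentiable_cst.
rewrite tens_cons; apply: (diffDC _ IH).
apply: (@tensor_diff (fun x => t.1.1 * dword t.1.2 f x) (dword t.2 g)).
  exact: diffZC (dword_holo _ oO hf Ox).
exact: (dword_holo _ oO hg Oy).
Qed.

Lemma tens_snd s f g O x y (b : 'I_2) : open O -> holo_on O f -> holo_on O g ->
  O x -> O y -> 'D_((0 : V), ('e_b : V)) (tens s f g) (x, y) =
    tens [seq (t.1.1, t.1.2, b :: t.2) | t <- s] f g (x, y).
Proof.
move=> oO hf hg Ox Oy; elim: s => [|t s IH].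
  by rewrite /= !tens_nil derive_cst0.
rewrite /= !tens_cons.
have dh := tens_holo s oO hf hg Ox Oy.
have du := dword_holo t.1.2 oO hf Ox.
have dw := dword_holo t.2 oO hg Oy.
rewrite (derive_DC (f := fun p : V * V =>
  (t.1.1 * dword t.1.2 f p.1) * dword t.2 g p.2) _ _ dh).
  rewrite IH; congr (_ + _).
  exact: (derive_snd (fun x => t.1.1 * dword t.1.2 f x) x 'e_b dw).
exact: (tensor_diff (diffZC t.1.1 du) dw).
Qed.

Lemma tens_fst s f g O x y (a : 'I_2) : open O -> holo_on O f -> holo_on O g ->
  O x -> O y -> 'D_(('e_a : V), (0 : V)) (tens s f g) (x, y) =
    tens [seq (t.1.1, a :: t.1.2, t.2) | t <- s] f g (x, y).
Proof.
move=> oO hf hg Ox Oy; elim: s => [|t s IH].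
  by rewrite /= !tens_nil derive_cst0.
rewrite /= !tens_cons.
have dh := tens_holo s oO hf hg Ox Oy.
have du := dword_holo t.1.2 oO hf Ox.
have dw := dword_holo t.2 oO hg Oy.
rewrite (derive_DC (f := fun p : V * V =>
  (t.1.1 * dword t.1.2 f p.1) * dword t.2 g p.2) _ _ dh).
  rewrite IH; congr (_ + _).
  etransitivity.
    exact: (derive_fst (dword t.2 g) y 'e_a (diffZC t.1.1 du)).
  exact: (congr1 (fun c => c * dword t.2 g y) (derive_ZC t.1.1 'e_a du)).
exact: (tensor_diff (diffZC t.1.1 du) dw).
Qed.

Lemma near_prod O x y : open O -> O x -> O y ->
  \forall p \near (x, y), O p.1 /\ O p.2.
Proof.
move=> oO Ox Oy; exists (O, O); first by split; exact: open_nbhs_nbhs.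
by move=> [a b] [].
Qed.

(** [F] is compared with the tensor only over [O] in both arguments: transported functions are
    controlled there and arbitrary elsewhere. This suffices, as derivatives depend on germs. *)
Lemma moyalD_tens s f g O (F : V * V -> C) x y : open O -> holo_on O f ->
  holo_on O g -> (forall p, O p.1 -> O p.2 -> F p = tens s f g p) ->
  O x -> O y -> moyalD om0 F (x, y) = tens (mstep s) f g (x, y).
Proof.
move=> oO hf hg FE Ox Oy.
have D2 b p : O p.1 -> O p.2 -> 'D_((0 : V), ('e_b : V)) F p =
    tens [seq (t.1.1, t.1.2, b :: t.2) | t <- s] f g p.
  case: p => p1 p2 /= O1 O2; rewrite -(tens_snd s b oO hf hg O1 O2).
  have E : \forall q \near (p1, p2), tens s f g q = F q.
    by apply: filterS (near_prod oO O1 O2) => q [q1 q2]; rewrite FE.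
  exact: near_derive _ E (tens_holo s oO hf hg O1 O2).
have D1 a b : 'D_(('e_a : V), (0 : V)) ('D_((0 : V), ('e_b : V)) F) (x, y) =
    tens [seq (t.1.1, a :: t.1.2, b :: t.2) | t <- s] f g (x, y).
  have -> : [seq (t.1.1, a :: t.1.2, b :: t.2) | t <- s] =
    [seq (t.1.1, a :: t.1.2, t.2) | t <- [seq (t.1.1, t.1.2, b :: t.2) | t <- s]].
    by rewrite -map_comp.
  rewrite -(tens_fst _ a oO hf hg Ox Oy).
  have E : \forall q \near (x, y),
      tens [seq (t.1.1, t.1.2, b :: t.2) | t <- s] f g q =
      'D_((0 : V), ('e_b : V)) F q.
    by apply: filterS (near_prod oO Ox Oy) => q [q1 q2]; rewrite D2.
  exact: near_derive _ E (tens_holo _ oO hf hg Ox Oy).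
apply: (etrans (moyalD2 F (x, y))).
apply: (etrans (congr2 (fun a b => a - b) (D1 1 0) (D1 0 1))).
rewrite /mstep tens_cat; congr (_ + _).
by rewrite /tens !big_map -sumrN; apply: eq_bigr => t _ /=; rewrite !mulNr.
Qed.

Lemma iter_moyalD k f g O x y : open O -> holo_on O f -> holo_on O g ->
  O x -> O y -> iter k (moyalD om0) (tensor f g) (x, y) = tens (mlist k) f g (x, y).
Proof.
move=> oO hf hg; elim: k x y => [|k IH] x y Ox Oy.
  by rewrite /= /tens /mlist /= big_seq1 /= mul1r.
rewrite iterS /mlist iterS -/(mlist k); apply: moyalD_tens oO hf hg _ Ox Oy.
by move=> [p1 p2] /= O1 O2; exact: IH.
Qed.

Definition kap k : C := ('i / 2%:R) ^+ k / k`!%:R.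

Lemma moyal_coefE k f g O v : open O -> holo_on O f -> holo_on O g -> O v ->
  moyal_coef om0 k f g v = kap k * tens (mlist k) f g (v, v).
Proof. by move=> oO hf hg Ov; rewrite /moyal_coef (iter_moyalD k oO hf hg). Qed.

Lemma diag_holo s f g O v : open O -> holo_on O f -> holo_on O g -> O v ->
  differentiable (fun v => tens s f g (v, v)) v.
Proof.
move=> oO hf hg Ov; elim: s => [|t s IH].
  by rewrite tens_nil; exact: differentiable_cst.
rewrite tens_cons; apply: (diffDC _ IH).
apply: diffMC; first exact: diffZC (dword_holo _ oO hf Ov).
exact: (dword_holo _ oO hg Ov).
Qed.

Definition lstep (a : 'I_2) s : seq mterm :=
  [seq (t.1.1, a :: t.1.2, t.2) | t <- s] ++
  [seq (t.1.1, t.1.2, a :: t.2) | t <- s].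

Lemma diag_derive s f g O v (a : 'I_2) : open O -> holo_on O f ->
  holo_on O g -> O v ->
  'D_('e_a) (fun v => tens s f g (v, v)) v = tens (lstep a s) f g (v, v).
Proof.
move=> oO hf hg Ov; rewrite tens_cat; elim: s => [|t s IH].
  by rewrite /= !tens_nil derive_cst0 addr0.
rewrite /= !tens_cons /=.
have dh := diag_holo s oO hf hg Ov.
have du := dword_holo t.1.2 oO hf Ov.
have dw := dword_holo t.2 oO hg Ov.
have dcu := diffZC t.1.1 du.
rewrite (derive_DC 'e_a (diffMC dcu dw) dh) (derive_MC 'e_a dcu dw).
rewrite (derive_ZC t.1.1 'e_a du) IH addrACA; reflexivity.
Qed.

Lemma near_derive_on O (F G : V -> C) (a : 'I_2) v : open O -> holo_on O F ->
  (forall q, O q -> F q = G q) -> O v -> 'D_('e_a) G v = 'D_('e_a) F v.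
Proof.
move=> oO hF FG Ov; have E : \forall q \near v, F q = G q.
  by apply: filterS (open_nbhs_nbhs (conj oO Ov)) => q; exact: FG.
exact: near_derive _ E (hF _ Ov).
Qed.

Lemma dword_diag s f g O v u : open O -> holo_on O f -> holo_on O g -> O v ->
  dword u (fun v => tens s f g (v, v)) v = tens (foldr lstep s u) f g (v, v).
Proof.
move=> oO hf hg; elim: u v => [//|a u IH] v Ov /=.
rewrite -(diag_derive _ a oO hf hg Ov).
apply: (near_derive_on a oO _ _ Ov) => q Oq; first exact: (diag_holo _ oO hf hg Oq).
by rewrite IH.
Qed.

Lemma dwordZ (c : C) f O v u : open O -> holo_on O f -> O v ->
  dword u (fun v => c * f v) v = c * dword u f v.
Proof.
move=> oO hf; elim: u v => [//|a u IH] v Ov /=.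
rewrite -(derive_ZC c 'e_a (dword_holo u oO hf Ov)).
apply: (near_derive_on a oO _ _ Ov) => q Oq.
  exact: diffZC (dword_holo u oO hf Oq).
by rewrite IH.
Qed.

Lemma dwordD f g O v u : open O -> holo_on O f -> holo_on O g -> O v ->
  dword u (fun v => f v + g v) v = dword u f v + dword u g v.
Proof.
move=> oO hf hg; elim: u v => [//|a u IH] v Ov /=.
rewrite -(derive_DC 'e_a (dword_holo u oO hf Ov) (dword_holo u oO hg Ov)).
apply: (near_derive_on a oO _ _ Ov) => q Oq.
  exact: diffDC (dword_holo u oO hf Oq) (dword_holo u oO hg Oq).
by rewrite IH.
Qed.

Definition jet f v : nat -> nat -> C := fun a b => dword (nseq a 0 ++ nseq b 1) f v.

Lemma jet1 f O v a b : open O -> holo_on O f -> O v ->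
  'D_('e_1) (dword (nseq a 0 ++ nseq b 1) f) v = jet f v a b.+1.
Proof.
move=> oO hf; elim: a v => [//|a IH] v Ov; rewrite /jet /=.
have hw := dword_holo (nseq a 0 ++ nseq b 1) oO hf.
have [_ _ <-] := partial_holo oO Ov hw.
apply: (near_derive_on 0 oO _ _ Ov) => q Oq; last exact: esym (IH _ Oq).
exact: (dword_holo (nseq a 0 ++ nseq b.+1 1) oO hf).
Qed.

(** Mixed partial derivatives commute, so every word can be sorted and only the number of its
    letters matters. This is the passage from words to arrays. *)
Lemma dword_jet f O v u : open O -> holo_on O f -> O v ->
  dword u f v = jet f v (count_mem 0 u) (count_mem 1 u).
Proof.
move=> oO hf; elim: u v => [//|a u IH] v Ov /=.
have -> : 'D_('e_a) (dword u f) v =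
    'D_('e_a) (dword (nseq (count_mem 0 u) 0 ++ nseq (count_mem 1 u) 1) f) v.
  apply: (near_derive_on a oO _ _ Ov) => q Oq; last by rewrite IH.
  exact: (dword_holo _ oO hf).
by case: (ord2P a) => ->; [reflexivity|exact: (jet1 _ _ oO hf Ov)].
Qed.

(** Pairing of a list of words with an array. Prepending letters to the words is dual to shifting
    the array, which translates [mstep] and [lstep] into [poisson4], [leib0] and [leib1]. *)
Definition ev s (T : nat -> nat -> nat -> nat -> C) : C :=
  \sum_(t <- s) t.1.1 * T (count_mem 0 t.1.2) (count_mem 1 t.1.2)
                          (count_mem 0 t.2) (count_mem 1 t.2).

Lemma tens_ev s f g O x y : open O -> holo_on O f -> holo_on O g -> O x -> O y ->
  tens s f g (x, y) = ev s (tens2 (jet f x) (jet g y)).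
Proof.
move=> oO hf hg Ox Oy; rewrite /tens /ev; apply: eq_bigr => t _.
by rewrite /= (dword_jet _ oO hf Ox) (dword_jet _ oO hg Oy) mulrA.
Qed.

Lemma ev_mstep s T : ev (mstep s) T = ev s (poisson4 T).
Proof.
rewrite /ev /mstep big_cat /= !big_map -big_split; apply: eq_bigr => t _ /=.
by rewrite /poisson4 mulrBr mulNr.
Qed.

Lemma ev_lstep0 s T : ev (lstep 0 s) T = ev s (leib0 T).
Proof.
rewrite /ev /lstep big_cat /= !big_map -big_split; apply: eq_bigr => t _ /=.
by rewrite /leib0 mulrDr.
Qed.

Lemma ev_lstep1 s T : ev (lstep 1 s) T = ev s (leib1 T).
Proof.
rewrite /ev /lstep big_cat /= !big_map -big_split; apply: eq_bigr => t _ /=.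
by rewrite /leib1 mulrDr.
Qed.

Lemma ev_mlist k T : ev (mlist k) T = iter k poisson4 T 0%N 0%N 0%N 0%N.
Proof.
elim: k T => [|k IH] T; first by rewrite /ev /mlist big_seq1 mul1r.
by rewrite /mlist iterS ev_mstep -/(mlist k) IH iterSr.
Qed.

Lemma moyal_coef_mval k f g O v : open O -> holo_on O f -> holo_on O g -> O v ->
  moyal_coef om0 k f g v = kap k * mval k (jet f v) (jet g v).
Proof.
move=> oO hf hg Ov.
by rewrite (moyal_coefE k oO hf hg Ov) (tens_ev _ oO hf hg Ov Ov) ev_mlist.
Qed.

Lemma moyal_coef_holo k f g O : open O -> holo_on O f -> holo_on O g ->
  holo_on O (moyal_coef om0 k f g).
Proof.
move=> oO hf hg v Ov.
apply: (@near_differentiable _ _ _ (fun v => kap k * tens (mlist k) f g (v, v))).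
  by apply: filterS (open_nbhs_nbhs (conj oO Ov)) => q Oq; rewrite (moyal_coefE k oO hf hg Oq).
exact: diffZC (diag_holo _ oO hf hg Ov).
Qed.

(** An outer product differentiates the inner one, so the whole jet of the inner one is needed. Its
    derivatives are Leibniz steps, which commute with [poisson4] because the operator has constant
    coefficients. *)
Lemma jet_moyal_coef k f g O v : open O -> holo_on O f -> holo_on O g -> O v ->
  jet (moyal_coef om0 k f g) v =
    (fun p q => kap k * mjet k (jet f v) (jet g v) p q).
Proof.
move=> oO hf hg Ov; apply/funext => p; apply/funext => q.
pose G (v : V) := tens (mlist k) f g (v, v).
have hG : holo_on O G by move=> x Ox; exact: (diag_holo _ oO hf hg Ox).
have hkG : holo_on O (fun v => kap k * G v).
  by move=> x Ox; exact: diffZC (hG _ Ox).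
have GE x : O x -> kap k * G x = moyal_coef om0 k f g x.
  by move=> Ox; rewrite (moyal_coefE k oO hf hg Ox).
have -> : jet (moyal_coef om0 k f g) v p q =
  dword (nseq p 0 ++ nseq q 1) (moyal_coef om0 k f g) v by [].
rewrite -(near_dword (nseq p 0 ++ nseq q 1) oO Ov hkG GE).
rewrite (dwordZ (kap k) _ oO hG Ov) (dword_diag _ _ oO hf hg Ov).
congr (_ * _); rewrite (tens_ev _ oO hf hg Ov Ov) foldr_cat.
have e1 (a : 'I_2) n s : foldr lstep s (nseq n a) = iter n (lstep a) s.
  by elim: n => //= n ->.
rewrite !e1; set T := tens2 (jet f v) (jet g v).
have c0 U : poisson4 (leib0 U) = leib0 (poisson4 U) :> (nat -> nat -> nat -> nat -> C).
  by do 4!apply/funext => ?; rewrite /poisson4 /leib0; ring.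
have c1 U : poisson4 (leib1 U) = leib1 (poisson4 U) :> (nat -> nat -> nat -> nat -> C).
  by do 4!apply/funext => ?; rewrite /poisson4 /leib1; ring.
have ci0 U : iter k poisson4 (leib0 U) = leib0 (iter k poisson4 U)
    :> (nat -> nat -> nat -> nat -> C).
  by elim: (k) => [//|n IH]; rewrite !iterS IH c0.
have ci1 U : iter k poisson4 (leib1 U) = leib1 (iter k poisson4 U)
    :> (nat -> nat -> nat -> nat -> C).
  by elim: (k) => [//|n IH]; rewrite !iterS IH c1.
have evi0 n s U : ev (iter n (lstep 0) s) U = ev s (iter n leib0 U).
  by elim: n U => // n IH U; rewrite iterS ev_lstep0 IH -iterSr.
have evi1 n s U : ev (iter n (lstep 1) s) U = ev s (iter n leib1 U).
  by elim: n U => // n IH U; rewrite iterS ev_lstep1 IH -iterSr.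
rewrite evi0 evi1 ev_mlist /mjet /jmul -/T.
have -> : iter k poisson4 (iter q leib1 (iter p leib0 T)) =
    iter q leib1 (iter k poisson4 (iter p leib0 T)).
  by elim: q => //= n <-; rewrite ci1.
have -> : iter k poisson4 (iter p leib0 T) = iter p leib0 (iter k poisson4 T).
  by elim: p => //= n <-; rewrite ci0.
move: (iter k poisson4 T) => U.
have -> : iter q leib1 (iter p leib0 U) = iter p leib0 (iter q leib1 U).
  by elim: p => //= n <-; rewrite iter_leib01.
by [].
Qed.

Lemma mvalZl (c : C) l A B : mval l (fun p q => c * A p q) B = c * mval l A B.
Proof.
rewrite /mval; have -> : iter l poisson4 (tens2 (fun p q => c * A p q) B) =
    (fun a b d e => c * iter l poisson4 (tens2 A B) a b d e).
  elim: l => [|l IH] /=; do 4!apply/funext => ?; first by rewrite /tens2 mulrA.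
  by rewrite IH /poisson4 mulrBr.
by [].
Qed.

Lemma mvalZr (c : C) l A B : mval l A (fun p q => c * B p q) = c * mval l A B.
Proof.
rewrite /mval; have -> : iter l poisson4 (tens2 A (fun p q => c * B p q)) =
    (fun a b d e => c * iter l poisson4 (tens2 A B) a b d e).
  elim: l => [|l IH] /=; do 4!apply/funext => ?; first by rewrite /tens2 mulrCA.
  by rewrite IH /poisson4 mulrBr.
by [].
Qed.

(** The coefficients are those of an exponential series, so a product of two of them carries the
    binomial weight that occurs in [mval_assoc]. *)
Lemma kap_mul m k : (k <= m)%N ->
  kap (m - k) * kap k = ('i / 2%:R) ^+ m / m`!%:R * 'C(m, k)%:R.
Proof.
move=> km; rewrite /kap -(bin_fact km) !natrM.
have f0 n : (n`!%:R : C) != 0 by rewrite pnatr_eq0 -lt0n fact_gt0.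
have c0 : ('C(m, k)%:R : C) != 0 by rewrite pnatr_eq0 -lt0n bin_gt0.
rewrite -{3}(subnK km) exprD; field.
by rewrite !f0 c0.
Qed.

(** Associativity in total order [m] for three functions, before formal series enter: [kap_mul]
    brings both sides to the form of [mval_assoc]. *)
Theorem moyal_coef_assoc m f g h O v : open O -> holo_on O f -> holo_on O g ->
  holo_on O h -> O v ->
  \sum_(k < m.+1) moyal_coef om0 (m - k) (moyal_coef om0 k f g) h v =
  \sum_(k < m.+1) moyal_coef om0 (m - k) f (moyal_coef om0 k g h) v.
Proof.
move=> oO hf hg hh Ov.
pose c := ('i / 2%:R : C) ^+ m / m`!%:R.
transitivity (c * \sum_(k < m.+1)
    mval (m - k) (mjet k (jet f v) (jet g v)) (jet h v) *+ 'C(m, k)).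
  rewrite mulr_sumr; apply: eq_bigr => k _.
  have hc := moyal_coef_holo k oO hf hg.
  rewrite (moyal_coef_mval _ oO hc hh Ov) (jet_moyal_coef k oO hf hg Ov).
  rewrite mvalZl mulrA (kap_mul (ltnSE (ltn_ord k))) -/c.
  by rewrite -mulrA mulr_natl.
rewrite mval_assoc mulr_sumr; apply: eq_bigr => k _.
have hc := moyal_coef_holo k oO hg hh.
rewrite (moyal_coef_mval _ oO hf hc Ov) (jet_moyal_coef k oO hg hh Ov).
rewrite mvalZr mulrA (kap_mul (ltnSE (ltn_ord k))) -/c.
by rewrite -mulrA mulr_natl.
Qed.

End MoyalWords.

(** * Rearrangement of finite convolution sums *)

Section ConvolutionSums.
Context {K : nzRingType}.

Lemma sum_widen (F : nat -> K) m N : (m <= N)%N ->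
  (forall k, (m <= k)%N -> F k = 0) -> \sum_(k < N) F k = \sum_(k < m) F k.
Proof.
move=> mN F0; rewrite -!(big_mkord xpredT) (@big_cat_nat _ _ _ m)//=.
rewrite [X in _ + X]big_nat_cond [X in _ + X]big1 ?addr0// => k.
by rewrite andbT => /andP[mk _]; exact: F0.
Qed.

Lemma sum_delta (F : nat -> K) p N : (p < N)%N ->
  \sum_(n < N) (p == n)%:R * F n = F p.
Proof.
move=> pN; rewrite (bigD1 (Ordinal pN))//= eqxx mul1r big1 ?addr0// => i ip.
rewrite (_ : (p == i) = false) ?mul0r//; apply/negbTE; move: ip.
by apply: contra => /eqP pi; apply/eqP/val_inj.
Qed.

(** The constraint becomes an indicator factor and all ranges become a common [N], so that sums can
    be exchanged freely; the added terms carry a false indicator. *)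
Lemma csumE (G : nat -> nat -> nat -> K) m N : (m < N)%N ->
  \sum_(k < m.+1) \sum_(i < m.+1) \sum_(j < m.+1 | (k + i + j == m)%N) G k i j =
  \sum_(k < N) \sum_(i < N) \sum_(j < N) (k + i + j == m)%N%:R * G k i j.
Proof.
move=> mN.
rewrite [RHS](@sum_widen (fun k => \sum_(i < N) \sum_(j < N)
    (k + i + j == m)%N%:R * G k i j) m.+1)//; last first.
  move=> k mk; apply: big1 => i _; apply: big1 => j _.
  by rewrite (_ : (_ == _) = false) ?mul0r//; apply/negbTE; lia.
apply: eq_bigr => k _.
rewrite [RHS](@sum_widen (fun i => \sum_(j < N)
    (k + i + j == m)%N%:R * G k i j) m.+1)//; last first.
  move=> i mi; apply: big1 => j _.
  by rewrite (_ : (_ == _) = false) ?mul0r//; apply/negbTE; lia.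
apply: eq_bigr => i _.
rewrite [RHS](@sum_widen (fun j => (k + i + j == m)%N%:R * G k i j) m.+1)//; last first.
  move=> j mj.
  by rewrite (_ : (_ == _) = false) ?mul0r//; apply/negbTE; lia.
rewrite big_mkcond; apply: eq_bigr => j _; by case: eqP; rewrite ?mul1r ?mul0r.
Qed.

Lemma antidiag (X : nat -> nat -> K) q N : (q < N)%N ->
  \sum_(k < N) \sum_(l < N) (k + l == q)%N%:R * X k l =
  \sum_(l < q.+1) X (q - l)%N l.
Proof.
move=> qN; rewrite exchange_big /=.
rewrite (@sum_widen (fun l => \sum_(k < N) (k + l == q)%N%:R * X k l) q.+1)//; last first.
  move=> l ql; apply: big1 => k _.
  by rewrite (_ : (_ == _) = false) ?mul0r//; apply/negbTE; lia.
apply: eq_bigr => l _; have lq := ltn_ord l.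
rewrite -(@sum_delta (X ^~ l) (q - l)%N N); last lia.
by apply: eq_bigr => k _; congr (_%:R * _); congr nat_of_bool;
  apply/eqP/eqP; lia.
Qed.

(** Removes the intermediate order [n] of an inner product. If [p] is outside the range, no [n]
    matches, and the right-hand indicator is false as well because [m < N]. *)
Lemma collapse (X : K) (c p m N : nat) : (m < N)%N ->
  \sum_(n < N) (c + n == m)%N%:R * ((p == n)%N%:R * X) = (c + p == m)%N%:R * X.
Proof.
move=> mN; have [pN|Np] := ltnP p N.
  rewrite -(@sum_delta (fun n => (c + n == m)%N%:R * X) p N)//.
  by apply: eq_bigr => n _; rewrite mulrA mulrA -natrM mulnC natrM.
rewrite big1 => [|n _].
  by rewrite (_ : (_ == _) = false) ?mul0r//; apply/negbTE; lia.
have nN := ltn_ord n.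
by rewrite [(p == n)](_ : _ = false) ?mul0r ?mulr0//; apply/negbTE; lia.
Qed.

Lemma reorder5 (I : finType) (F : I -> I -> I -> I -> I -> K) :
  \sum_k' \sum_a \sum_b \sum_k \sum_j F k' a b k j =
  \sum_a \sum_b \sum_j \sum_k \sum_k' F k' a b k j.
Proof.
rewrite exchange_big; apply: eq_bigr => a _ /=.
rewrite exchange_big; apply: eq_bigr => b _ /=.
rewrite exchange_big /=.
rewrite (eq_bigr (fun k => \sum_j \sum_k' F k' a b k j)); last first.
  by move=> k _; rewrite exchange_big.
by rewrite exchange_big.
Qed.

End ConvolutionSums.

(** * The Moyal-Weyl product of formal power series *)

Section MoyalSeries.
Context {R : realType}.
Local Notation C := (cplx R).
Local Notation V := 'rV[C]_2.
Local Notation om0 := (omega0 R).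
Local Notation B := (moyal_coef om0).
Implicit Types (O : set V) (f g h : nat -> V -> C).

Definition holo_ser O f := forall k, holo_on O (f k).

Lemma holo_on_sum (I : Type) (r : seq I) (c : I -> C) (F : I -> V -> C) O :
  (forall i, holo_on O (F i)) -> holo_on O (fun v => \sum_(i <- r) c i * F i v).
Proof.
move=> hF v Ov; elim: r => [|i r IH].
  have -> : (fun v => \sum_(i <- [::]) c i * F i v) = cst 0.
    by apply/funext => x; rewrite big_nil.
  exact: differentiable_cst.
have -> : (fun v => \sum_(i <- i :: r) c i * F i v) =
    (fun v => c i * F i v + \sum_(i <- r) c i * F i v).
  by apply/funext => x; rewrite big_cons.
exact: diffDC (diffZC (c i) (hF i v Ov)) IH.
Qed.

Lemma dword_sum (I : Type) (r : seq I) (c : I -> C) (F : I -> V -> C) O u v :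
  open O -> (forall i, holo_on O (F i)) -> O v ->
  dword u (fun v => \sum_(i <- r) c i * F i v) v =
  \sum_(i <- r) c i * dword u (F i) v.
Proof.
move=> oO hF Ov; elim: r => [|i r IH].
  rewrite big_nil.
  have -> : (fun v => \sum_(i <- [::]) c i * F i v) = (fun v => 0 * (0 : C)).
    by apply/funext => x; rewrite big_nil mul0r.
  have h0 : holo_on O (fun=> 0 : C) by move=> x _; exact: differentiable_cst.
  by rewrite (dwordZ 0 u oO h0 Ov) mul0r.
have -> : (fun v => \sum_(i <- i :: r) c i * F i v) =
    (fun v => c i * F i v + \sum_(i <- r) c i * F i v).
  by apply/funext => x; rewrite big_cons.
have h1 : holo_on O (fun v => c i * F i v).
  by move=> x Ox; exact: diffZC (hF i x Ox).
rewrite (dwordD u oO h1 (holo_on_sum r c hF) Ov) (dwordZ (c i) u oO (hF i) Ov).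
by rewrite IH big_cons.
Qed.

Lemma near_moyal_coef k (f f' g g' : V -> C) O v : open O -> O v ->
  holo_on O f -> holo_on O g -> (forall x, O x -> f x = f' x) ->
  (forall x, O x -> g x = g' x) -> B k f g v = B k f' g' v.
Proof.
move=> oO Ov hf hg ff gg.
have near_on (F F' : V -> C) : holo_on O F -> (forall x, O x -> F x = F' x) ->
    holo_on O F'.
  move=> hF FF x Ox; apply: near_differentiable (hF x Ox).
  by apply: filterS (open_nbhs_nbhs (conj oO Ox)) => q; exact: FF.
rewrite (moyal_coefE k oO hf hg Ov).
rewrite (moyal_coefE k oO (near_on _ _ hf ff) (near_on _ _ hg gg) Ov).
congr (_ * _); apply: eq_bigr => t _.
by rewrite (near_dword t.1.2 oO Ov hf ff) (near_dword t.2 oO Ov hg gg).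
Qed.

Lemma moyal_coef_suml k (I : Type) (r : seq I) (c : I -> C) (F : I -> V -> C)
    (g : V -> C) O v :
  open O -> (forall i, holo_on O (F i)) -> holo_on O g -> O v ->
  B k (fun v => \sum_(i <- r) c i * F i v) g v = \sum_(i <- r) c i * B k (F i) g v.
Proof.
move=> oO hF hg Ov; rewrite (moyal_coefE k oO (holo_on_sum r c hF) hg Ov).
rewrite /tens mulr_sumr.
transitivity (\sum_(t <- mlist k) \sum_(i <- r)
  c i * (kap k * (t.1.1 * dword t.1.2 (F i) v * dword t.2 g v))).
  apply: eq_bigr => t _; rewrite (dword_sum _ _ _ oO hF Ov).
  by rewrite mulr_sumr mulr_suml mulr_sumr; apply: eq_bigr => i _ /=; ring.
rewrite exchange_big; apply: eq_bigr => i _ /=.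
by rewrite (moyal_coefE k oO (hF i) hg Ov) /tens !mulr_sumr.
Qed.

Lemma moyal_coef_sumr k (I : Type) (r : seq I) (c : I -> C) (F : I -> V -> C)
    (g : V -> C) O v :
  open O -> (forall i, holo_on O (F i)) -> holo_on O g -> O v ->
  B k g (fun v => \sum_(i <- r) c i * F i v) v = \sum_(i <- r) c i * B k g (F i) v.
Proof.
move=> oO hF hg Ov; rewrite (moyal_coefE k oO hg (holo_on_sum r c hF) Ov).
rewrite /tens mulr_sumr.
transitivity (\sum_(t <- mlist k) \sum_(i <- r)
  c i * (kap k * (t.1.1 * dword t.1.2 g v * dword t.2 (F i) v))).
  apply: eq_bigr => t _; rewrite (dword_sum _ _ _ oO hF Ov).
  by rewrite !mulr_sumr; apply: eq_bigr => i _ /=; ring.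
rewrite exchange_big; apply: eq_bigr => i _ /=.
by rewrite (moyal_coefE k oO hg (hF i) Ov) /tens !mulr_sumr.
Qed.

Definition ix N : finType := ('I_N * 'I_N * 'I_N)%type.

(** [N] is free above [m], so that an inner product of any smaller order can be summed over the same
    index set as the outer one. *)
Lemma moyal_csum f g m N v : (m < N)%N -> moyal om0 f g m v =
  \sum_(t : ix N) (t.1.1 + t.1.2 + t.2 == m)%N%:R * B t.1.1 (f t.1.2) (g t.2) v.
Proof.
move=> mN; rewrite /moyal (@csumE _ (fun k i j => B k (f i) (g j) v) m N mN).
rewrite pair_bigA /= pair_bigA /=.
by apply: eq_bigr => -[[k i] j].
Qed.

Lemma sum_ix N (F : 'I_N -> 'I_N -> 'I_N -> C) :
  \sum_(t : ix N) F t.1.1 t.1.2 t.2 = \sum_a \sum_b \sum_c F a b c.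
Proof. by rewrite pair_bigA pair_bigA; apply: eq_bigr => -[[a b] c]. Qed.

Lemma moyal_holo f g m O : open O -> holo_ser O f -> holo_ser O g ->
  holo_on O (moyal om0 f g m).
Proof.
move=> oO hf hg.
have -> : moyal om0 f g m = (fun v => \sum_(t : ix m.+1)
    (t.1.1 + t.1.2 + t.2 == m)%N%:R * B t.1.1 (f t.1.2) (g t.2) v).
  by apply/funext => v; exact: moyal_csum.
by apply: holo_on_sum => t; exact: moyal_coef_holo.
Qed.

Lemma near_moyal f f' g g' m O v : open O -> O v -> holo_ser O f ->
  holo_ser O g -> (forall k x, O x -> f k x = f' k x) ->
  (forall k x, O x -> g k x = g' k x) ->
  moyal om0 f g m v = moyal om0 f' g' m v.
Proof.
move=> oO Ov hf hg ff gg.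
rewrite !(@moyal_csum _ _ m m.+1)//; apply: eq_bigr => t _; congr (_ * _).
exact: (near_moyal_coef _ oO Ov (hf _) (hg _) (ff _) (gg _)).
Qed.

Lemma moyal_coefDl k (f f' g : V -> C) O v : open O -> O v -> holo_on O f ->
  holo_on O f' -> holo_on O g ->
  B k (fun x => f x + f' x) g v = B k f g v + B k f' g v.
Proof.
move=> oO Ov hf hf' hg.
(* The sum of two functions is treated as a family over the booleans with coefficients 1. *)
have hF (b : bool) : holo_on O (if b then f else f') by case: b.
have := @moyal_coef_suml k _ [:: true; false] (fun=> 1) _ g O v oO hF hg Ov.
rewrite !big_cons big_nil !mul1r addr0 => <-; congr (moyal_coef _ _ _ _ _).
by apply/funext => x; rewrite !big_cons big_nil !mul1r addr0.
Qed.

Lemma moyal_coefDr k (f f' g : V -> C) O v : open O -> O v -> holo_on O f ->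
  holo_on O f' -> holo_on O g ->
  B k g (fun x => f x + f' x) v = B k g f v + B k g f' v.
Proof.
move=> oO Ov hf hf' hg.
have hF (b : bool) : holo_on O (if b then f else f') by case: b.
have := @moyal_coef_sumr k _ [:: true; false] (fun=> 1) _ g O v oO hF hg Ov.
rewrite !big_cons big_nil !mul1r addr0 => <-; congr (moyal_coef _ _ _ _ _).
by apply/funext => x; rewrite !big_cons big_nil !mul1r addr0.
Qed.

Lemma moyal_addl f f' g m O v : open O -> O v -> holo_ser O f ->
  holo_ser O f' -> holo_ser O g ->
  moyal om0 (fun k x => f k x + f' k x) g m v =
  moyal om0 f g m v + moyal om0 f' g m v.
Proof.
move=> oO Ov hf hf' hg; rewrite !(@moyal_csum _ _ m m.+1)// -big_split.
apply: eq_bigr => t _ /=; rewrite -mulrDr; congr (_ * _).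
exact: moyal_coefDl oO Ov (hf _) (hf' _) (hg _).
Qed.

Lemma moyal_addr f f' g m O v : open O -> O v -> holo_ser O f ->
  holo_ser O f' -> holo_ser O g ->
  moyal om0 g (fun k x => f k x + f' k x) m v =
  moyal om0 g f m v + moyal om0 g f' m v.
Proof.
move=> oO Ov hf hf' hg; rewrite !(@moyal_csum _ _ m m.+1)// -big_split.
apply: eq_bigr => t _ /=; rewrite -mulrDr; congr (_ * _).
exact: moyal_coefDr oO Ov (hf _) (hf' _) (hg _).
Qed.

Definition sscaleV (c : nat -> C) f : nat -> V -> C :=
  fun k v => \sum_(j < k.+1) c j * f (k - j)%N v.

Definition ix2 N : finType := ('I_N * 'I_N)%type.

Lemma sscaleE c f n N v : (n < N)%N -> sscaleV c f n v =
  \sum_(s : ix2 N) ((s.1 + s.2 == n)%N%:R * c s.2) * f s.1 v.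
Proof.
move=> nN; rewrite /sscaleV -(@antidiag _ (fun i p => c p * f i v) n N)//.
by rewrite pair_bigA; apply: eq_bigr => -[i p] _ /=; rewrite mulrA.
Qed.

Lemma moyal_scalel c f g m O v : open O -> O v -> holo_ser O f -> holo_ser O g ->
  moyal om0 (sscaleV c f) g m v = sscaleV c (moyal om0 f g) m v.
Proof.
move=> oO Ov hf hg.
have step (k n j : 'I_m.+1) : B k (sscaleV c f n) (g j) v =
    \sum_(s : ix2 m.+1) (s.1 + s.2 == n)%N%:R * (c s.2 * B k (f s.1) (g j) v).
  have -> : sscaleV c f n = (fun v => \sum_(s : ix2 m.+1)
      ((s.1 + s.2 == n)%N%:R * c s.2) * f s.1 v).
    by apply/funext => x; apply: sscaleE.
  rewrite (@moyal_coef_suml k _ _ _ (fun s : ix2 m.+1 => f s.1) _ O)//.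
  by apply: eq_bigr => s _; rewrite mulrA.
rewrite (@moyal_csum _ _ m m.+1)//.
rewrite (@sum_ix m.+1 (fun k n j => (k + n + j == m)%N%:R *
  B k (sscaleV c f n) (g j) v)).
transitivity (\sum_(k < m.+1) \sum_(j < m.+1) \sum_(s : ix2 m.+1)
    (k + j + (s.1 + s.2) == m)%N%:R * (c s.2 * B k (f s.1) (g j) v)).
  apply: eq_bigr => k _; rewrite exchange_big; apply: eq_bigr => j _ /=.
  transitivity (\sum_(s : ix2 m.+1) \sum_(n < m.+1) (k + j + n == m)%N%:R *
    ((s.1 + s.2 == n)%N%:R * (c s.2 * B k (f s.1) (g j) v))).
    rewrite exchange_big; apply: eq_bigr => n _ /=.
    by rewrite step mulr_sumr; apply: eq_bigr => s _; rewrite addnAC.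
  by apply: eq_bigr => s _; exact: collapse.
rewrite /sscaleV.
have -> : \sum_(j < m.+1) c j * moyal om0 f g (m - j)%N v =
    \sum_(p < m.+1) \sum_(k < m.+1) \sum_(i < m.+1) \sum_(j < m.+1)
      (k + i + j + p == m)%N%:R * (c p * B k (f i) (g j) v).
  apply: eq_bigr => p _; have pm : (p <= m)%N := ltn_ord p.
  rewrite (@moyal_csum _ _ (m - p) m.+1); last by lia.
  rewrite (@sum_ix m.+1 (fun k i j => (k + i + j == m - p)%N%:R *
    B k (f i) (g j) v)).
  rewrite mulr_sumr; apply: eq_bigr => k _.
  rewrite mulr_sumr; apply: eq_bigr => i _.
  rewrite mulr_sumr; apply: eq_bigr => j _.
  rewrite mulrCA; congr (_%:R * _); congr nat_of_bool; apply/eqP/eqP; lia.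
rewrite [RHS]exchange_big; apply: eq_bigr => k _ /=.
rewrite (eq_bigr (fun j : 'I_m.+1 => \sum_(i < m.+1) \sum_(p < m.+1)
   (k + i + j + p == m)%N%:R * (c p * B k (f i) (g j) v))); last first.
  move=> j _; rewrite pair_bigA; apply: eq_bigr => -[i p] _ /=.
  by congr (_%:R * _); congr nat_of_bool; apply/eqP/eqP; lia.
rewrite exchange_big [RHS]exchange_big /=; apply: eq_bigr => i _.
by rewrite exchange_big.
Qed.

Lemma moyal_scaler c f g m O v : open O -> O v -> holo_ser O f -> holo_ser O g ->
  moyal om0 f (sscaleV c g) m v = sscaleV c (moyal om0 f g) m v.
Proof.
move=> oO Ov hf hg.
have step (k i n : 'I_m.+1) : B k (f i) (sscaleV c g n) v =
    \sum_(s : ix2 m.+1) (s.1 + s.2 == n)%N%:R * (c s.2 * B k (f i) (g s.1) v).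
  have -> : sscaleV c g n = (fun v => \sum_(s : ix2 m.+1)
      ((s.1 + s.2 == n)%N%:R * c s.2) * g s.1 v).
    by apply/funext => x; apply: sscaleE.
  rewrite (@moyal_coef_sumr k _ _ _ (fun s : ix2 m.+1 => g s.1) _ O)//.
  by apply: eq_bigr => s _; rewrite mulrA.
rewrite (@moyal_csum _ _ m m.+1)//.
rewrite (@sum_ix m.+1 (fun k i n => (k + i + n == m)%N%:R *
  B k (f i) (sscaleV c g n) v)).
transitivity (\sum_(k < m.+1) \sum_(i < m.+1) \sum_(s : ix2 m.+1)
    (k + i + (s.1 + s.2) == m)%N%:R * (c s.2 * B k (f i) (g s.1) v)).
  apply: eq_bigr => k _; apply: eq_bigr => i _ /=.
  transitivity (\sum_(s : ix2 m.+1) \sum_(n < m.+1) (k + i + n == m)%N%:R *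
    ((s.1 + s.2 == n)%N%:R * (c s.2 * B k (f i) (g s.1) v))).
    rewrite exchange_big; apply: eq_bigr => n _ /=.
    by rewrite step mulr_sumr.
  by apply: eq_bigr => s _; exact: collapse.
rewrite /sscaleV.
have -> : \sum_(j < m.+1) c j * moyal om0 f g (m - j)%N v =
    \sum_(p < m.+1) \sum_(k < m.+1) \sum_(i < m.+1) \sum_(j < m.+1)
      (k + i + j + p == m)%N%:R * (c p * B k (f i) (g j) v).
  apply: eq_bigr => p _; have pm : (p <= m)%N := ltn_ord p.
  rewrite (@moyal_csum _ _ (m - p) m.+1); last by lia.
  rewrite (@sum_ix m.+1 (fun k i j => (k + i + j == m - p)%N%:R *
    B k (f i) (g j) v)).
  rewrite mulr_sumr; apply: eq_bigr => k _.
  rewrite mulr_sumr; apply: eq_bigr => i _.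
  rewrite mulr_sumr; apply: eq_bigr => j _.
  rewrite mulrCA; congr (_%:R * _); congr nat_of_bool; apply/eqP/eqP; lia.
rewrite [RHS]exchange_big; apply: eq_bigr => k _ /=.
rewrite [RHS]exchange_big; apply: eq_bigr => i _ /=.
rewrite [RHS]exchange_big pair_bigA; apply: eq_bigr => -[j p] _ /=.
by congr (_%:R * _); congr nat_of_bool; apply/eqP/eqP; lia.
Qed.

(** Once the intermediate orders are removed, both sides are sums over the orders [a], [b], [j]
    taken from the three series and the orders [k], [l] of the two operators. For fixed [a], [b],
    [j] the sum over [k + l = q] is settled by [moyal_coef_assoc]. *)
Theorem moyal_assoc f g h m O v : open O -> O v -> holo_ser O f ->
  holo_ser O g -> holo_ser O h ->
  moyal om0 (moyal om0 f g) h m v = moyal om0 f (moyal om0 g h) m v.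
Proof.
move=> oO Ov hf hg hh.
have hB k a b : holo_on O (B k (f a) (g b)) by exact: moyal_coef_holo.
have hB' k a b : holo_on O (B k (g a) (h b)) by exact: moyal_coef_holo.
have stepl (k n j : 'I_m.+1) : B k (moyal om0 f g n) (h j) v =
    \sum_(s : ix m.+1) (s.1.1 + s.1.2 + s.2 == n)%N%:R *
       B k (B s.1.1 (f s.1.2) (g s.2)) (h j) v.
  have -> : moyal om0 f g n = (fun v => \sum_(s : ix m.+1)
      (s.1.1 + s.1.2 + s.2 == n)%N%:R * B s.1.1 (f s.1.2) (g s.2) v).
    by apply/funext => x; apply: moyal_csum.
  by rewrite (@moyal_coef_suml k _ _ _
    (fun s : ix m.+1 => B s.1.1 (f s.1.2) (g s.2)) _ O).
have stepr (k i n : 'I_m.+1) : B k (f i) (moyal om0 g h n) v =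
    \sum_(s : ix m.+1) (s.1.1 + s.1.2 + s.2 == n)%N%:R *
       B k (f i) (B s.1.1 (g s.1.2) (h s.2)) v.
  have -> : moyal om0 g h n = (fun v => \sum_(s : ix m.+1)
      (s.1.1 + s.1.2 + s.2 == n)%N%:R * B s.1.1 (g s.1.2) (h s.2) v).
    by apply/funext => x; apply: moyal_csum.
  by rewrite (@moyal_coef_sumr k _ _ _
    (fun s : ix m.+1 => B s.1.1 (g s.1.2) (h s.2)) _ O).
have L : moyal om0 (moyal om0 f g) h m v =
    \sum_(l < m.+1) \sum_(a < m.+1) \sum_(b < m.+1) \sum_(k < m.+1) \sum_(j < m.+1)
      (k + j + (l + a + b) == m)%N%:R * B k (B l (f a) (g b)) (h j) v.
  rewrite (@moyal_csum _ _ m m.+1)//.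
  rewrite (@sum_ix m.+1 (fun k n j => (k + n + j == m)%N%:R *
    B k (moyal om0 f g n) (h j) v)).
  rewrite -(@sum_ix m.+1 (fun l a b => \sum_(k < m.+1) \sum_(j < m.+1)
      (k + j + (l + a + b) == m)%N%:R * B k (B l (f a) (g b)) (h j) v)).
  rewrite [RHS]exchange_big; apply: eq_bigr => k _ /=.
  rewrite [RHS]exchange_big [LHS]exchange_big /=; apply: eq_bigr => j _ /=.
  transitivity (\sum_(s : ix m.+1) \sum_(n < m.+1) (k + j + n == m)%N%:R *
    ((s.1.1 + s.1.2 + s.2 == n)%N%:R * B k (B s.1.1 (f s.1.2) (g s.2)) (h j) v)).
    rewrite exchange_big; apply: eq_bigr => n _ /=.
    by rewrite stepl mulr_sumr; apply: eq_bigr => s _; rewrite addnAC.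
  by apply: eq_bigr => s _; exact: collapse.
have Rr : moyal om0 f (moyal om0 g h) m v =
    \sum_(l < m.+1) \sum_(b < m.+1) \sum_(j < m.+1) \sum_(k < m.+1) \sum_(a < m.+1)
      (k + a + (l + b + j) == m)%N%:R * B k (f a) (B l (g b) (h j)) v.
  rewrite (@moyal_csum _ _ m m.+1)//.
  rewrite (@sum_ix m.+1 (fun k a n => (k + a + n == m)%N%:R *
    B k (f a) (moyal om0 g h n) v)).
  rewrite -(@sum_ix m.+1 (fun l b j => \sum_(k < m.+1) \sum_(a < m.+1)
      (k + a + (l + b + j) == m)%N%:R * B k (f a) (B l (g b) (h j)) v)).
  rewrite [RHS]exchange_big; apply: eq_bigr => k _ /=.
  rewrite [RHS]exchange_big; apply: eq_bigr => a _ /=.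
  transitivity (\sum_(s : ix m.+1) \sum_(n < m.+1) (k + a + n == m)%N%:R *
    ((s.1.1 + s.1.2 + s.2 == n)%N%:R * B k (f a) (B s.1.1 (g s.1.2) (h s.2)) v)).
    rewrite exchange_big; apply: eq_bigr => n _ /=.
    by rewrite stepr mulr_sumr.
  by apply: eq_bigr => s _; exact: collapse.
rewrite L Rr.
rewrite (@reorder5 _ 'I_m.+1 (fun l a b k j => (k + j + (l + a + b) == m)%N%:R *
  B k (B l (f a) (g b)) (h j) v)).
rewrite (@reorder5 _ 'I_m.+1 (fun l b j k a => (k + a + (l + b + j) == m)%N%:R *
  B k (f a) (B l (g b) (h j)) v)).
rewrite [RHS](eq_bigr (fun b : 'I_m.+1 => \sum_(a < m.+1) \sum_(j < m.+1)
  \sum_(k < m.+1) \sum_(l < m.+1) (k + a + (l + b + j) == m)%N%:R *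
  B k (f a) (B l (g b) (h j)) v)); last by move=> b _; rewrite exchange_big.
rewrite [RHS]exchange_big; apply: eq_bigr => a _; apply: eq_bigr => b _.
apply: eq_bigr => j _.
(* If the three orders already exceed [m], all indicators vanish; otherwise the truncated difference
   [q] is a true one. *)
have [sm|ms] := leqP (a + b + j) m; last first.
  rewrite !big1// => k _; apply: big1 => l _.
    by rewrite (_ : (_ == _) = false) ?mul0r//; apply/negbTE; lia.
  by rewrite (_ : (_ == _) = false) ?mul0r//; apply/negbTE; lia.
pose q := (m - (a + b + j))%N; have qN : (q < m.+1)%N by rewrite /q; lia.
transitivity (\sum_(k < m.+1) \sum_(l < m.+1) (k + l == q)%N%:R *
    B k (B l (f a) (g b)) (h j) v).
  apply: eq_bigr => k _; apply: eq_bigr => l _; congr (_%:R * _).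
  by congr nat_of_bool; apply/eqP/eqP; rewrite /q; lia.
rewrite (@antidiag _ (fun k l => B k (B l (f a) (g b)) (h j) v) q m.+1 qN).
rewrite (moyal_coef_assoc q oO (hf a) (hg b) (hh j) Ov).
rewrite -(@antidiag _ (fun k l => B k (f a) (B l (g b) (h j)) v) q m.+1 qN).
apply: eq_bigr => k _; apply: eq_bigr => l _; congr (_%:R * _).
by congr nat_of_bool; apply/eqP/eqP; rewrite /q; lia.
Qed.

Lemma moyal_coef0 (f g : V -> C) v : B 0 f g v = f v * g v.
Proof. by rewrite /moyal_coef /= expr0 fact0 invr1 mulr1 mul1r. Qed.

Lemma moyal_coef1 (f g : V -> C) O v : open O -> O v -> holo_on O f ->
  holo_on O g -> B 1 f g v = 'i / 2%:R *
    ('D_('e_1) f v * 'D_('e_0) g v - 'D_('e_0) f v * 'D_('e_1) g v).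
Proof.
move=> oO Ov hf hg; rewrite (moyal_coefE 1 oO hf hg Ov).
have E (a b c d : C) : kap (R := R) 1 * ((1 * a) * b + (-1 * c) * d) =
    'i / 2%:R * (a * b - c * d).
  by rewrite /kap expr1 (_ : 1`! = 1%N)// divr1 mul1r mulN1r mulNr.
by rewrite /tens big_cons big_seq1; exact: E.
Qed.

Lemma moyal_zero f g v : moyal om0 f g 0 v = f 0%N v * g 0%N v.
Proof.
rewrite (@moyal_csum _ _ 0 1)// (@sum_ix 1 (fun k i j => (k + i + j == 0)%N%:R *
  B k (f i) (g j) v)).
by rewrite !big_ord1 /= mul1r moyal_coef0.
Qed.

Lemma moyal_one f g v : moyal om0 f g 1 v =
  f 0%N v * g 1%N v + f 1%N v * g 0%N v + B 1 (f 0%N) (g 0%N) v.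
Proof.
have E (b : nat -> nat -> nat -> C) :
    \sum_(k < 2) \sum_(i < 2) \sum_(j < 2) (k + i + j == 1)%N%:R * b k i j =
    b 0%N 0%N 1%N + b 0%N 1%N 0%N + b 1%N 0%N 0%N.
  by rewrite !big_ord_recl !big_ord0 /= !(mul0r, mul1r, add0r, addr0).
rewrite (@moyal_csum _ _ 1 2)// (@sum_ix 2 (fun k i j => (k + i + j == 1)%N%:R *
  B k (f i) (g j) v)).
by rewrite (E (fun k i j => B k (f i) (g j) v)) !moyal_coef0.
Qed.

(** In positive order both factors are differentiated at least once, so a constant factor kills the
    term. This makes 1 a unit. *)
Lemma mlist_words k t : t \in mlist (R := R) k.+1 -> t.1.2 != [::] /\ t.2 != [::].
Proof.
rewrite /mlist iterS /mstep mem_cat => /orP[] /mapP[s _ ->]; by split.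
Qed.

Lemma dword_cst (c : C) (u : seq 'I_2) (v : V) : u != [::] -> dword u (fun=> c) v = 0.
Proof.
elim: u v => // a u IH v _ /=; case: u IH => [|b u] IH; first exact: derive_cst0.
have -> : dword (b :: u) (fun=> c) = (fun=> 0) by apply/funext => x; exact: IH.
exact: derive_cst0.
Qed.

Lemma holo_cst (c : C) O : holo_on O (fun=> c).
Proof. by move=> x _; exact: differentiable_cst. Qed.

Lemma moyal_coef_cstl k c (g : V -> C) O v : open O -> O v -> holo_on O g ->
  B k.+1 (fun=> c) g v = 0.
Proof.
move=> oO Ov hg; rewrite (moyal_coefE _ oO (@holo_cst c O) hg Ov).
rewrite /tens big1_seq ?mulr0// => t /andP[_ /mlist_words[t1 _]].
by rewrite (dword_cst _ _ t1) mulr0 mul0r.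
Qed.

Lemma moyal_coef_cstr k c (g : V -> C) O v : open O -> O v -> holo_on O g ->
  B k.+1 g (fun=> c) v = 0.
Proof.
move=> oO Ov hg; rewrite (moyal_coefE _ oO hg (@holo_cst c O) Ov).
rewrite /tens big1_seq ?mulr0// => t /andP[_ /mlist_words[_ t2]].
by rewrite (dword_cst _ _ t2) mulr0.
Qed.

Definition sconstV (t : V -> C) : nat -> V -> C :=
  fun k => if k is 0%N then t else fun=> 0.

Lemma moyal_unitl t m O v : open O -> O v -> holo_on O t ->
  moyal om0 (sconstV (fun=> 1)) (sconstV t) m v = sconstV t m v.
Proof.
move=> oO Ov ht; case: m => [|m]; first by rewrite moyal_zero mul1r.
rewrite (@moyal_csum _ _ m.+1 m.+2)//; apply: big1 => -[[k i] j] _ /=.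
have hs n : holo_on O (sconstV t n) by case: n => [//|n]; exact: holo_cst.
have [e|_] := eqVneq (k + i + j)%N m.+1; last by rewrite mul0r.
rewrite mul1r; case: i e => [[|i] ilt] /= e.
  case: k e => [[|k] klt] /= e.
    case: j e => [[|j] jlt] /= e; first by rewrite addn0 in e.
    by rewrite moyal_coef0 mulr0.
  exact: moyal_coef_cstl oO Ov (hs _).
case: k e => [[|k] klt] /= e; first by rewrite moyal_coef0 mul0r.
exact: moyal_coef_cstl oO Ov (hs _).
Qed.

Lemma moyal_unitr t m O v : open O -> O v -> holo_on O t ->
  moyal om0 (sconstV t) (sconstV (fun=> 1)) m v = sconstV t m v.
Proof.
move=> oO Ov ht; case: m => [|m]; first by rewrite moyal_zero mulr1.
rewrite (@moyal_csum _ _ m.+1 m.+2)//; apply: big1 => -[[k i] j] _ /=.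
have hs n : holo_on O (sconstV t n) by case: n => [//|n]; exact: holo_cst.
have [e|_] := eqVneq (k + i + j)%N m.+1; last by rewrite mul0r.
rewrite mul1r; case: j e => [[|j] jlt] /= e.
  case: k e => [[|k] klt] /= e.
    case: i e => [[|i] ilt] /= e; first by rewrite addn0 in e.
    by rewrite moyal_coef0 mul0r.
  exact: moyal_coef_cstr oO Ov (hs _).
case: k e => [[|k] klt] /= e; first by rewrite moyal_coef0 mulr0.
exact: moyal_coef_cstr oO Ov (hs _).
Qed.

End MoyalSeries.

(** * The cotangent bundle *)

Section ManifoldCharts.
Context {R : realType} {E : normedModType (cplx R)} {M : topologicalType}.
Local Notation C := (cplx R).

Lemma transportE (S T : Type) (W : zmodType) (D : set S) (phi : S -> T)
    (f : S -> W) y : (forall y y', D y -> D y' -> phi y = phi y' -> y = y') ->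
  D y -> transport D phi f (phi y) = f y.
Proof.
move=> inj Dy; rewrite /transport; case: xgetP => [x _ [z [Dz zy] <-]|/(_ (f y))].
  by rewrite (inj _ _ Dz Dy zy).
by case; exists y.
Qed.

Variable A : atlas E M.
Hypothesis hA : complex_manifold A.

Lemma rep_crd (W : zmodType) i (f : M -> W) y : dom i y ->
  rep (A := A) i f (crd i y) = f y.
Proof. by apply: transportE; exact: (mfd_crd_inj hA (i := i)). Qed.

(** Chart images of open sets are open in the model space. This is what allows [rep], whose values
    outside the chart image are defaults, to be computed near a point. *)
Lemma near_chart i y (W : set M) : open W -> W y -> dom (a := A) i y ->
  \forall q \near crd (a := A) i y,
    exists y', [/\ W y', dom (a := A) i y' & q = crd i y'].
Proof.
move=> oW Wy dy; have oWd : open (W `&` dom (a := A) i).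
  by apply: openI => //; exact: mfd_dom_open.
have := mfd_crd_open hA oWd (@subIsetr _ _ _) => oi.
have : nbhs (crd i y) (crd i @` (W `&` dom (a := A) i)).
  by apply: open_nbhs_nbhs; split => //; exists y.
by apply: filterS => q [y' [Wy' dy'] <-]; exists y'.
Qed.

Lemma open_chart i (W : set M) : open W ->
  open (crd (a := A) i @` (W `&` dom (a := A) i)).
Proof.
move=> oW; apply: (mfd_crd_open hA); last exact: subIsetr.
by apply: openI => //; exact: mfd_dom_open.
Qed.

Lemma man_continuous (T : topologicalType) (g : T -> M) t i :
  dom (a := A) i (g t) -> (\forall s \near t, dom (a := A) i (g s)) ->
  {for t, continuous (fun s => crd i (g s))} -> {for t, continuous g}.
Proof.
move=> dt dg cg N /= Nt.
have [B [oB Bt BN]] : exists B, [/\ open B, B (g t) & B `<=` N].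
  by move: Nt; rewrite nbhsE => -[B [oB Bt] BN]; exists B.
have := cg _ (near_chart oB Bt dt) => h.
apply: filterS2 dg h => s ds [y' [By' dy' e]].
by apply: BN; rewrite (mfd_crd_inj hA ds dy' e).
Qed.

Lemma rep_trans (W : zmodType) i j (f : M -> W) y : dom (a := A) i y ->
  dom (a := A) j y -> \forall q \near crd (a := A) j y,
    rep (A := A) i f (rep (A := A) j (crd i) q) = rep (A := A) j f q.
Proof.
move=> di dj; apply: filterS (near_chart (mfd_dom_open hA i) di dj) => q.
by move=> [y' [di' dj' ->]]; rewrite !rep_crd.
Qed.

Lemma near_rep (W : zmodType) i (f g : M -> W) (U : set M) y : open U -> U y ->
  (forall y, U y -> f y = g y) -> dom (a := A) i y ->
  \forall q \near crd (a := A) i y, rep (A := A) i f q = rep (A := A) i g q.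
Proof.
move=> oU Uy fg di; apply: filterS (near_chart oU Uy di) => q.
by move=> [y' [Uy' di' ->]]; rewrite !rep_crd// fg.
Qed.

Lemma diff_trans (V : normedModType C) i j (f : M -> V) y :
  dom (a := A) i y -> dom (a := A) j y ->
  differentiable (rep (A := A) i f) (crd i y) ->
  differentiable (rep (A := A) j f) (crd j y) /\
  forall v, 'd (rep (A := A) j f) (crd j y) v =
    'd (rep (A := A) i f) (crd i y) ('d (rep (A := A) j (crd i)) (crd j y) v).
Proof.
move=> di dj df; have dt := mfd_crd_holo hA di dj.
have e := rep_crd (crd i) dj.
have df' : differentiable (rep (A := A) i f) (rep (A := A) j (crd i) (crd j y)).
  by rewrite e.
have [dg Eg] := near_diff (rep_trans f di dj) (differentiable_comp dt df').
split; first exact: dg.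
move=> v; rewrite Eg.
have -> : 'd (rep (A := A) i f \o rep (A := A) j (crd i)) (crd j y) v =
   'd (rep (A := A) i f) (rep (A := A) j (crd i) (crd j y))
     ('d (rep (A := A) j (crd i)) (crd j y) v).
  by rewrite (diff_comp dt df').
by rewrite e.
Qed.

Lemma holo_chart (V : normedModType C) (f : M -> V) (U : set M) :
  (forall y, U y -> exists2 i, dom (a := A) i y &
     differentiable (rep (A := A) i f) (crd i y)) -> holo A U f.
Proof.
move=> h j y Uy dj; have [i di df] := h y Uy.
by have [dg _] := diff_trans di dj df.
Qed.

Lemma holo_ext (V : normedModType C) (f g : M -> V) (U : set M) : open U ->
  (forall y, U y -> f y = g y) -> holo A U f -> holo A U g.
Proof.
move=> oU fg hf i y Uy di.
exact: near_differentiable (near_rep oU Uy fg di) (hf i y Uy di).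
Qed.

Lemma holo_sub (V : normedModType C) (f : M -> V) (U U' : set M) :
  U' `<=` U -> holo A U f -> holo A U' f.
Proof. by move=> UU hf i y Uy di; apply: hf => //; exact: UU. Qed.

Lemma rep_holo (V : normedModType C) i (f : M -> V) (U : set M) : holo A U f ->
  forall q, (crd (a := A) i @` (U `&` dom (a := A) i)) q ->
    differentiable (rep (A := A) i f) q.
Proof. by move=> hf _ [y [Uy di] <-]; exact: hf. Qed.

Lemma holo_continuous (V : normedModType C) (f : M -> V) (U : set M) y :
  open U -> holo A U f -> U y -> {for y, continuous f}.
Proof.
move=> oU hf Uy; have [i di] := mfd_cover hA y.
have cr := differentiable_continuous (hf i y Uy di).
have cc := mfd_crd_continuous hA di.
move=> N /= Ny.
have Ny' : nbhs (rep (A := A) i f (crd i y)) N by rewrite rep_crd.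
have h : \forall z \near y, N (rep (A := A) i f (crd i z)) := cc _ (cr _ Ny').
have dn : nbhs y (dom (a := A) i).
  by apply: open_nbhs_nbhs; split => //; exact: mfd_dom_open.
by apply: filterS2 h dn => z /= hz dz; move: hz; rewrite rep_crd.
Qed.

End ManifoldCharts.

Section InverseFunction.
Context {R : realType}.
Local Notation C := (cplx R).

(** Every value near [h c] is attained near [c], so the left inverse [psi] is a true inverse there.
    The lower bound [nm a / 2 * nm (psi q - c) <= nm (q - h c)] converts the remainder of [h] into
    one of [psi]; the loss of [2 / nm a] and a division by [a] account for [e']. *)
Lemma inverse_deriv (h psi : C -> C) (O : set C) c : open O -> O c ->
  (forall w, O w -> differentiable h w) -> derive1 h c != 0 ->
  (forall w, O w -> psi (h w) = w) -> has_deriv psi (derive1 h c)^-1 (h c).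
Proof.
move=> oO Oc dh a0 ph; have [r r0 [rO lin]] := near_linear oO Oc dh a0.
have dhc := diff_has_deriv (dh _ Oc).
move: (derive1 h c) a0 lin dhc => a a0 lin dhc {dh}.
have na : 0 < nm a by rewrite nm_gt0.
have inv q : nm (q - h c) < nm a * r / 4 ->
    nm (psi q - c) < r /\ h (psi q) = q.
  move=> /(near_linear_surj a0 r0 lin)[w wr <-].
  by have [Ow _] := rO _ wr; rewrite ph.
move=> e e0; pose e' := e * nm a ^+ 2 / 2.
have e'0 : 0 < e' by rewrite divr_gt0// mulr_gt0// exprn_gt0.
have [d d0 dP] := dhc _ e'0.
exists (Num.min (nm a * r / 4) (nm a * d / 2)).
  by rewrite lt_min !divr_gt0// mulr_gt0.
move=> q; rewrite lt_min => /andP[q1 q2].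
have [pr hp] := inv _ q1.
have cr : nm (c - c) < r by rewrite subrr nm0.
have hlow := lin _ _ cr pr; rewrite hp in hlow.
have low : nm a / 2 * nm (psi q - c) <= nm (q - h c).
  have := nm_sub ((psi q - c) * a) (q - h c).
  rewrite nmM (nmBC ((psi q - c) * a)); lra.
have pd : nm (psi q - c) < d.
  rewrite -(ltr_pM2l (_ : 0 < nm a / 2)) ?divr_gt0//; lra.
have := dP _ pd; rewrite hp => hh.
have -> : psi (h c) = c by apply: ph.
have -> : psi q - c - (q - h c) / a = - ((q - h c - (psi q - c) * a) / a).
  by field.
rewrite nmN nmM nmV ler_pdivrMr//.
apply: le_trans hh _.
have : e' * nm (psi q - c) = e * nm a * (nm a / 2 * nm (psi q - c)).
  by rewrite /e'; ring.
move=> ->; have : e * nm a * (nm a / 2 * nm (psi q - c)) <=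
    e * nm a * nm (q - h c) by rewrite ler_wpM2l// mulr_ge0// ltW.
by lra.
Qed.

End InverseFunction.

Section FiberedMaps.
Context {R : realType}.
Local Notation C := (cplx R).
Local Notation V := 'rV[C]_2.

(* The coordinate expression of a map of line bundles. *)
Definition fibmap (t s : C -> C) (p : V) : V := pt2 (t (p 0 0)) (p 0 1 * s (p 0 0)).

Lemma coord_diff (p : V) i : differentiable (fun q : V => q 0 i : C) p.
Proof. exact: differentiable_coord. Qed.

Lemma derive_coord (p : V) i (a : 'I_2) :
  'D_('e_a) (fun q : V => q 0 i : C) p = (a == i)%:R.
Proof.
rewrite (deriveE _ (coord_diff p i)).
have lin : linear (fun q : V => q 0 i : C).
  by move=> u y z; rewrite !mxE.
pose linM := GRing.isLinear.Build _ _ _ _ _ lin.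
pose L : {linear V -> C} := HB.pack (fun q : V => q 0 i : C) linM.
have cL : continuous L by exact: coord_continuous.
have E : 'd L p = L :> (V -> C) by exact: diff_lin.
have -> : 'd (fun q : V => q 0 i : C) p 'e_a = L 'e_a.
  exact (congr1 (fun F : V -> C => F 'e_a) E).
by rewrite /L /= !mxE eqxx eq_sym.
Qed.

Lemma comp_coord_diff (t : C -> C) (p : V) i : differentiable t (p 0 i) ->
  differentiable (fun q : V => t (q 0 i)) p.
Proof. by move=> dt; exact: (differentiable_comp (coord_diff p i) dt). Qed.

Lemma comp_coord_derive (t : C -> C) (p : V) i (a : 'I_2) :
  differentiable t (p 0 i) ->
  'D_('e_a) (fun q : V => t (q 0 i)) p = (a == i)%:R * derive1 t (p 0 i).
Proof.
move=> dt; rewrite (deriveE _ (comp_coord_diff dt)).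
have e1 : 'd (t \o (fun q : V => q 0 i : C)) p 'e_a =
    'd t (p 0 i) ('d (fun q : V => q 0 i : C) p 'e_a).
  exact (congr1 (fun F : V -> C => F 'e_a) (diff_comp (coord_diff p i) dt)).
have e2 : 'd (fun q : V => q 0 i : C) p 'e_a = (a == i)%:R.
  by rewrite -(deriveE _ (coord_diff p i)) derive_coord.
have e3 (x : C) : 'd t (p 0 i) x = x * derive1 t (p 0 i).
  have e4 := diff1E dt.
  exact (congr1 (fun F : C -> C => F x) e4).
exact: (etrans e1 (etrans (congr1 ('d t (p 0 i)) e2) (e3 _))).
Qed.

Lemma pt2_diff (f g : V -> C) (p : V) : differentiable f p -> differentiable g p ->
  differentiable (fun q => pt2 (f q) (g q)) p.
Proof.
move=> df dg.
have -> : (fun q => pt2 (f q) (g q)) =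
    (fun q => f q *: ('e_0 : V)) + (fun q => g q *: ('e_1 : V)).
  apply/funext => q; apply/rowP => i; rewrite !mxE.
  by case: (ord2P i) => -> /=; rewrite ?mulr1 ?mulr0 ?addr0 ?add0r.
exact: (differentiableD (differentiableZl _ df) (differentiableZl _ dg)).
Qed.

Lemma derive_comp_coord (phi : V -> V) (p v : V) i : differentiable phi p ->
  ('D_v phi p) 0 i = 'D_v (fun q => phi q 0 i) p.
Proof.
move=> dphi.
have dc := differentiable_comp dphi (coord_diff (phi p) i).
rewrite (deriveE v dphi) (deriveE v dc).
have e1 : 'd ((fun q : V => q 0 i : C) \o phi) p v =
    'd (fun q : V => q 0 i : C) (phi p) ('d phi p v).
  exact (congr1 (fun F : V -> C => F v) (diff_comp dphi (coord_diff (phi p) i))).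
have e2 w : 'd (fun q : V => q 0 i : C) (phi p) w = w 0 i.
  rewrite (diff2E _ (coord_diff (phi p) i)) !derive_coord.
  by case: (ord2P i) => -> /=; rewrite ?mulr1 ?mulr0 ?addr0 ?add0r.
exact: esym (etrans e1 (e2 _)).
Qed.

Lemma fibmap_diff (t s : C -> C) (p : V) : differentiable t (p 0 0) ->
  differentiable s (p 0 0) -> differentiable (fibmap t s) p.
Proof.
move=> dt ds; apply: pt2_diff; first exact: comp_coord_diff.
by apply: diffMC; [exact: coord_diff|exact: comp_coord_diff].
Qed.

Lemma fibmap_derive0 (t s : C -> C) (p : V) : differentiable t (p 0 0) ->
  differentiable s (p 0 0) ->
  'D_('e_0) (fibmap t s) p = pt2 (derive1 t (p 0 0)) (p 0 1 * derive1 s (p 0 0)).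
Proof.
move=> dt ds; apply/rowP => i; rewrite (derive_comp_coord _ _ (fibmap_diff dt ds)).
case: (ord2P i) => ->.
  have -> : (fun q => fibmap t s q 0 0) = (fun q : V => t (q 0 0)).
    by apply/funext => q; rewrite /fibmap pt20.
  by rewrite (comp_coord_derive _ dt) pt20 mul1r.
have -> : (fun q => fibmap t s q 0 1) = (fun q : V => q 0 1 * s (q 0 0)).
  by apply/funext => q; rewrite /fibmap pt21.
rewrite (derive_MC _ (coord_diff p 1) (comp_coord_diff ds)).
by rewrite (comp_coord_derive _ ds) derive_coord pt21 /= mul0r add0r mul1r.
Qed.

Lemma fibmap_derive1 (t s : C -> C) (p : V) : differentiable t (p 0 0) ->
  differentiable s (p 0 0) ->
  'D_('e_1) (fibmap t s) p = pt2 0 (s (p 0 0)).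
Proof.
move=> dt ds; apply/rowP => i; rewrite (derive_comp_coord _ _ (fibmap_diff dt ds)).
case: (ord2P i) => ->.
  have -> : (fun q => fibmap t s q 0 0) = (fun q : V => t (q 0 0)).
    by apply/funext => q; rewrite /fibmap pt20.
  by rewrite (comp_coord_derive _ dt) pt20 /= mul0r.
have -> : (fun q => fibmap t s q 0 1) = (fun q : V => q 0 1 * s (q 0 0)).
  by apply/funext => q; rewrite /fibmap pt21.
rewrite (derive_MC _ (coord_diff p 1) (comp_coord_diff ds)).
by rewrite (comp_coord_derive _ ds) derive_coord pt21 /= mul1r mul0r mulr0 addr0.
Qed.

End FiberedMaps.

(** * Covectors, charts and topology of the cotangent bundle *)

Section CotangentBundle.
Context {R : realType} {X : topologicalType}.
Local Notation C := (cplx R).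
Local Notation V := 'rV[C]_2.
Variable A : atlas C X.
Hypothesis hA : complex_manifold A.
Implicit Types (i j k : idx A) (x : X) (y : cotangent A).

Lemma diff1C (f : C -> C) (x h : C) : differentiable f x ->
  'd f x h = h * derive1 f x.
Proof. by move=> df; exact (congr1 (fun F : C -> C => F h) (diff1E df)). Qed.

(* Locked, for unification would otherwise unfold derivatives. *)
Definition trd i j x : C := locked (derive1 (rep (A := A) i (crd j)) (crd i x)).

Lemma trdE i j x : derive1 (rep (A := A) i (crd j)) (crd i x) = trd i j x.
Proof. by rewrite /trd -lock. Qed.

Lemma trd_trans i j k x : dom i x -> dom j x -> dom k x ->
  trd i k x = trd i j x * trd j k x.
Proof.
move=> di dj dk; have dij := mfd_crd_holo hA (i := i) (j := j) dj di.
have djk := mfd_crd_holo hA (i := j) (j := k) dk dj.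
have dik := mfd_crd_holo hA (i := i) (j := k) dk di.
have [_ /(_ 1) e] := diff_trans hA dj di djk.
have e1 := diff1C 1 dik; have e2 := diff1C 1 dij.
rewrite trdE in e1; rewrite trdE in e2.
have e3 := diff1C ('d (rep (A := A) i (crd j)) (crd i x) 1) djk.
rewrite trdE in e3.
have e4 : 1 * trd i k x = (1 * trd i j x) * trd j k x.
  exact: (etrans (esym e1) (etrans e (etrans e3 (congr1 (fun u => u * trd j k x) e2)))).
by move: (trd i k x) (trd i j x) (trd j k x) e4 {e e1 e2 e3} => a b c;
  rewrite !mul1r.
Qed.

Lemma trd_id i x : dom i x -> trd i i x = 1.
Proof.
move=> di.
have E : \forall q \near crd i x, q = rep (A := A) i (crd i) q.
  apply: filterS (near_chart hA (mfd_dom_open hA i) di di) => q.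
  by move=> [x' [di' _ ->]]; rewrite (rep_crd hA).
have D := is_diff_id (crd i x).
have [dr Er0] := near_diff E (@ex_diff _ _ _ _ _ _ _ D).
have Er := congr1 (fun F : C -> C => F 1) Er0.
have e1 := diff1C 1 dr; rewrite trdE in e1.
have e2 := congr1 (fun F : C -> C => F 1) (@diff_val _ _ _ _ _ _ _ D).
have e3 : 1 * trd i i x = 1.
  exact: (etrans (esym e1) (etrans Er e2)).
by move: (trd i i x) e3 {e1 e2 Er Er0} => a; rewrite mul1r.
Qed.

Lemma trdV i j x : dom i x -> dom j x -> trd i j x * trd j i x = 1.
Proof. by move=> di dj; rewrite -(trd_trans di dj di) trd_id. Qed.

Lemma cotP y : covector (base y) (cov y).
Proof. by case: y. Qed.

Lemma cov_out y i : ~ dom i (base y) -> cov y i = 0.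
Proof. exact: (cotP y).1. Qed.

Lemma cov_trans y i j : dom i (base y) -> dom j (base y) ->
  cov y i = cov y j * trd i j (base y).
Proof. by move=> di dj; rewrite -trdE; exact: ((cotP y).2 i j di dj). Qed.

Lemma cot_eq y y' : base y = base y' -> cov y = cov y' -> y = y'.
Proof.
case: y => x z h; case: y' => x' z' h' /= xx zz; subst x' z'.
by rewrite (Prop_irrelevance h h').
Qed.

Lemma covec_eq x (z z' : idx A -> C) i : covector x z -> covector x z' ->
  dom i x -> z i = z' i -> z = z'.
Proof.
move=> [z0 zt] [z0' zt'] di zz; apply/funext => j.
have [dj|dj] := pselect (dom j x); last by rewrite z0// z0'.
by rewrite (zt j i dj di) (zt' j i dj di) trdE zz.
Qed.

Lemma cot_eq_chart y y' i : dom i (base y) -> base y = base y' ->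
  cov y i = cov y' i -> y = y'.
Proof.
move=> di bb cc; apply: cot_eq => //.
have c2 : covector (base y) (cov y') by rewrite bb; exact: cotP.
exact: covec_eq (cotP y) c2 di cc.
Qed.

Definition mkcov i x (u : C) : idx A -> C :=
  fun j => if pselect (dom j x) then u * trd j i x else 0.

Lemma mkcovP i x u : dom i x -> covector x (mkcov i x u).
Proof.
move=> di; split=> [j dj|j k dj dk]; rewrite /mkcov.
  by case: (pselect (dom j x)) => [d|]; first have := dj d.
case: (pselect (dom j x)) => [d|d]; last by have := d dj.
case: (pselect (dom k x)) => [d'|d']; last by have := d' dk.
rewrite trdE.
rewrite (trd_trans dj dk di).
by move: (trd j k x) (trd k i x) => a b; rewrite -mulrA [b * a]mulrC.
Qed.

Lemma cot_exists i x u : dom i x ->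
  exists y, base y = x /\ cov y i = u.
Proof.
move=> di; exists (Cotangent (mkcovP u di)); split => //=.
rewrite /mkcov; case: (pselect (dom i x)) => [d|d]; last by have := d di.
by rewrite (trd_id di) mulr1.
Qed.

Lemma cot_crd_inj i y y' : dom i (base y) -> dom i (base y') ->
  cot_crd i y = cot_crd i y' -> y = y'.
Proof.
move=> di di' e.
have e0 : crd i (base y) = crd i (base y').
  by have := congr1 (fun p : V => p 0 0) e; rewrite /cot_crd !pt20.
have e1 : cov y i = cov y' i.
  by have := congr1 (fun p : V => p 0 1) e; rewrite /cot_crd !pt21.
exact: (cot_eq_chart di (mfd_crd_inj hA di di' e0) e1).
Qed.

Lemma cot_openE (W : set (cotangent A)) : open W = cot_open W.
Proof. by []. Qed.

Lemma base_open (U : set X) : open U -> open (cot_over (A := A) U).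
Proof.
move=> oU; rewrite cot_openE => i y Uy di.
have := near_chart hA oU Uy di => /(@nbhs_nm _ (crd i (base y)))[e e0 eP].
apply/nbhs_rv2; exists e => // p p0 _ y' di' py.
rewrite -py /cot_crd !pt20 in p0.
have [x [Ux dx e1]] := eP _ p0.
by rewrite /cot_over /= (mfd_crd_inj hA di' dx e1).
Qed.

Lemma cot_dom_open i : open (fun y => dom i (base y)).
Proof. exact: (base_open (mfd_dom_open hA i)). Qed.

(** Coefficients of covectors are multiplied by the derivative of the inverse transition, taken at
    the image point. Hence the Jacobian determinant will be 1. *)
Definition cot_tr i j : V -> V :=
  fibmap (rep (A := A) i (crd j))
    (fun q => derive1 (rep (A := A) j (crd i)) (rep (A := A) i (crd j) q)).

Lemma cot_trE i j y : dom i (base y) -> dom j (base y) ->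
  cot_tr i j (cot_crd i y) = cot_crd j y.
Proof.
move=> di dj; rewrite /cot_tr /fibmap /cot_crd pt20 pt21 (rep_crd hA)//.
by rewrite trdE (cov_trans dj di).
Qed.

Lemma trd_holo i j x : dom i x -> dom j x ->
  differentiable (derive1 (rep (A := A) i (crd j))) (crd i x).
Proof.
move=> di dj; pose O := crd i @` (dom j `&` dom i).
have oO : open O by apply: (open_chart hA); exact: mfd_dom_open.
apply: (derive1_holo oO); first by exists x.
exact: (rep_holo (mfd_crd_holo hA (j := j))).
Qed.

Lemma cot_tr_fib i j x : dom i x -> dom j x ->
  differentiable (rep (A := A) i (crd j)) (crd i x) /\
  differentiable (fun q => derive1 (rep (A := A) j (crd i)) (rep (A := A) i (crd j) q))
    (crd i x).
Proof.
move=> di dj; have d1 := mfd_crd_holo hA (i := i) (j := j) dj di.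
split; first exact: d1.
have d2 := trd_holo dj di.
have d3 : differentiable (derive1 (rep (A := A) j (crd i)))
    (rep (A := A) i (crd j) (crd i x)) by rewrite (rep_crd hA).
exact: (differentiable_comp d1 d3).
Qed.

Lemma cot_tr_diff i j y : dom i (base y) -> dom j (base y) ->
  differentiable (cot_tr i j) (cot_crd i y).
Proof.
move=> di dj; have [d1 d2] := cot_tr_fib di dj.
by apply: fibmap_diff; rewrite /cot_crd pt20.
Qed.

(** Openness in the bundle constrains only those points of a chart that are coordinates of
    covectors. Since a chart image is an open set times the whole fibre, all points near
    [cot_crd i y] are of this kind. *)
Lemma near_cot i y (W : set (cotangent A)) : open W -> W y -> dom i (base y) ->
  \forall p \near cot_crd i y,
    exists y', [/\ W y', dom i (base y') & p = cot_crd i y'].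
Proof.
move=> oW Wy di; rewrite cot_openE in oW.
have h1 := oW i y Wy di.
have := near_chart hA (mfd_dom_open hA i) di di.
move=> /(@nbhs_nm _ (crd i (base y)))[e e0 eP].
have h2 : \forall p \near cot_crd i y,
      exists x, dom i x /\ (p : V) 0 0 = crd i x.
  apply/nbhs_rv2; exists e => // p p0 _; rewrite /cot_crd pt20 in p0.
  by have [x [dx _ ->]] := eP _ p0; exists x.
apply: filterS2 h1 h2 => p Wp [x [dx px]].
have [y' [yx yp]] := cot_exists (p 0 1) dx.
have e1 : cot_crd i y' = p by rewrite /cot_crd yx yp -px -pt2_eta.
have dy' : dom i (base y') by rewrite yx.
by exists y'; split=> //; exact: Wp.
Qed.

Lemma cot_crd_open i (W : set (cotangent A)) : open W ->
  W `<=` (fun y => dom i (base y)) -> open (cot_crd i @` W).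
Proof.
move=> oW Wd; rewrite openE => _ [y Wy <-].
by apply: filterS (near_cot oW Wy (Wd _ Wy)) => p [y' [Wy' _ ->]]; exists y'.
Qed.

Lemma cot_crd_continuous i y : dom i (base y) -> {for y, continuous (cot_crd i)}.
Proof.
move=> di N /= Ny'; have Ny : nbhs (cot_crd i y) N := Ny'.
have [B [oB By BN]] : exists B, [/\ open B, B (cot_crd i y) & B `<=` N].
  by move: Ny; rewrite nbhsE => -[B [oB By] BN]; exists B.
(* The topology refers to all charts at once, so openness of [W] is tested in an arbitrary chart
   [j], where [W] is a preimage under the continuous transition [cot_tr j i]. *)
pose W y' := dom i (base y') /\ B (cot_crd i y').
have oW : open W.
  rewrite cot_openE => j y0 [di0 By0] dj0.
  have ct := differentiable_continuous (cot_tr_diff dj0 di0).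
  have h1 : \forall p \near cot_crd j y0, B (cot_tr j i p).
    by apply: ct; rewrite cot_trE//; exact: open_nbhs_nbhs.
  have h2 := near_cot (@cot_dom_open i) di0 dj0.
  apply: filterS2 h1 h2 => p Bp [y1 [di1 dj1 e1]] y' dj' e'.
  have yy : y' = y1 by apply: (cot_crd_inj dj' dj1); rewrite e'.
  by subst y'; split=> //; rewrite -(cot_trE dj1 di1) e'.
have : nbhs y W by apply: open_nbhs_nbhs; split.
by apply: filterS => y' [_ /BN].
Qed.

Lemma pt2_near_sep (p q : V) : p <> q -> exists P Q : set V,
  [/\ open_nbhs p P, open_nbhs q Q & P `&` Q = set0].
Proof.
move=> pq; have : exists AB : set V * set V, (p \in AB.1 /\ q \in AB.2) /\
    [/\ open AB.1, open AB.2 & AB.1 `&` AB.2 == set0].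
  have := @norm_hausdorff C V; rewrite open_hausdorff => /(_ p q).
  by move=> /(_ ltac:(exact/eqP)) [AB h1 h2]; exists AB.
move=> [[P Q] /= [[/set_mem Pp /set_mem Qq] [oP oQ /eqP PQ]]].
by exists P, Q.
Qed.

Lemma cot_hausdorff : hausdorff_space (cotangent A).
Proof.
rewrite open_hausdorff => y y' /eqP yy.
have [bb|bb] := pselect (base y = base y').
  have [i di] := mfd_cover hA (base y).
  have di' : dom i (base y') by rewrite -bb.
  have cc : cot_crd i y <> cot_crd i y'.
    by move=> /(cot_crd_inj di di').
  have [P [Q [Pp Qq PQ]]] := pt2_near_sep cc.
  have [B1 [oB1 B1y] B1P] : exists2 B, open_nbhs y B &
      B `<=` (cot_crd i @^-1` P).
    have H : nbhs y (cot_crd i @^-1` P) :=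
      cot_crd_continuous di (open_nbhs_nbhs Pp).
    by move: H; rewrite nbhsE => -[B hB BN]; exists B.
  have [B2 [oB2 B2y] B2Q] : exists2 B, open_nbhs y' B &
      B `<=` (cot_crd i @^-1` Q).
    have H : nbhs y' (cot_crd i @^-1` Q) :=
      cot_crd_continuous di' (open_nbhs_nbhs Qq).
    by move: H; rewrite nbhsE => -[B hB BN]; exists B.
  exists (B1, B2); first by split; exact/mem_set.
  split=> //; apply/eqP/seteqP; split=> // z [/= z1 z2].
  have : (P `&` Q) (cot_crd i z) by split; [exact: B1P|exact: B2Q].
  by rewrite PQ.
have := mfd_hausdorff hA; rewrite open_hausdorff => /(_ (base y) (base y')).
move=> /(_ ltac:(exact/eqP)) [[P Q] /= [/set_mem Py /set_mem Qy] [oP oQ PQ]].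
exists (cot_over (A := A) P, cot_over (A := A) Q).
  by split; exact/mem_set.
split; [exact: base_open|exact: base_open|].
apply/eqP/seteqP; split=> // z [/= z1 z2].
have : (P `&` Q) (base z) by split.
by move/eqP : PQ => ->.
Qed.

End CotangentBundle.

(** * Connectedness criteria and a countable dense set of scalars *)

Section Connectedness.
Context {R : realType}.
Local Notation C := (cplx R).

Lemma star_connected (T : topologicalType) (U : set T) p :
  (forall y, U y -> exists B, [/\ connected B, B p, B y & B `<=` U]) ->
  connected U.
Proof.
move=> h; pose B y := if pselect (U y) is left Uy then sval (cid (h y Uy)) else set0.
have BP y : U y -> [/\ connected (B y), B y p, B y y & B y `<=` U].
  move=> Uy; rewrite /B; case: (pselect (U y)) => [u|/(_ Uy)//].
  by case: cid.
have -> : U = \bigcup_(y in U) B y.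
  apply/seteqP; split=> y; first by move=> Uy; exists y => //; have [] := BP y Uy.
  by move=> [z Uz Bzy]; have [_ _ _] := BP z Uz; apply.
apply: bigcup_connected; last by move=> y /BP[].
by exists p => y /BP[].
Qed.

Lemma path_connected (T : topologicalType) (g : R -> T) (a b : R) :
  continuous g -> connected (g @` [set r | a <= r <= b]).
Proof.
move=> cg; have -> : [set r | a <= r <= b] = [set` `[a, b]].
  by apply/seteqP; split=> r /=; rewrite in_itv.
apply: connected_continuous_connected; first exact: segment_connected.
by apply: continuous_subspaceT => r.
Qed.

Lemma rc_affine_continuous (u v : C) : continuous (fun r : R => u + rc r * v).
Proof.
move=> r; apply/cvgrPdist_lt => e e0.
have ne : 0 < complex.Re e / (1 + nm v).
  by rewrite divr_gt0 ?pos_Re// ltr_pwDl// nm_ge0.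
have h : \forall s \near r, `|r - s| < complex.Re e / (1 + nm v).
  by apply/nbhs_ballP; exists (complex.Re e / (1 + nm v)).
apply: filterS h => s /= rs; rewrite normE (pos_rc e0) rc_lt.
have -> : u + rc r * v - (u + rc s * v) = rc (r - s) * v.
  by rewrite /rc rmorphB /=; ring.
rewrite nmM nm_rc; have := nm_ge0 v; move: rs; rewrite ltr_pdivlMr; last first.
  by rewrite ltr_pwDl// nm_ge0.
by have := normr_ge0 (r - s); nra.
Qed.

Lemma star_shaped_connected (S : set C) p : S p ->
  (forall w (t : R), S w -> 0 <= t <= 1 -> S (p + rc t * (w - p))) ->
  connected S.
Proof.
move=> Sp SS; apply: (@star_connected _ _ p) => w Sw.
exists ((fun t : R => p + rc t * (w - p)) @` [set t | 0 <= t <= 1]); split.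
- apply (@path_connected _ (fun t : R => p + rc t * (w - p)) 0 1).
  exact: rc_affine_continuous.
- by exists 0; [rewrite /= lexx ler01|rewrite /rc rmorph0 mul0r addr0].
- by exists 1; [rewrite /= lexx ler01|rewrite /rc rmorph1 mul1r; ring].
by move=> _ [t /= t01 <-]; exact: SS.
Qed.

Lemma disc_connected (z : C) (r : R) : connected [set w | nm (w - z) < r].
Proof.
have [r0|r0] := ltP 0 r; last first.
  have -> : [set w | nm (w - z) < r] = set0; last exact: connected0.
  apply/seteqP; split=> // w /= wr.
  by have := lt_le_trans wr r0; rewrite ltNge nm_ge0.
apply: (@star_shaped_connected _ z) => [|w t /= wr /andP[t0 t1]].
  by rewrite /= subrr nm0.
rewrite addrAC subrr add0r nmM nm_rc ger0_norm//.
by apply: le_lt_trans wr; rewrite ler_piMl// nm_ge0.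
Qed.

Lemma rat_dense (u : C) (e : R) : 0 < e ->
  exists q : rat * rat, nm (rc (ratr q.1) + 'i * rc (ratr q.2) - u) < e.
Proof.
move=> e0; have e2 : 0 < e / 2 by rewrite divr_gt0.
have approx (a : R) : exists q : rat, `|ratr q - a| < e / 2.
  have [q] := @rat_in_itvoo R (a - e / 2) (a + e / 2) ltac:(lra).
  by rewrite in_itv /= => /andP[q1 q2]; exists q; rewrite ltr_norml; lra.
have [q1 h1] := approx (complex.Re u); have [q2 h2] := approx (complex.Im u).
exists (q1, q2) => /=.
have -> : rc (ratr q1) + 'i * rc (ratr q2) - u =
    rc (ratr q1 - complex.Re u) + 'i * rc (ratr q2 - complex.Im u).
  have E : u = rc (complex.Re u) + 'i * rc (complex.Im u) := complexE u.
  rewrite [in LHS]E /rc !rmorphB /=; ring.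
apply: le_lt_trans (nmD _ _) _; rewrite nmM !nm_rc.
have -> : nm 'i = 1 :> R by rewrite nmE normCi.
lra.
Qed.

End Connectedness.

(** * The cotangent bundle as a connected complex manifold *)

Section CotangentManifold.
Context {R : realType} {X : topologicalType}.
Local Notation C := (cplx R).
Local Notation V := 'rV[C]_2.
Variable A : atlas C X.
Hypothesis hA : complex_manifold A.
Implicit Types (i j k : idx A) (x : X) (y : cotangent A).

Lemma cov_ball_open i (q : C) (e : R) (b : set X) : open b -> b `<=` dom i ->
  open (fun y => b (base y) /\ nm (cov y i - q) < e).
Proof.
move=> ob bi; rewrite openE => y [by_ ye].
have di := bi _ by_.
have h1 : nbhs (cot_crd i y) [set p : V | nm (p 0 1 - q) < e].
  apply/nbhs_rv2; exists (e - nm (cov y i - q)); first by rewrite subr_gt0.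
  move=> p _; rewrite /cot_crd pt21 /= => h.
  by have := nm_triang (cov y i) (p 0 1) q; lra.
have h2 : \forall z \near y, nm (cot_crd i z 0 1 - q) < e.
  exact: (cot_crd_continuous hA di h1).
have h3 : nbhs y (cot_over (A := A) b).
  by apply: open_nbhs_nbhs; split => //; exact: base_open.
rewrite /interior /=; apply: filterS2 h2 h3 => z hz bz; split; first exact: bz.
by move: hz; rewrite /cot_crd pt21.
Qed.

(** The atlas may be uncountable, so charts are chosen per basic open set of [X]: [b1] serves to
    select a chart containing it, [b2] is the actual neighbourhood in the base, and a disc with
    rational centre and radius [n.+1%:R^-1] bounds the fibre coordinate. *)
Lemma cot_countable : @second_countable (cotangent A).
Proof.
have [B cB [Bo Bb]] := mfd_countable hA.
have hch (b : set X) : exists o : option (idx A),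
    if o is Some i then b `<=` dom i else ~ exists i, b `<=` dom i.
  by have [[i bi]|h] := pselect (exists i, b `<=` dom i); [exists (Some i)|exists None].
have [ch chP] := choice hch.
pose N (t : set X * set X * (rat * rat) * nat) : set (cotangent A) :=
  if ch t.1.1.1 is Some i then fun y => (t.1.1.1 `&` t.1.1.2) (base y) /\
    nm (cov y i - (rc (ratr t.1.2.1) + 'i * rc (ratr t.1.2.2))) < t.2.+1%:R^-1
  else set0.
pose T := (B `*` B) `*` [set: rat * rat] `*` [set: nat].
have [f fi] := elimT (countable_injP _) cB.
exists (N @` T).
  apply: sub_countable (card_image_le _ _) _; apply/countable_injP.
  exists (fun t => choice.pickle (f t.1.1.1, f t.1.1.2, t.1.2, t.2)).
  move=> [[[b1 b2] q] n] [[[b1' b2'] q'] n'] /set_mem[[[/= h1 h2] _] _]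
    /set_mem[[[/= h1' h2'] _] _] /(pcan_inj choice.pickleK) [e1 e2 -> ->].
  by rewrite (fi b1 b1' (mem_set h1) (mem_set h1') e1)
     (fi b2 b2' (mem_set h2) (mem_set h2') e2).
split=> [_ [[[[b1 b2] q] n] [[[/= h1 h2] _] _] <-]|y W].
  rewrite /N /=; have := chP b1; case: (ch b1) => [i|] bi; last exact: open0.
  have bb : b1 `&` b2 `<=` dom i by move=> x [/bi].
  exact (@cov_ball_open i _ _ _ (openI (Bo _ h1) (Bo _ h2)) bb).
move=> Wy.
have [D [oD Dy DW]] : exists D, [/\ open D, D y & D `<=` W].
  by move: Wy; rewrite nbhsE => -[D [oD Dy] DW]; exists D.
have [i0 di0] := mfd_cover hA (base y).
have nd : nbhs (base y) (dom i0).
  by apply: open_nbhs_nbhs; split => //; exact: mfd_dom_open.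
have [b1 [Bb1 b1y] b1d] := Bb (base y) _ nd.
have := chP b1; case E : (ch b1) => [i|] bi; last by case: bi; exists i0.
have di := bi _ b1y.
rewrite cot_openE in oD.
have /nbhs_rv2[e e0 eP] := oD i y Dy di.
have nb : nbhs (base y) [set x | dom i x /\ nm (crd i x - crd i (base y)) < e].
  have h1 : nbhs (base y) (dom i).
    by apply: open_nbhs_nbhs; split => //; exact: mfd_dom_open.
  have h2 : nbhs (crd i (base y)) [set w | nm (w - crd i (base y)) < e].
    by apply/nbhs_nm; exists e.
  have h3 : \forall x \near base y, nm (crd i x - crd i (base y)) < e.
    exact: (mfd_crd_continuous hA di h2).
  by apply: filterS2 h1 h3.
have [b2 [Bb2 b2y] b2d] := Bb (base y) _ nb.
have [n ne] : exists n : nat, n.+1%:R^-1 < e / 2.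
  have e2 : 0 < e / 2 by rewrite divr_gt0.
  exists (Num.truncn (e / 2)^-1); rewrite -[ltRHS]invrK ltf_pV2 ?posrE ?invr_gt0//.
  exact: truncnS_gt.
have n0 : 0 < n.+1%:R^-1 :> R by rewrite invr_gt0.
have [q qP] := rat_dense (cov y i) n0.
exists (N (b1, b2, q, n)).
  split; first by exists (b1, b2, q, n).
  by rewrite /N /= E; split=> //; rewrite nmBC.
rewrite /N /= E => y' [[b1y' b2y'] cy']; apply: DW.
have [di' xe] := b2d _ b2y'.
apply: (eP (cot_crd i y')) => //; rewrite /cot_crd ?pt20 ?pt21//.
have h4 := nm_triang (rc (ratr q.1) + 'i * rc (ratr q.2)) (cov y' i) (cov y i).
apply: le_lt_trans h4 _; rewrite -[ltRHS](divfK (_ : 2%:R != 0)) ?pnatr_eq0//.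
rewrite mulr_natr mulr2n; apply: ltrD; last exact: lt_trans ne.
exact: lt_trans cy' ne.
Qed.

Lemma cot_manifold : complex_manifold (cot_atlas A).
Proof.
split.
- exact: cot_hausdorff.
- exact: cot_countable.
- by move=> y; have [i di] := mfd_cover hA (base y); exists i.
- exact: cot_dom_open.
- exact: cot_crd_inj.
- exact: cot_crd_continuous.
- exact: cot_crd_open.
move=> j i y /= dj di.
have E : \forall p \near cot_crd i y,
    cot_tr i j p = rep (A := cot_atlas A) i (cot_crd j) p.
  have h := near_cot hA (cot_dom_open hA (i := j)) dj di.
  apply: filterS h => p [y' [dj' di' ->]].
  by rewrite (cot_trE hA)// /rep transportE//; exact: cot_crd_inj.
exact: (near_differentiable E (cot_tr_diff hA di dj)).
Qed.

Definition zero_cov x : cotangent A.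
Proof.
by apply: (@Cotangent R X A x (fun _ => 0)); split=> // i j _ _; rewrite mul0r.
Defined.

Definition scale_cov y (r : C) : cotangent A.
Proof.
apply: (@Cotangent R X A (base y) (fun i => r * cov y i)); split=> [i di|i j di dj].
  by rewrite (cov_out di) mulr0.
by rewrite trdE (cov_trans di dj) mulrA.
Defined.

Lemma zero_cov_continuous : continuous zero_cov.
Proof.
move=> x; have [i di] := mfd_cover hA x.
apply: (man_continuous cot_manifold (i := i)); first exact: di.
  by apply: open_nbhs_nbhs; split=> //; exact: (mfd_dom_open hA).
move=> N /= /nbhs_rv2[e e0 eP].
have h2 : nbhs (crd i x) [set w | nm (w - crd i x) < e].
  by apply/nbhs_nm; exists e.
have h3 : \forall z \near x, nm (crd i z - crd i x) < e.
  exact: (mfd_crd_continuous hA di h2).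
apply: filterS h3 => z hz; apply: eP; rewrite /= /cot_crd ?pt20 ?pt21//=.
by rewrite subrr nm0.
Qed.

Lemma scale_cov_continuous y : continuous (fun r : R => scale_cov y (rc r)).
Proof.
move=> r; have [i di] := mfd_cover hA (base y).
apply: (man_continuous cot_manifold (i := i)); first exact: di.
  by apply: filterE => s; exact: di.
move=> N /= /nbhs_rv2[e e0 eP].
have h2 : nbhs (0 + rc r * cov y i) [set w | nm (w - (rc r * cov y i)) < e].
  by rewrite add0r; apply/nbhs_nm; exists e.
have h3 : \forall s \near r, nm (0 + rc s * cov y i - rc r * cov y i) < e.
  exact: (@rc_affine_continuous R 0 (cov y i) r _ h2).
apply: filterS h3 => s; rewrite add0r => hs; apply: eP; rewrite /= /cot_crd ?pt20 ?pt21//=.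
by rewrite subrr nm0.
Qed.

(** Every covector is joined through its real multiples to the zero section, which is connected as a
    continuous image of [U]. *)
Lemma cot_over_connected (U : set X) : connected U -> connected (cot_over (A := A) U).
Proof.
move=> cU; have [[x Ux]|U0] := pselect (U !=set0); last first.
  suff -> : cot_over (A := A) U = set0 by exact: connected0.
  by apply/seteqP; split=> // y Uy; case: U0; exists (base y).
apply: (@star_connected _ _ (zero_cov x)) => y Uy.
exists (zero_cov @` U `|`
  (fun r : R => scale_cov y (rc r)) @` [set r | 0 <= r <= 1]); split.
- apply: connectedU.
  + exists (zero_cov (base y)); split; first by exists (base y).
    exists 0; first by rewrite /= lexx ler01.
    by apply: cot_eq => //=; apply/funext => i; rewrite /rc rmorph0 mul0r.
  + apply: connected_continuous_connected cU _.
    by apply: continuous_subspaceT => z; exact: zero_cov_continuous.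
  + exact (@path_connected R _ _ 0 1 (@scale_cov_continuous y)).
- by left; exists x.
- right; exists 1; first by rewrite /= lexx ler01.
  by apply: cot_eq => //=; apply/funext => i; rewrite /rc rmorph1 mul1r.
by move=> _ [[z Uz <-]|[r _ <-]].
Qed.

End CotangentManifold.

(** * The Liouville form in cotangent charts *)

Section Liouville.
Context {R : realType} {X : topologicalType}.
Local Notation C := (cplx R).
Local Notation V := 'rV[C]_2.
Local Notation om0 := (omega0 R).
Variable A : atlas C X.
Hypothesis hA : complex_manifold A.
Let hT := cot_manifold hA.
Implicit Types (i j k : idx A) (x : X) (y : cotangent A).

(** In dimension two a congruence multiplies an antisymmetric matrix by the determinant. *)
Lemma omega0_congr (J : 'M[C]_2) : J 0 0 * J 1 1 - J 0 1 * J 1 0 = 1 ->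
  J *m om0 *m J^T = om0.
Proof.
move: om0 (@omega0E R) => B entry dJ; apply/matrixP => a b.
rewrite !mxE !sum_I2 !mxE !sum_I2 !entry.
rewrite /= !(mulr1, mulr0, mul0r, subr0, sub0r, addr0, add0r, mulrN, mulNr).
case: (ord2P a) => ->; case: (ord2P b) => -> /=;
  rewrite ?(mulr1, mulr0, mul0r, subr0, sub0r, addr0, add0r); last by ring.
- ring.
- rewrite -dJ; ring.
- rewrite -dJ; ring.
Qed.

Lemma cot_near i (f g : cotangent A -> C) (h : V -> C) y : dom i (base y) ->
  (forall y', dom i (base y') -> f y' = h (cot_crd i y')) ->
  \forall p \near cot_crd i y, h p = rep (A := cot_atlas A) i f p.
Proof.
move=> di fh; have ho := near_cot hA (cot_dom_open hA (i := i)) di di.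
apply: filterS ho => p [y' [di' _ ->]].
have e := rep_crd hT (i := i) f di'; rewrite /= in e.
by rewrite e fh.
Qed.

Lemma cot_pderiv i (f : cotangent A -> C) (h : V -> C) y a : dom i (base y) ->
  (forall y', dom i (base y') -> f y' = h (cot_crd i y')) ->
  differentiable h (cot_crd i y) ->
  pderiv (A := cot_atlas A) i [:: a] f y = 'D_('e_a) h (cot_crd i y).
Proof.
move=> di fh dh; have E := cot_near f di fh.
exact: near_derive _ E dh.
Qed.

Lemma tautologicalE i y b : dom i (base y) ->
  tautological (A := A) i y 0 b = cov y i * (0 == b)%:R.
Proof.
move=> di; rewrite /tautological /grad.
have E : pderiv (A := cot_atlas A) i [:: b] (fun y' => crd (a := A) i (base y')) y =
    'D_('e_b) (fun p : V => p 0 0 : C) (cot_crd i y).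
  apply: cot_pderiv di _ (coord_diff _ _) => y' _.
  by rewrite /cot_crd pt20.
rewrite mxE mxE (etrans E (derive_coord _ _ _)).
by rewrite eq_sym.
Qed.

(** In a cotangent chart with coordinates x, p the tautological form is p dx, with exterior
    derivative dp /\ dx. Since it is constant, holomorphy and closedness are immediate. *)
Lemma liouvilleE i y : dom i (base y) -> liouville (A := A) i y = om0.
Proof.
move=> di; apply/matrixP => a b; rewrite omega0E mxE.
have E c d : pderiv (A := cot_atlas A) i [:: c]
    (fun y => tautological (A := A) i y 0 d) y = (c == 1)%:R * (d == 0)%:R.
  have fh y' : dom i (base y') -> tautological (A := A) i y' 0 d =
      (d == 0)%:R * (cot_crd i y' 0 1).
    by move=> di'; rewrite (tautologicalE _ di') /cot_crd pt21 mulrC eq_sym.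
  have dh : differentiable (fun p : V => (d == 0)%:R * (p 0 1 : C)) (cot_crd i y).
    exact: (diffZC _ (coord_diff _ _)).
  have e1 := cot_pderiv c di fh dh.
  have e2 := derive_ZC (d == 0)%:R 'e_c (coord_diff (cot_crd i y) 1).
  have e3 := derive_coord (cot_crd i y) 1 c.
  by rewrite (etrans e1 (etrans e2 (congr1 _ e3))) mulrC.
by rewrite !E; ring.
Qed.

Lemma delta_mul (J : 'M[C]_2) a b : J a b = (('e_a : V) *m J) 0 b.
Proof. by rewrite -rowE mxE. Qed.

(** The Jacobian is triangular, with the derivatives of two mutually inverse transitions on the
    diagonal. *)
Lemma cot_jacobian i j y : dom i (base y) -> dom j (base y) ->
  let J := jacobian (rep (A := cot_atlas A) i (cot_crd j)) (cot_crd i y) in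
  J 0 0 * J 1 1 - J 0 1 * J 1 0 = 1.
Proof.
move=> di dj J.
have [dt ds] := cot_tr_fib hA di dj.
have dJ := cot_tr_diff hA di dj.
have E : \forall p \near cot_crd i y,
    cot_tr i j p = rep (A := cot_atlas A) i (cot_crd j) p.
  have h := near_cot hA (cot_dom_open hA (i := j)) dj di.
  apply: filterS h => p [y' [dj' di' ->]].
  have e := rep_crd hT (i := i) (cot_crd j) di'; rewrite /= in e.
  by rewrite e (cot_trE hA di' dj').
have [dr _] := near_diff E dJ.
have JE a b : J a b = ('D_('e_a) (cot_tr i j) (cot_crd i y)) 0 b.
  have e1 := deriveEjacobian 'e_a dr.
  have e2 := near_derive 'e_a E dJ.
  exact: etrans (delta_mul J a b) (congr1 (fun v : V => v 0 b) (etrans (esym e1) e2)).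
have c0 : cot_crd i y 0 0 = crd i (base y) by rewrite /cot_crd pt20.
rewrite -c0 in dt; rewrite -c0 in ds.
have f0 := fibmap_derive0 dt ds.
have f1 := fibmap_derive1 dt ds.
have g0 b := etrans (JE 0 b) (congr1 (fun v : V => v 0 b) f0).
have g1 b := etrans (JE 1 b) (congr1 (fun v : V => v 0 b) f1).
rewrite !g0 !g1 !pt20 !pt21 mulr0 subr0.
have e3 := congr1 (derive1 (rep (A := A) j (crd i))) (rep_crd hA (crd j) di).
have e4 := etrans e3 (trdE j i (base y)).
exact: etrans (congr2 _ (trdE i j (base y)) e4) (trdV hA di dj).
Qed.

Lemma liouville_symplectic : symplectic_form (liouville (A := A)).
Proof.
have cst_holo i (f : cotangent A -> C) c :
    (forall y, dom i (base y) -> f y = c) ->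
    forall y, dom i (base y) ->
      differentiable (rep (A := cot_atlas A) i f) (cot_crd i y).
  move=> fc y di.
  apply: near_differentiable (cot_near (h := fun=> c) f di fc) _.
  exact: differentiable_cst.
split.
- move=> i j y di dj J; rewrite (liouvilleE di) (liouvilleE dj).
  by rewrite omega0_congr//; exact: cot_jacobian.
- move=> i a b; apply: (holo_chart hT) => y di; exists i => //.
  apply: (cst_holo i _ (om0 a b)) => // y' di'.
  by rewrite liouvilleE.
- by move=> i y di; rewrite liouvilleE// omega0_tr.
- move=> i y di; rewrite liouvilleE//.
  apply: (proj1 (mulmx1_unit (B := - om0) _)).
  by rewrite mulmxN omega0_sqr opprK.
move=> i y a b c di.
have E e d d' : pderiv (A := cot_atlas A) i [:: e]
    (fun y => liouville (A := A) i y d d') y = 0.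
  have fh y' : dom (a := A) i (base y') -> liouville (A := A) i y' d d' = om0 d d'.
    by move=> di'; rewrite liouvilleE.
  have e1 := cot_pderiv (h := fun=> om0 d d') e di fh (differentiable_cst _ _).
  exact: (etrans e1 (derive_cst0 _ _ _)).
by rewrite !E !addr0.
Qed.

Lemma liouville_manifold (U : set X) : open U -> connected U ->
  symplectic_manifold (liouville (A := A)) (cot_over U).
Proof.
move=> oU cU; split.
- exact: hT.
- exact: liouville_symplectic.
- exact: base_open.
- exact: cot_over_connected.
Qed.

End Liouville.

(** * Flat charts *)

Section FlatCharts.
Context {R : realType} {X : topologicalType}.
Local Notation C := (cplx R).
Variable A : atlas C X.
Hypothesis hA : complex_manifold A.
Variable b : X -> idx A -> C.
Hypothesis hb : holo_oneform b.
Implicit Types (i j : idx A) (x : X) (U W : set X) (f : X -> C).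

Lemma form_neq0 x i : nonvanishing b x -> dom i x -> b x i != 0.
Proof.
move=> bx di; apply/eqP => b0; apply: bx.
apply: (covec_eq (hb.1 x) _ di b0); split=> // j k _ _.
by rewrite mul0r.
Qed.

Lemma nonvanishing_chart x i : b x i != 0 -> nonvanishing b x.
Proof. by move=> b0 bx; move: b0; rewrite bx eqxx. Qed.

Lemma nonvanishing_open : open (nonvanishing b).
Proof.
rewrite openE => x bx; have [i di] := mfd_cover hA x.
have ct := holo_continuous hA (mfd_dom_open hA i) (hb.2 i) di.
have n0 := form_neq0 bx di.
have h1 : nbhs (b x i) [set w | nm (w - b x i) < nm (b x i)].
  by apply/nbhs_nm; exists (nm (b x i)) => //; rewrite nm_gt0.
have h2 : \forall z \near x, nm (b z i - b x i) < nm (b x i) := ct _ h1.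
rewrite /interior /=; apply: filterS h2 => z hz.
apply: (@nonvanishing_chart z i); apply/eqP => z0.
by rewrite z0 sub0r nmN ltxx in hz.
Qed.

Lemma form_trans x i j : dom i x -> dom j x -> b x i = b x j * trd i j x.
Proof. by move=> di dj; rewrite -trdE; exact: ((hb.1 x).2 i j di dj). Qed.

Section OneFlatChart.
Variables (U : set X) (f : X -> C).
Hypothesis fU : flat_chart b U f.

Let oU : open U. Proof. by case: fU. Qed.
Let hf : holo A U f. Proof. by case: fU => _ _ _ []. Qed.
Let injf y y' : U y -> U y' -> f y = f y' -> y = y'.
Proof. by case: fU => _ _ _ [_ inj _ _] _; exact: inj. Qed.

Lemma flat_neq0 x i : U x -> dom i x -> b x i != 0.
Proof. by case: fU => _ _ UX _ _ Ux di; exact: form_neq0 (UX _ Ux) di. Qed.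

Lemma flat_has_deriv x i : U x -> dom i x ->
  has_deriv (rep (A := A) i f) (b x i) (crd i x).
Proof.
move=> Ux di; apply/has_derivP; split; first exact: hf.
by case: fU => _ _ _ _ df; exact: df.
Qed.

Lemma flat_chart_image i W : open W ->
  (f @` (W `&` U `&` dom i)) =
  rep (A := A) i f @` (crd i @` (W `&` U `&` dom i)).
Proof.
move=> oW; apply/seteqP; split.
  move=> _ [x [Wx dx] <-]; exists (crd i x); first by exists x.
  by rewrite (rep_crd hA).
by move=> _ [_ [x [Wx dx] <-] <-]; exists x => //; rewrite (rep_crd hA).
Qed.

(** In a chart the derivative of [f] is the coefficient of the form, which has no zero on [U]; so
    [holo_open_map] applies. *)
Lemma flat_open i W : open W -> open (f @` (W `&` U `&` dom i)).
Proof.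
move=> oW; rewrite flat_chart_image//.
apply: holo_open_map.
- by apply: (open_chart hA); exact: openI.
- by move=> _ [x [[_ Ux] dx] <-]; exact: hf.
move=> _ [x [[_ Ux] dx] <-].
have [_ e] := proj1 (has_derivP _ _ _) (flat_has_deriv Ux dx).
by rewrite e; exact: flat_neq0.
Qed.

Lemma near_flat_base x i W : open W -> W x -> U x -> dom i x ->
  \forall c \near f x, exists x', [/\ W x', U x', dom i x' & c = f x'].
Proof.
move=> oW Wx Ux di; have : nbhs (f x) (f @` (W `&` U `&` dom i)).
  by apply: open_nbhs_nbhs; split; [exact: flat_open|exists x].
by apply: filterS => c [x' [[Wx' Ux'] dx'] <-]; exists x'.
Qed.

Lemma flat_inv i x : U x -> transport U f (crd (a := A) i) (f x) = crd i x.
Proof. by move=> Ux; rewrite transportE. Qed.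

Lemma flat_inv_deriv i x : U x -> dom i x ->
  has_deriv (transport U f (crd (a := A) i)) (b x i)^-1 (f x).
Proof.
move=> Ux di; have [_ e] := proj1 (has_derivP _ _ _) (flat_has_deriv Ux di).
have oO := open_chart hA i oU.
have Oc : (crd i @` (U `&` dom i)) (crd i x) by exists x.
have dO w : (crd (a := A) i @` (U `&` dom i)) w -> differentiable (rep (A := A) i f) w.
  exact: rep_holo hf w.
have n0 := flat_neq0 Ux di.
rewrite -e in n0.
have inv w : (crd (a := A) i @` (U `&` dom i)) w ->
    transport U f (crd (a := A) i) (rep (A := A) i f w) = w.
  by move=> [x' [Ux' di'] <-]; rewrite (rep_crd hA)// flat_inv.
have := inverse_deriv oO Oc dO n0 inv.
by rewrite e (rep_crd hA).
Qed.

End OneFlatChart.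

(** In a chart disc the coefficient of [b] has a primitive; its derivative is nonzero at the centre,
    so on a smaller disc it is injective and open. The rest carries this over from the disc to the
    surface and from the chart [i] to all others. *)
Lemma flat_chart_exists x : nonvanishing b x -> exists U f, U x /\ flat_chart b U f.
Proof.
move=> bx; have [i di] := mfd_cover hA x.
pose O := crd i @` (nonvanishing b `&` dom i).
have oO : open O by exact: (open_chart hA i nonvanishing_open).
pose h := rep (A := A) i (b ^~ i).
have dh w : O w -> differentiable h w.
  by move=> [y [_ dy] <-]; exact: (hb.2 i).
have Oz : O (crd i x) by exists x.
have [r r0 [F FP]] := local_primitive oO Oz dh.
have oD := @disc_open R (crd i x) r.
have Dz : [set w | nm (w - crd i x) < r] (crd i x) by rewrite /= subrr nm0.
have dF w : nm (w - crd i x) < r -> differentiable F w /\ derive1 F w = h w.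
  by move=> /FP[_ /has_derivP].
have n0 : derive1 F (crd i x) != 0.
  by rewrite (dF _ Dz).2 /h (rep_crd hA)// form_neq0.
have [s s0 [sD lin]] := near_linear oD Dz (fun w Dw => (dF w Dw).1) n0.
have injF := near_linear_inj n0 lin.
pose D := [set w : C | nm (w - crd i x) < s].
have DO w : D w -> O w by move=> /sD[/FP[]].
pose U := [set y | dom i y /\ D (crd i y)].
have oU : open U.
  rewrite openE => y [dy Dy]; rewrite /interior /=.
  have h1 : nbhs y (dom i) by apply: open_nbhs_nbhs; split => //; exact: mfd_dom_open.
  have h2 : nbhs (crd i y) D.
    by apply: open_nbhs_nbhs; split=> //; exact: disc_open.
  have h3 : \forall z \near y, D (crd i z) := mfd_crd_continuous hA dy h2.
  by apply: filterS2 h1 h3.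
have UD w : D w -> exists y, [/\ U y, nonvanishing b y & crd i y = w].
  by move=> Dw; have [y [by_ dy] yw] := DO _ Dw; exists y; split=> //; split=> //; rewrite yw.
have UX : U `<=` nonvanishing b.
  move=> y [dy Dy]; have [y' [[dy' _] by' e]] := UD _ Dy.
  by rewrite -(mfd_crd_inj hA dy' dy e).
(* [crd i] maps [U] homeomorphically onto the disc [D], so a relatively open and closed part of [U]
   becomes one of [D], hence everything. *)
have cU : connected U.
  move=> B [y By] [C1 oC1 BE1] [C2 cC2 BE2].
  have subi : crd i @` B = D `&` crd i @` (U `&` C1).
    apply/seteqP; split=> [_ [z Bz <-]|_ [_ [z Uz <-]]].
      by move: (Bz); rewrite BE1 => -[[dz Dz'] Cz]; split=> //; exists z => //; split.
    by exists z => //; rewrite BE1.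
  have subc : crd i @` B = D `&` ~` (crd i @` (U `&` ~` C2)).
    apply/seteqP; split=> [_ [z Bz <-]|w [Dw nw]].
      move: (Bz); rewrite BE2 => -[[dz Dz'] Cz]; split=> //.
      move=> [z' [[dz' Dz''] nC] e]; apply: nC.
      by rewrite (mfd_crd_inj hA dz' dz e).
    have [z [Uz _ zw]] := UD _ Dw; exists z => //; rewrite BE2; split=> //.
    by apply: contrapT => nC; apply: nw; exists z.
  have oI (C' : set X) : open C' -> open (crd i @` (U `&` C')).
    move=> oC'; apply: (mfd_crd_open hA); first exact: openI.
    by move=> z [[]].
  have BD : crd i @` B = D.
    apply: (disc_connected (z := crd i x) (r := s)).
    - by exists (crd i y); exists y.
    - by exists (crd i @` (U `&` C1)) => //; exact: oI.
    exists (~` (crd i @` (U `&` ~` C2))) => //.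
    by apply: open_closedC; apply: oI; exact: closed_openC.
  apply/seteqP; split=> z; first by rewrite BE1 => -[].
  move=> [dz Dz']; have : (crd i @` B) (crd i z) by rewrite BD.
  move=> [z' Bz' e]; have dz' : dom i z' by move: (Bz'); rewrite BE1 => -[[]].
  by rewrite -(mfd_crd_inj hA dz' dz e).
pose f := fun y => F (crd i y).
have fnear y : U y -> \forall w \near crd i y, F w = rep (A := A) i f w.
  move=> [dy Dy]; apply: filterS (near_chart hA (mfd_dom_open hA i) dy dy) => w.
  by move=> [z [dz _ ->]]; rewrite (rep_crd hA).
have dfi y : U y -> has_deriv (rep (A := A) i f) (b y i) (crd i y).
  move=> Uy; have [dy Dy] := Uy; apply/has_derivP.
  have [dFy eF] := dF _ (sD _ Dy).1.
  have [df Ef] := near_diff (fnear y Uy) dFy.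
  split; first exact: df.
  have e1 := diff1C 1 df; have e2 := diff1C 1 dFy.
  have e3 := congr1 (fun G : C -> C => G 1) Ef.
  have e4 := etrans (esym e1) (etrans e3 e2).
  have e5 : h (crd i y) = b y i by rewrite /h (rep_crd hA).
  have e6 := etrans e4 (congr1 (fun u : C => 1 * u) (etrans eF e5)).
  move: e6; move: (derive1 _ _) (b y i) => u v {e1 e2 e3 e4 e5 Ef df dFy eF}.
  by rewrite !mul1r.
have hfU : holo A U f.
  apply: (holo_chart hA) => y Uy; exists i; first by case: Uy.
  by have [] := proj1 (has_derivP _ _ _) (dfi y Uy).
(* An embedding is tested in every chart [j]. The chain rule multiplies by the transition factor
   that also relates the coefficients of the form. *)
have dfj j y : U y -> dom j y -> forall v,
    'd (rep (A := A) j f) (crd j y) v = v * b y j.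
  move=> Uy dj v; have [dy _] := Uy.
  have [d1 d2] := proj1 (has_derivP _ _ _) (dfi y Uy).
  have [d3 d4] := diff_trans hA dy dj d1.
  have e1 := d4 v.
  have e2 := diff1C v (mfd_crd_holo hA (j := i) dy dj).
  have e3 := diff1C ('d (rep (A := A) j (crd i)) (crd j y) v) d1.
  have e4 := etrans e3 (congr2 *%R (etrans e2 (congr1 (fun u => v * u) (trdE j i y))) d2).
  have e5 : v * trd j i y * b y i = v * b y j.
    have e6 := form_trans dj dy.
    by rewrite e6; move: (trd j i y) (b y i) => p q; ring.
  exact: etrans e1 (etrans e4 e5).
exists U, f; split; first by split=> //; rewrite /D /= subrr nm0.
split=> //; last first.
  move=> j y Uy dj; have e1 := dfj j y Uy dj 1.
  have e2 := diff1C 1 (hfU j y Uy dj).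
  have e3 := etrans (esym e2) e1.
  move: e3; move: (derive1 _ _) (b y j) => u v {e1 e2}.
  by rewrite !mul1r.
split=> //.
- move=> y y' [dy Dy] [dy' Dy'] e; apply: (mfd_crd_inj hA dy dy').
  exact: injF Dy Dy' e.
- move=> j y Uy dj u v e.
  have e1 := etrans (esym (dfj j y Uy dj u)) (etrans e (dfj j y Uy dj v)).
  exact: (mulIf (form_neq0 (UX _ Uy) dj) e1).
move=> W oW WU; exists (f @` W); last first.
  by apply/seteqP; split=> [z [y Wy <-]|z []//]; split; exists y => //; exact: WU.
have -> : f @` W = F @` (crd i @` W).
  apply/seteqP; split=> [_ [y Wy <-]|_ [_ [y Wy <-] <-]]; last by exists y.
  by exists (crd i y) => //; exists y.
have WD w : (crd i @` W) w -> D w by move=> [y /WU[_ Dy] <-].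
apply: holo_open_map.
- by apply: (mfd_crd_open hA) => // y /WU[].
- by move=> w /WD /sD[/dF[]].
by move=> w /WD /sD[_].
Qed.

End FlatCharts.

(** * The flat map as a holomorphic embedding into C^2 *)

Section FlatMap.
Context {R : realType} {X : topologicalType}.
Local Notation C := (cplx R).
Local Notation V := 'rV[C]_2.
Variable A : atlas C X.
Hypothesis hA : complex_manifold A.
Variable b : X -> idx A -> C.
Hypothesis hb : holo_oneform b.
Let hT := cot_manifold hA.
Implicit Types (i j : idx A) (x : X) (y : cotangent A) (W : set (cotangent A)).

(** The coefficients of [y] and of the form transform by the same factor, so their quotient is the
    same in all charts. *)
Lemma fibre_crdE y i : nonvanishing b (base y) -> dom i (base y) ->
  fibre_crd b y = cov y i / b (base y) i.
Proof.
move=> by_ di; have b0 := form_neq0 hb by_ di.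
rewrite /fibre_crd; case: xgetP => [l _ /= e|/(_ (cov y i / b (base y) i))[]].
  by rewrite e mulfK.
apply: (covec_eq (cotP y) _ di); last by rewrite divfK.
split=> [j dj|j k dj dk].
  by rewrite ((hb.1 (base y)).1 j dj) mulr0.
by rewrite trdE (form_trans hb dj dk) mulrA.
Qed.

Local Notation bb i := (rep (A := A) i (b ^~ i)).

Lemma form_rep_diff i x : dom i x -> differentiable (bb i) (crd i x).
Proof. by move=> di; exact: (hb.2 i i x di di). Qed.

Section OneFlatMap.
Variables (U : set X) (f : X -> C).
Hypothesis fU : flat_chart b U f.
Local Notation F := (flat_map b f).

Let oU : open U. Proof. by case: fU. Qed.
Let UX : U `<=` nonvanishing b. Proof. by case: fU. Qed.
Let injf x x' : U x -> U x' -> f x = f x' -> x = x'.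
Proof. by case: fU => _ _ _ [_ inj _ _] _; exact: inj. Qed.

Lemma flat_mapE y i : U (base y) -> dom i (base y) ->
  F y = fibmap (rep (A := A) i f) (fun q => (bb i q)^-1) (cot_crd i y).
Proof.
move=> Uy di; rewrite /flat_map /fibmap (fibre_crdE (UX Uy) di) /cot_crd.
by rewrite pt20 pt21 !(rep_crd hA).
Qed.

Lemma flat_map0 y : F y 0 0 = f (base y).
Proof. by rewrite /flat_map pt20. Qed.

Lemma flat_map1 y i : U (base y) -> dom i (base y) ->
  F y 0 1 = cov y i / b (base y) i.
Proof. by move=> Uy di; rewrite /flat_map pt21 (fibre_crdE (UX Uy) di). Qed.

Lemma flat_map_inj y y' : U (base y) -> U (base y') -> F y = F y' -> y = y'.
Proof.
move=> Uy Uy' e; have e0 : base y = base y'.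
  by apply: injf => //; rewrite -!flat_map0 e.
have [i di] := mfd_cover hA (base y).
have di' : dom i (base y') by rewrite -e0.
apply: (cot_eq_chart di e0).
have b0 := flat_neq0 hb fU Uy di.
apply: (mulIf (invr_neq0 b0)).
by rewrite -(flat_map1 Uy di) e (flat_map1 Uy' di') e0.
Qed.

(** The inverse of the flat map read in the chart [i]: the second coordinate is turned back into a
    coefficient by multiplying with the coefficient of the form at the recovered base point. *)
Definition flat_inverse i : V -> V :=
  fibmap (transport U f (crd (a := A) i))
    (fun c => bb i (transport U f (crd (a := A) i) c)).

Lemma flat_inverseE y i : U (base y) -> dom i (base y) ->
  flat_inverse i (F y) = cot_crd i y.
Proof.
move=> Uy di; rewrite /flat_inverse /fibmap (flat_map1 Uy di) flat_map0.
have b0 := flat_neq0 hb fU Uy di.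
by rewrite (flat_inv fU i Uy) (rep_crd hA)// (divfK b0).
Qed.

Lemma flat_inverse_fib y i : U (base y) -> dom i (base y) ->
  [/\ differentiable (transport U f (crd (a := A) i)) (F y 0 0),
      differentiable (fun c => bb i (transport U f (crd (a := A) i) c)) (F y 0 0),
      derive1 (transport U f (crd (a := A) i)) (F y 0 0) = (b (base y) i)^-1 &
      derive1 (fun c => bb i (transport U f (crd (a := A) i) c)) (F y 0 0) =
        (b (base y) i)^-1 * derive1 (bb i) (crd i (base y))].
Proof.
move=> Uy di; rewrite flat_map0.
have [d1 e1] := proj1 (has_derivP _ _ _) (flat_inv_deriv hA hb fU Uy di).
have ei := flat_inv fU i Uy.
have d2 : differentiable (bb i) (transport U f (crd (a := A) i) (f (base y))).
  by rewrite ei; exact: form_rep_diff.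
have d3 := differentiable_comp d1 d2.
split; [exact: d1|exact: d3|exact: e1|].
have s1 := diff1C 1 d3.
have s2 := congr1 (fun G : C -> C => G 1) (diff_comp d1 d2).
have s3 := diff1C ('d (transport U f (crd (a := A) i)) (f (base y)) 1) d2.
have s4 := etrans (diff1C 1 d1) (congr1 (fun u : C => 1 * u) e1).
have s5 := congr2 *%R s4 (congr1 (derive1 (bb i)) ei).
have s6 := etrans (esym s1) (etrans s2 (etrans s3 s5)).
move: s6; move: (derive1 _ _) (derive1 _ _) => u v {s1 s2 s3 s4 s5 d1 d2 d3 e1 ei}.
by rewrite !mul1r.
Qed.

Lemma flat_inverse_diff y i : U (base y) -> dom i (base y) ->
  differentiable (flat_inverse i) (F y).
Proof.
by move=> Uy di; have [d1 d2 _ _] := flat_inverse_fib Uy di; exact: fibmap_diff.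
Qed.

(** Preimages exist because [f] is open on the base and the fibre contains the covector with
    coefficient [p 0 1 * b x i]; continuity of [flat_inverse i] keeps them in [W]. *)
Lemma near_flat W y i : open W -> W y -> U (base y) -> dom i (base y) ->
  \forall p \near F y,
    exists y', [/\ W y', U (base y'), dom i (base y') & p = F y'].
Proof.
move=> oW Wy Uy di; have Wy' := oW; rewrite cot_openE in Wy'.
have h1 := Wy' i y Wy di.
have ct := differentiable_continuous (flat_inverse_diff Uy di).
have ei := flat_inverseE Uy di.
have h2 : \forall p \near F y, forall y', dom i (base y') ->
    cot_crd i y' = flat_inverse i p -> W y'.
  rewrite -ei in h1; exact: (ct _ h1).
have h3 : \forall p \near F y,
    exists x', [/\ U x', dom i x' & (p : V) 0 0 = f x'].
  have h4 := near_flat_base hA hb fU (mfd_dom_open hA i) di Uy di.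
  have /nbhs_nm[e e0 eP] := h4.
  apply/nbhs_rv2; exists e => // p; rewrite flat_map0 => p0 _.
  by have [x' [_ Ux' dx' e']] := eP _ p0; exists x'.
apply: filterS2 h2 h3 => p Wp [x [Ux dx p0]].
have [y' [y'x y'c]] := cot_exists hA (p 0 1 * b x i) dx.
have Uy' : U (base y') by rewrite y'x.
have dy' : dom i (base y') by rewrite y'x.
have e1 : p = F y'.
  rewrite (pt2_eta p) (pt2_eta (F y')) flat_map0 (flat_map1 Uy' dy') y'c y'x p0.
  by rewrite (mulfK (flat_neq0 hb fU Ux dx)).
exists y'; split=> //; apply: Wp => //.
by rewrite e1 flat_inverseE.
Qed.

Lemma flat_map_open W : open W -> W `<=` cot_over U -> open (F @` W).
Proof.
move=> oW WU; rewrite openE => _ [y Wy <-].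
have [i di] := mfd_cover hA (base y).
rewrite /interior /=; apply: filterS (near_flat oW Wy (WU _ Wy) di) => p.
by move=> [y' [Wy' _ _ ->]]; exists y'.
Qed.

Lemma flat_map_fib y i : U (base y) -> dom i (base y) ->
  differentiable (rep (A := A) i f) (cot_crd i y 0 0) /\
  differentiable (fun q => (bb i q)^-1) (cot_crd i y 0 0).
Proof.
move=> Uy di; rewrite /cot_crd pt20.
have [d1 _] := proj1 (has_derivP _ _ _) (flat_has_deriv fU Uy di).
have d2 := form_rep_diff di.
have n0 : bb i (crd i (base y)) != 0.
  by rewrite (rep_crd hA)//; exact (flat_neq0 hb fU Uy di).
split; first exact: d1.
exact: (differentiableV d2 n0).
Qed.

Lemma flat_map_near y i : U (base y) -> dom i (base y) ->
  \forall p \near cot_crd i y,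
    fibmap (rep (A := A) i f) (fun q => (bb i q)^-1) p =
    rep (A := cot_atlas A) i F p.
Proof.
move=> Uy di; have h := near_cot hA (base_open hA oU) Uy di.
apply: filterS h => p [y' [Uy' di' ->]].
have e := rep_crd hT (i := i) F di'; rewrite /= in e.
by rewrite e (flat_mapE Uy' di').
Qed.

Lemma flat_map_holo : holo (cot_atlas A) (cot_over U) F.
Proof.
move=> i y Uy di; have [d1 d2] := flat_map_fib Uy di.
exact: near_differentiable (flat_map_near Uy di) (fibmap_diff d1 d2).
Qed.

Lemma flat_map_embedding : holo_embedding (cot_atlas A) (cot_over U) F.
Proof.
split.
- exact: flat_map_holo.
- exact: flat_map_inj.
- move=> i y Uy di h h' hh.
  have er : rep (A := cot_atlas A) i F (cot_crd i y) = F y.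
    exact: (rep_crd hT (i := i) F di).
  have dF := flat_map_holo Uy di.
  have dG : differentiable (flat_inverse i) (rep (A := cot_atlas A) i F (cot_crd i y)).
    by rewrite er; exact: flat_inverse_diff.
  (* A differentiable left inverse in the chart makes the differential of the flat map injective. *)
  have E : \forall p \near cot_crd i y,
      (flat_inverse i \o rep (A := cot_atlas A) i F) p = p.
    have h1 := near_cot hA (base_open hA oU) Uy di.
    apply: filterS h1 => p [y' [Uy' di' ->]] /=.
    have e := rep_crd hT (i := i) F di'; rewrite /= in e.
    by rewrite e flat_inverseE.
  have [_ E1] := near_diff E (differentiable_comp dF dG).
  have E2 := diff_comp dF dG.
  have E3 := @diff_val _ _ _ _ _ _ _ (is_diff_id (cot_crd i y)).
  have id_d v : 'd (flat_inverse i) (rep (A := cot_atlas A) i F (cot_crd i y))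
      ('d (rep (A := cot_atlas A) i F) (cot_crd i y) v) = v.
    have s1 := congr1 (fun G : V -> V => G v) E2.
    have s2 := congr1 (fun G : V -> V => G v) E1.
    have s3 := congr1 (fun G : V -> V => G v) E3.
    exact: etrans (esym s1) (etrans (esym s2) s3).
  exact: etrans (esym (id_d h)) (etrans (congr1 _ hh) (id_d h')).
move=> W oW WU; exists (F @` W); first exact: flat_map_open.
by apply/seteqP; split=> [z [y Wy <-]|z []//]; split; exists y => //; exact: WU.
Qed.

End OneFlatMap.
End FlatMap.

(** * The star product in an arbitrary chart *)

Section UniversalPolynomial.
Context {R : realType} {X : topologicalType}.
Local Notation C := (cplx R).
Local Notation V := 'rV[C]_2.
Local Notation om0 := (omega0 R).
Variable A : atlas C X.
Hypothesis hA : complex_manifold A.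
Variable b : X -> idx A -> C.
Hypothesis hb : holo_oneform b.
Let hT := cot_manifold hA.
Implicit Types (i j : idx A) (x : X) (y : cotangent A) (W : set (cotangent A)).
Local Notation bb i := (rep (A := A) i (b ^~ i)).
Local Notation X0 := (nonvanishing b).

Definition cot_image i W : set V := cot_crd i @` (W `&` (fun y => dom i (base y))).

Lemma cot_image_open i W : open W -> open (cot_image i W).
Proof. exact: (open_chart hT i). Qed.

Lemma cot_rep_holo i (h : cotangent A -> C) W : holo (cot_atlas A) W h ->
  holo_on (cot_image i W) (rep (A := cot_atlas A) i h).
Proof. by move=> hh q Wq; exact: rep_holo hh q Wq. Qed.

(* The coordinate fields of a flat chart are cA 0 d_x + cB 0 d_p and
   cA 1 d_x + cB 1 d_p in the chart i = (x, p) of the cotangent bundle. *)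
Definition cA i (a : 'I_2) (q : V) : C :=
  if a == 0 then (bb i (q 0 0))^-1 else 0.

Definition cB i (a : 'I_2) (q : V) : C :=
  if a == 0 then q 0 1 * (derive1 (bb i) (q 0 0) * (bb i (q 0 0))^-1 ^+ 2)
  else bb i (q 0 0).

Definition delta i (a : 'I_2) (h : V -> C) (q : V) : C :=
  cA i a q * 'D_('e_0) h q + cB i a q * 'D_('e_1) h q.

Let Q i := cot_image i (cot_over X0).

Let oQ i : open (Q i).
Proof. exact: (@cot_image_open i _ (base_open hA (nonvanishing_open hA hb))). Qed.

Lemma form_diff_on i q : Q i q ->
  [/\ differentiable (fun q : V => bb i (q 0 0)) q, bb i (q 0 0) != 0 &
      differentiable (fun q : V => derive1 (bb i) (q 0 0)) q].
Proof.
move=> [y [Xy di] <-]; have c0 : cot_crd i y 0 0 = crd i (base y).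
  by rewrite /cot_crd pt20.
have d1 : differentiable (bb i) (cot_crd i y 0 0).
  by rewrite c0; exact: (form_rep_diff hb di).
have oO : open (crd i @` (dom i `&` dom i)).
  exact: (open_chart hA i (mfd_dom_open hA i)).
have d2 : differentiable (derive1 (bb i)) (cot_crd i y 0 0).
  rewrite c0; apply: (derive1_holo oO); first by exists (base y).
  by move=> _ [x' [dx' _] <-]; exact: (form_rep_diff hb dx').
split; first exact: (comp_coord_diff d1).
  by rewrite c0 (rep_crd hA)//; exact (form_neq0 hb Xy di).
exact: (comp_coord_diff d2).
Qed.

Lemma cA_holo i a : holo_on (Q i) (cA i a).
Proof.
move=> q Qq; have [d1 n0 _] := form_diff_on Qq.
rewrite /cA; case: (ord2P a) => -> /=; last exact: differentiable_cst.
exact: (differentiableV d1 n0).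
Qed.

Lemma cB_holo i a : holo_on (Q i) (cB i a).
Proof.
move=> q Qq; have [d1 n0 d2] := form_diff_on Qq.
rewrite /cB; case: (ord2P a) => -> /=; last exact: d1.
have d3 := differentiableV d1 n0.
exact: (diffMC (coord_diff q 1) (diffMC d2 (diffMC d3 d3))).
Qed.

Lemma delta_holo i a h (O : set V) : open O -> O `<=` Q i -> holo_on O h ->
  holo_on O (delta i a h).
Proof.
move=> oO OQ hh q Oq.
have d0 := dword_holo [:: 0] oO hh Oq; have d1 := dword_holo [:: 1] oO hh Oq.
exact: (diffDC (diffMC (cA_holo a (OQ _ Oq)) d0)
  (diffMC (cB_holo a (OQ _ Oq)) d1)).
Qed.

(** A coefficient carries its proof of holomorphy, because the next step of [dcoef] differentiates
    it. *)
Let coef i := {c : V -> C | holo_on (Q i) c}.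

Let coef_one i : coef i := exist _ _ (@holo_cst R 1 (Q i)).

Let coef_mul i (c : coef i) (d : V -> C) (hd : holo_on (Q i) d) : coef i :=
  exist (holo_on (Q i)) (fun q => sval c q * d q)
    (fun q Qq => diffMC (svalP c q Qq) (hd q Qq)).

Let coef_delta i a (c : coef i) : coef i :=
  exist (holo_on (Q i)) _ (@delta_holo i a _ _ (@oQ i) (fun _ h => h) (svalP c)).

(** Expands a word in the coordinate fields of a flat chart into words in d_x and d_p. A further
    field either differentiates the coefficient or adds one of the two letters, hence three terms.
    Only the form enters, not a primitive of it. *)
Fixpoint dcoef i (w : seq 'I_2) : seq (coef i * seq 'I_2) :=
  if w is a :: w then
    flatten [seq [:: (coef_delta a t.1, t.2);
                     (coef_mul t.1 (@cA_holo i a), 0 :: t.2);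
                     (coef_mul t.1 (@cB_holo i a), 1 :: t.2)] | t <- dcoef i w]
  else [:: (coef_one i, [::])].

Lemma derive_list (I : Type) (s : seq I) (F : I -> V -> C) (v q : V) :
  (forall t, differentiable (F t) q) ->
  differentiable (fun q => \sum_(t <- s) F t q) q /\
  'D_v (fun q => \sum_(t <- s) F t q) q = \sum_(t <- s) 'D_v (F t) q.
Proof.
move=> dF; elim: s => [|t s [IH1 IH2]].
  have -> : (fun q => \sum_(t <- [::]) F t q) = cst 0.
    by apply/funext => z; rewrite big_nil.
  by split; [exact: differentiable_cst|rewrite big_nil; exact: derive_cst0].
have -> : (fun q => \sum_(t <- t :: s) F t q) =
    (fun q => F t q + \sum_(t <- s) F t q).
  by apply/funext => z; rewrite big_cons.
split; first exact: (diffDC (dF t) IH1).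
rewrite big_cons; exact: etrans (derive_DC v (dF t) IH1) (congr1 _ IH2).
Qed.

Lemma dcoefE i w h (O : set V) q : open O -> O `<=` Q i -> holo_on O h -> O q ->
  foldr (delta i) h w q =
  \sum_(t <- dcoef i w) sval t.1 q * dword t.2 h q.
Proof.
move=> oO OQ hh; elim: w q => [|a w IH] q Oq /=.
  by rewrite big_seq1 /= mul1r.
have hw : holo_on O (foldr (delta i) h w).
  by elim: (w) => [|c w' IHw]; [exact: hh|exact: delta_holo].
pose G (t : coef i * seq 'I_2) (q : V) : C := sval t.1 q * dword t.2 h q.
have dG t : differentiable (G t) q.
  exact: (diffMC (svalP t.1 q (OQ _ Oq)) (dword_holo t.2 oO hh Oq)).
have DG (c : 'I_2) : 'D_('e_c) (foldr (delta i) h w) q =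
    \sum_(t <- dcoef i w) ('D_('e_c) (sval t.1) q * dword t.2 h q +
      sval t.1 q * dword (c :: t.2) h q).
  have e1 := near_derive_on c oO hw IH Oq.
  have [_ e2] := derive_list (dcoef i w) 'e_c dG.
  rewrite -[LHS]e1 [LHS]e2; apply: eq_bigr => t _.
  exact: (derive_MC 'e_c (svalP t.1 q (OQ _ Oq)) (dword_holo t.2 oO hh Oq)).
rewrite /delta !DG big_flatten big_map !mulr_sumr -big_split /=.
apply: eq_bigr => t _; rewrite !big_cons big_nil /= /delta.
move: ('D_('e_0) (sval t.1) q) ('D_('e_1) (sval t.1) q) (sval t.1 q)
  (cA i a q) (cB i a q) (dword t.2 h q) ('D_('e_0) (dword t.2 h) q)
  ('D_('e_1) (dword t.2 h) q) => p1 p2 p3 p4 p5 p6 p7 p8 {DG dG}.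
ring.
Qed.

(* The k-th bidifferential operator of the Moyal-Weyl product of any flat chart. *)
Definition ucoef i k (u v : cotangent A -> C) y : C :=
  \sum_(t <- mlist k) \sum_(c <- dcoef i t.1.2) \sum_(d <- dcoef i t.2)
    (kap k * t.1.1 * sval c.1 (cot_crd i y) * sval d.1 (cot_crd i y))
    * pderiv (A := cot_atlas A) i c.2 u y * pderiv (A := cot_atlas A) i d.2 v y.

Definition umoyal i (u v : nat -> cotangent A -> C) m y : C :=
  \sum_(k < m.+1) \sum_(k1 < m.+1) \sum_(k2 < m.+1 | (k + k1 + k2 == m)%N)
    ucoef i k (u k1) (v k2) y.

Section FlatPullback.
Variables (U : set X) (f : X -> C).
Hypothesis fU : flat_chart b U f.
Local Notation F := (flat_map b f).

Let UX : U `<=` X0. Proof. by case: fU. Qed.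

Lemma flat_transport W (u : cotangent A -> C) y : W `<=` cot_over U -> W y ->
  transport W F u (F y) = u y.
Proof.
move=> WU Wy; apply: transportE => // z z' Wz Wz'.
exact: (flat_map_inj hA hb fU (WU _ Wz) (WU _ Wz')).
Qed.

(** Chain rule for [h] composed with the inverse flat map, whose derivative in the direction ['e_a]
    has the components [cA i a] and [cB i a]. The primitive [f] enters this derivative only through
    the form. *)
Lemma flat_delta i W (H h : V -> C) y a : open W -> W `<=` cot_over U ->
  (forall y', W y' -> dom i (base y') -> H (F y') = h (cot_crd i y')) ->
  W y -> dom i (base y) -> differentiable h (cot_crd i y) ->
  differentiable H (F y) /\ 'D_('e_a) H (F y) = delta i a h (cot_crd i y).
Proof.
move=> oW WU Hh Wy di dh; have Uy := WU _ Wy.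
have ei := flat_inverseE hA hb fU Uy di.
have dG := flat_inverse_diff hA hb fU Uy di.
have dh' : differentiable h (flat_inverse b U f i (F y)) by rewrite ei.
have E : \forall p \near F y, (h \o flat_inverse b U f i) p = H p.
  apply: filterS (near_flat hA hb fU oW Wy Uy di) => p.
  move=> [y' [Wy' Uy' di' ->]] /=.
  by rewrite (flat_inverseE hA hb fU Uy' di') Hh.
have dc := differentiable_comp dG dh'.
split; first exact: near_differentiable E dc.
have e1 := near_derive 'e_a E dc.
have e2 := deriveE 'e_a dc.
have e3 := congr1 (fun K : V -> C => K 'e_a) (diff_comp dG dh').
have e4 := diff2E ('d (flat_inverse b U f i) (F y) 'e_a) dh'.
have e5 := etrans e1 (etrans e2 (etrans e3 e4)).
have e6 := deriveE 'e_a dG.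
have [d1 d2 s1 s2] := flat_inverse_fib hA hb fU Uy di.
have f0 := fibmap_derive0 d1 d2; have f1 := fibmap_derive1 d1 d2.
have di' := di.
have b1 : bb i (cot_crd i y 0 0) = b (base y) i.
  by rewrite /cot_crd pt20 (rep_crd hA).
have eqA : ('D_('e_a) (flat_inverse b U f i) (F y)) 0 0 = cA i a (cot_crd i y).
  rewrite /cA; case: (ord2P a) => ->.
    have g := congr1 (fun v : V => v 0 0) f0.
    by rewrite [LHS]g pt20 [LHS]s1 /= b1.
  have g := congr1 (fun v : V => v 0 0) f1.
  by rewrite [LHS]g pt20.
have eqB : ('D_('e_a) (flat_inverse b U f i) (F y)) 0 1 = cB i a (cot_crd i y).
  rewrite /cB; case: (ord2P a) => ->.
    have g := congr1 (fun v : V => v 0 1) f0.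
    rewrite [LHS]g pt21 s2 (flat_map1 hb fU Uy di) /= b1 /cot_crd pt20 pt21.
    by move: (derive1 _ _) (cov y i) (b _ _)^-1 => p q r {g}; ring.
  have g := congr1 (fun v : V => v 0 1) f1.
  by rewrite [LHS]g pt21 flat_map0 (flat_inv fU i Uy) /cot_crd pt20.
have r0 := etrans (congr1 (fun v : V => v 0 0) (esym e6)) eqA.
have r1 := etrans (congr1 (fun v : V => v 0 1) (esym e6)) eqB.
rewrite ei in e5.
have bilin (p q p' q' r s : C) : p = p' -> q = q' -> p * r + q * s = p' * r + q' * s.
  by move=> -> ->.
have e7 := bilin _ _ _ _ ('D_('e_0) h (cot_crd i y)) ('D_('e_1) h (cot_crd i y)) r0 r1.
have e8 := etrans e5 e7.
exact: e8.
Qed.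

Lemma transport_near W (u : cotangent A -> C) i y : W `<=` cot_over U -> W y ->
  dom i (base y) ->
  transport W F u (F y) = rep (A := cot_atlas A) i u (cot_crd i y).
Proof.
move=> WU Wy di; rewrite (flat_transport u WU Wy).
exact: esym (rep_crd hT (i := i) u di).
Qed.

Lemma flat_transport_holo W (u : cotangent A -> C) : open W ->
  W `<=` cot_over U -> holo (cot_atlas A) W u ->
  holo_on (F @` W) (transport W F u).
Proof.
move=> oW WU hu _ [y Wy <-]; have [i di] := mfd_cover hA (base y).
have Hh y' (Wy' : W y') (di' : dom i (base y')) := transport_near u WU Wy' di'.
by have [] := flat_delta 0 oW WU Hh Wy di (hu i y Wy di).
Qed.

(** The induction runs over all points of [W] at once, since [flat_delta] asks for an equality of
    functions and not of values. *)
Lemma flat_dword i W (u : cotangent A -> C) w : open W -> W `<=` cot_over U ->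
  holo (cot_atlas A) W u -> forall y, W y -> dom i (base y) ->
  dword w (transport W F u) (F y) =
  foldr (delta i) (rep (A := cot_atlas A) i u) w (cot_crd i y).
Proof.
move=> oW WU hu; have oO := cot_image_open (i := i) oW.
have OQ : cot_image i W `<=` Q i.
  by move=> _ [y [Wy dy] <-]; exists y => //; split=> //; exact: (UX (WU _ Wy)).
have hh := cot_rep_holo (i := i) hu.
have hw w' : holo_on (cot_image i W)
    (foldr (delta i) (rep (A := cot_atlas A) i u) w').
  by elim: w' => [|c w' IHw]; [exact: hh|exact: delta_holo].
elim: w => [|a w IH] y Wy di; first exact: transport_near.
have Oy : cot_image i W (cot_crd i y) by exists y.
by have [_ e] := flat_delta a oW WU IH Wy di (hw w _ Oy); exact: e.
Qed.

Lemma flat_pderiv i W (u : cotangent A -> C) w y : open W -> W `<=` cot_over U ->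
  holo (cot_atlas A) W u -> W y -> dom i (base y) ->
  dword w (transport W F u) (F y) =
  \sum_(c <- dcoef i w) sval c.1 (cot_crd i y) *
    pderiv (A := cot_atlas A) i c.2 u y.
Proof.
move=> oW WU hu Wy di; rewrite (flat_dword w oW WU hu Wy di).
have oO := cot_image_open (i := i) oW.
have OQ : cot_image i W `<=` Q i.
  by move=> _ [z [Wz dz] <-]; exists z => //; split=> //; exact: (UX (WU _ Wz)).
have Oy : cot_image i W (cot_crd i y) by exists y.
exact: (dcoefE w oO OQ (cot_rep_holo (i := i) hu) Oy).
Qed.

Lemma flat_ucoef i W (u v : cotangent A -> C) k y : open W -> W `<=` cot_over U ->
  holo (cot_atlas A) W u -> holo (cot_atlas A) W v -> W y -> dom i (base y) ->
  moyal_coef om0 k (transport W F u) (transport W F v) (F y) = ucoef i k u v y.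
Proof.
move=> oW WU hu hv Wy di.
have oO := flat_map_open hA hb fU oW WU.
have Oy : (F @` W) (F y) by exists y.
have hu' := flat_transport_holo oW WU hu; have hv' := flat_transport_holo oW WU hv.
rewrite (moyal_coefE k oO hu' hv' Oy) /tens /ucoef mulr_sumr.
apply: eq_bigr => t _ /=.
rewrite (flat_pderiv t.1.2 oW WU hu Wy di) (flat_pderiv t.2 oW WU hv Wy di).
rewrite [t.1.1 * _]mulr_sumr mulr_suml mulr_sumr; apply: eq_bigr => c _.
rewrite mulr_sumr mulr_sumr; apply: eq_bigr => d _.
move: (kap k) (t.1.1) (sval c.1 _) (sval d.1 _) (pderiv _ c.2 _ _)
  (pderiv _ d.2 _ _) => p1 p2 p3 p4 p5 p6; ring.
Qed.

Lemma flat_umoyal i W (u v : nat -> cotangent A -> C) m y : open W ->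
  W `<=` cot_over U -> holo_series (cot_atlas A) W u ->
  holo_series (cot_atlas A) W v -> W y -> dom i (base y) ->
  pullback_moyal F W u v m y = umoyal i u v m y.
Proof.
move=> oW WU hu hv Wy di; rewrite /pullback_moyal /moyal /umoyal.
apply: eq_bigr => k _; apply: eq_bigr => k1 _; apply: eq_bigr => k2 _.
exact: flat_ucoef oW WU (hu k1) (hv k2) Wy di.
Qed.

End FlatPullback.

(** The polynomial condition for a single operator, in a form stable under finite sums. No
    holomorphy of [u] and [v] is asked, because [umoyal] is literally an expression in chart
    derivatives. *)
Definition polynomial_op (i : idx (cot_atlas A))
    (Phi : (nat -> cotangent A -> C) -> (nat -> cotangent A -> C) ->
           cotangent A -> C) : Prop :=
  exists (N : nat) (P : 'I_N -> @monomial R 2 (cotangent A)),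
    (forall l, holo (cot_atlas A) (cot_over X0 `&` dom i) (mcoef (P l))) /\
    (forall u v y, Phi u v y = poly_eval i P u v y).

Lemma polynomial_op_sum i (I : Type) (s : seq I)
    (Phi : I -> (nat -> cotangent A -> C) -> (nat -> cotangent A -> C) ->
           cotangent A -> C) :
  (forall t, polynomial_op i (Phi t)) ->
  polynomial_op i (fun u v y => \sum_(t <- s) Phi t u v y).
Proof.
move=> h; elim: s => [|t s [N [P [hP PE]]]].
  exists 0%N, (fun l : 'I_0 => False_rect _ (notF (valP l))); split=> [[]//|u v y].
  by rewrite big_nil /poly_eval big_ord0.
have [N' [P' [hP' PE']]] := h t.
exists (N' + N)%N, (fun l => match fintype.split l with inl l => P' l | inr l => P l end).
split=> [l|u v y]; first by case: (fintype.split l).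
rewrite big_cons PE PE' /poly_eval big_split_ord /=; congr (_ + _).
  by apply: eq_bigr => l _; have := unsplitK (inl l : 'I_N' + 'I_N) => /= ->.
by apply: eq_bigr => l _; have := unsplitK (inr l : 'I_N' + 'I_N) => /= ->.
Qed.

Lemma polynomial_op_sum_cond i n (P : pred 'I_n)
    (Phi : 'I_n -> (nat -> cotangent A -> C) -> (nat -> cotangent A -> C) ->
           cotangent A -> C) :
  (forall t, polynomial_op i (Phi t)) ->
  polynomial_op i (fun u v y => \sum_(t < n | P t) Phi t u v y).
Proof.
move=> h; have [N [P' [hP PE]]] := polynomial_op_sum (enum P) h.
by exists N, P'; split=> // u v y; rewrite -PE big_enum.
Qed.

Lemma polynomial_op_umoyal i m :
  polynomial_op i (fun u v => umoyal i u v m).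
Proof.
apply: polynomial_op_sum_cond => k; apply: polynomial_op_sum_cond => k1.
apply: polynomial_op_sum_cond => k2.
apply: polynomial_op_sum => t; apply: polynomial_op_sum => c.
apply: polynomial_op_sum => d.
pose coe (q : V) : C := kap k * t.1.1 * sval c.1 q * sval d.1 q.
exists 1%N, (fun=> @Monomial R 2 (cotangent A) (fun y => coe (cot_crd i y))
  [:: (nat_of_ord k1, c.2)] [:: (nat_of_ord k2, d.2)]); split=> [_|u v y].
  apply: (holo_chart hT) => y [Xy di]; exists i => //.
  have Qq : Q i (cot_crd i y) by exists y.
  have E := cot_near hA (i := i) (h := coe) (fun y => coe (cot_crd i y)) di
    (fun _ _ => erefl).
  apply: near_differentiable E _.
  exact: (diffMC (diffZC _ (svalP c.1 _ Qq)) (svalP d.1 _ Qq)).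
by rewrite /poly_eval big_ord_recl big_ord0 addr0 /= !big_seq1.
Qed.

End UniversalPolynomial.

(** * Verification of the axioms of a deformation quantization *)

Section LocalQuantization.
Context {R : realType} {X : topologicalType}.
Local Notation C := (cplx R).
Local Notation V := 'rV[C]_2.
Local Notation om0 := (omega0 R).
Variable A : atlas C X.
Hypothesis hA : complex_manifold A.
Variable b : X -> idx A -> C.
Hypothesis hb : holo_oneform b.
Let hT := cot_manifold hA.
Local Notation T := (cot_atlas A).
Local Notation X0 := (nonvanishing b).
Implicit Types (y : cotangent A) (W : set (cotangent A)).
Implicit Types (u v w : nat -> cotangent A -> C).

Lemma cot_holo W (h : cotangent A -> C) : open W ->
  (forall (i : idx A) y, W y -> dom i (base y) -> exists2 H : V -> C,
     differentiable H (cot_crd i y) &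
     forall y', W y' -> dom i (base y') -> H (cot_crd i y') = h y') ->
  holo T W h.
Proof.
move=> oW hH i y Wy di; have [H dH HE] := hH i y Wy di.
have E : \forall p \near cot_crd i y, H p = rep (A := T) i h p.
  apply: filterS (near_cot hA oW Wy di) => p [y' [Wy' di' ->]].
  have e := rep_crd hT (i := i) h di'; rewrite /= in e.
  by rewrite e HE.
exact: near_differentiable E dH.
Qed.

Lemma rep_cot (i : idx A) (h : cotangent A -> C) y : dom i (base y) ->
  rep (A := T) i h (cot_crd i y) = h y.
Proof. by move=> di; exact: (rep_crd hT (i := i) h di). Qed.

Lemma cot_holoD W (f g : cotangent A -> C) : open W -> holo T W f ->
  holo T W g -> holo T W (fun y => f y + g y).
Proof.
move=> oW hf hg; apply: cot_holo => // i y Wy di.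
exists (fun p => rep (A := T) i f p + rep (A := T) i g p).
  exact: (diffDC (hf i y Wy di) (hg i y Wy di)).
by move=> y' _ di'; rewrite !rep_cot.
Qed.

Lemma cot_holoZ W c (f : cotangent A -> C) : open W -> holo T W f ->
  holo T W (fun y => c * f y).
Proof.
move=> oW hf; apply: cot_holo => // i y Wy di.
exists (fun p => c * rep (A := T) i f p).
  exact: (diffZC c (hf i y Wy di)).
by move=> y' _ di'; rewrite rep_cot.
Qed.

Lemma cot_holo_cst W c : open W -> holo T W (fun=> c : C).
Proof.
move=> oW; apply: cot_holo => // i y Wy di.
by exists (fun=> c) => //; exact: differentiable_cst.
Qed.

Lemma cot_holo_sum W (I : Type) (s : seq I) (c : I -> C)
    (F : I -> cotangent A -> C) : open W -> (forall t, holo T W (F t)) ->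
  holo T W (fun y => \sum_(t <- s) c t * F t y).
Proof.
move=> oW hF; elim: s => [|t s IH].
  have -> : (fun y => \sum_(t <- [::]) c t * F t y) = (fun=> 0 : C).
    by apply/funext => z; rewrite big_nil.
  exact: cot_holo_cst.
have -> : (fun y => \sum_(t <- t :: s) c t * F t y) =
    (fun y => c t * F t y + \sum_(t <- s) c t * F t y).
  by apply/funext => z; rewrite big_cons.
exact: (cot_holoD oW (cot_holoZ _ oW (hF t)) IH).
Qed.

(** The bracket in flat coordinates is the canonical one times the determinant [a * b1] of the
    coordinate fields; the zeros stand for the coefficient [cA] of index 1. The undifferentiated
    products cancel in the commutator. *)
Lemma commutator_identity (c a b0 b1 u0 u1 v0 v1 p q r s : C) : a * b1 = 1 ->
  p * q + r * s + c / 2 * ((0 * u0 + b1 * u1) * (a * v0 + b0 * v1) -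
    (a * u0 + b0 * u1) * (0 * v0 + b1 * v1)) -
  (s * r + q * p + c / 2 * ((0 * v0 + b1 * v1) * (a * u0 + b0 * u1) -
    (a * v0 + b0 * v1) * (0 * u0 + b1 * u1))) = c * (u1 * v0 - u0 * v1).
Proof.
move=> ab; have c2 : c = c / 2 * 2 by rewrite divfK// pnatr_eq0.
rewrite [in RHS]c2; move: (c / 2) => h {c2}.
by transitivity (a * b1 * (h * 2 * (u1 * v0 - u0 * v1))); [ring|rewrite ab mul1r].
Qed.

Lemma gradE (i : idx A) (h : cotangent A -> C) y a :
  grad (A := T) i h y 0 a = pderiv (A := T) i [:: a] h y.
Proof. exact: mxE. Qed.

Lemma poissonE (i : idx A) (g h : cotangent A -> C) y : dom i (base y) ->
  poisson (liouville (A := A)) i g h y =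
    pderiv (A := T) i [:: 1] g y * pderiv (A := T) i [:: 0] h y -
    pderiv (A := T) i [:: 0] g y * pderiv (A := T) i [:: 1] h y.
Proof.
move=> di; rewrite /poisson (liouvilleE hA di).
exact: etrans (bracket_omega0 _ _) (congr2 (fun p q : C => p - q)
  (congr2 *%R (gradE _ _ _ _) (gradE _ _ _ _))
  (congr2 *%R (gradE _ _ _ _) (gradE _ _ _ _))).
Qed.

Lemma holo_sadd W u v : open W -> holo_series T W u -> holo_series T W v ->
  holo_series T W (sadd u v).
Proof. by move=> oW hu hv k; exact: (cot_holoD oW (hu k) (hv k)). Qed.

Lemma holo_sscale W c u : open W -> holo_series T W u ->
  holo_series T W (sscale c u).
Proof.
move=> oW hu k.
exact: (cot_holo_sum _ (fun j : 'I_k.+1 => c j) oW (fun j => hu (k - j)%N)).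
Qed.

Lemma holo_sconst W t : open W -> holo T W t -> holo_series T W (sconst t).
Proof. by move=> oW ht [|k]; [exact: ht|exact: cot_holo_cst]. Qed.

Definition flat_series (f : X -> C) W u : nat -> V -> C :=
  fun k => transport W (flat_map b f) (u k).

Section Germ.
Variables (U : set X) (f : X -> C).
Hypothesis fU : flat_chart b U f.
Local Notation F := (flat_map b f).

Lemma flat_pull_holo W (h : cotangent A -> C) (H : V -> C) : open W ->
  W `<=` cot_over U -> holo_on (F @` W) H -> (forall y, W y -> h y = H (F y)) ->
  holo T W h.
Proof.
move=> oW WU hH hE; apply: cot_holo => // i y Wy di.
have er : rep (A := T) i F (cot_crd i y) = F y.
  exact: (rep_crd hT (i := i) F di).
have dF := flat_map_holo hA hb fU (WU _ Wy) di.
have dH : differentiable H (rep (A := T) i F (cot_crd i y)).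
  by rewrite er; apply: hH; exists y.
exists (H \o rep (A := T) i F); first exact: (differentiable_comp dF dH).
move=> y' Wy' di' /=; have e := rep_crd hT (i := i) F di'; rewrite /= in e.
by rewrite e hE.
Qed.

Lemma flat_series_holo W u : open W -> W `<=` cot_over U -> holo_series T W u ->
  holo_ser (F @` W) (flat_series f W u).
Proof. by move=> oW WU hu k; exact: (flat_transport_holo hA hb fU oW WU (hu k)). Qed.

(** [Hu] and [Hv] may be any series inducing [u] and [v], not just the transported ones. An outer
    product can thus be fed with an inner Moyal-Weyl product. *)
Lemma flat_moyal (i : idx A) W u v (Hu Hv : nat -> V -> C) k y : open W ->
  W `<=` cot_over U -> holo_series T W u -> holo_series T W v ->
  (forall k y, W y -> u k y = Hu k (F y)) ->
  (forall k y, W y -> v k y = Hv k (F y)) -> W y -> dom i (base y) ->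
  umoyal hA hb i u v k y = moyal om0 Hu Hv k (F y).
Proof.
move=> oW WU hu hv uE vE Wy di.
rewrite -(flat_umoyal hA hb fU k oW WU hu hv Wy di) /pullback_moyal.
have oO := flat_map_open hA hb fU oW WU.
have Oy : (F @` W) (F y) by exists y.
apply: (near_moyal k oO Oy (flat_series_holo oW WU hu) (flat_series_holo oW WU hv)).
  by move=> j _ [z Wz <-]; rewrite /flat_series (flat_transport hA hb fU _ WU Wz) uE.
by move=> j _ [z Wz <-]; rewrite /flat_series (flat_transport hA hb fU _ WU Wz) vE.
Qed.

End Germ.

Section Quantization.
Variables (D : set X) (star : set (cotangent A) -> (nat -> cotangent A -> C) ->
  (nat -> cotangent A -> C) -> nat -> cotangent A -> C).
Hypothesis oD : open D.
Hypothesis cD : connected D.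
Hypothesis DX : D `<=` X0.
Hypothesis hstar : forall (i : idx A) W u v k y, open W -> W `<=` cot_over D ->
  holo_series T W u -> holo_series T W v -> W y -> dom i (base y) ->
  star W u v k y = umoyal hA hb i u v k y.

Let germ W y : open W -> W `<=` cot_over D -> W y ->
  exists U f, [/\ flat_chart b U f, open (W `&` cot_over U),
    (W `&` cot_over U) y, W `&` cot_over U `<=` cot_over U &
    W `&` cot_over U `<=` W].
Proof.
move=> oW WD Wy; have [U [f [Uy fU]]] := flat_chart_exists hA hb (DX (WD _ Wy)).
exists U, f; split=> //.
by apply: openI => //; apply: (base_open hA); case: fU.
Qed.

Let sub_series W W' u : W' `<=` W -> holo_series T W u -> holo_series T W' u.
Proof. by move=> WW hu k; exact: holo_sub WW (hu k). Qed.

Let star_flat W u v U f W' (Hu Hv : nat -> V -> C) k y : flat_chart b U f ->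
  open W -> W `<=` cot_over D -> open W' -> W' `<=` cot_over U -> W' `<=` W ->
  holo_series T W u -> holo_series T W v ->
  (forall k y, W' y -> u k y = Hu k (flat_map b f y)) ->
  (forall k y, W' y -> v k y = Hv k (flat_map b f y)) -> W' y ->
  star W u v k y = moyal om0 Hu Hv k (flat_map b f y).
Proof.
move=> fU oW WD oW' WU WW hu hv uE vE Wy.
have [i di] := mfd_cover hA (base y).
rewrite (hstar k oW WD hu hv (WW _ Wy) di).
exact: (flat_moyal fU k oW' WU (sub_series WW hu) (sub_series WW hv) uE vE Wy di).
Qed.

Let transE W' U f u : flat_chart b U f -> W' `<=` cot_over U ->
  forall k y, W' y ->
    u k y = flat_series f W' u k (flat_map b f y).
Proof.
by move=> fU WU k y Wy; exact: esym (flat_transport hA hb fU (u k) WU Wy).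
Qed.

Lemma star_holo W u v : open W -> W `<=` cot_over D -> holo_series T W u ->
  holo_series T W v -> holo_series T W (star W u v).
Proof.
move=> oW WD hu hv k i y Wy di.
have [U [f [fU oW' Wy' WU WW]]] := germ oW WD Wy.
have oO := flat_map_open hA hb fU oW' WU.
have hu' := flat_series_holo fU oW' WU (sub_series WW hu).
have hv' := flat_series_holo fU oW' WU (sub_series WW hv).
apply: (flat_pull_holo fU oW' WU (moyal_holo k oO hu' hv')) Wy' di => z Wz.
have tu := transE u fU WU; have tv := transE v fU WU.
exact (star_flat k fU oW WD oW' WU WW hu hv tu tv Wz).
Qed.

(** The only information about [star] is [hstar], so one proof covers both the pulled-back products
    over a flat chart and the global product. *)
Lemma star_quantization :
  deformation_quantization (liouville (A := A)) (cot_over D) star.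
Proof.
split.
- exact: liouville_manifold.
- exact: star_holo.
- move=> W u u' v v' oW WD hu hv uu vv k y Wy.
  have hu' : holo_series T W u'.
    by move=> j; exact: (holo_ext hT oW (uu j) (hu j)).
  have hv' : holo_series T W v'.
    by move=> j; exact: (holo_ext hT oW (vv j) (hv j)).
  have [U [f [fU oW' Wy' WU WW]]] := germ oW WD Wy.
  rewrite (star_flat k fU oW WD oW' WU WW hu hv (transE _ fU WU) (transE _ fU WU) Wy').
  apply: esym; apply: (star_flat k fU oW WD oW' WU WW hu' hv' _ _ Wy').
    by move=> j z Wz; rewrite -(uu _ _ (WW _ Wz)); exact: transE _ fU WU j z Wz.
  by move=> j z Wz; rewrite -(vv _ _ (WW _ Wz)); exact: transE _ fU WU j z Wz.
- move=> W W' u v oW oW' WD WW hu hv k y Wy.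
  have [i di] := mfd_cover hA (base y).
  rewrite (hstar k oW WD hu hv (WW _ Wy) di).
  have WD' : W' `<=` cot_over D by move=> z /WW/WD.
  by rewrite (hstar k oW' WD' (sub_series WW hu) (sub_series WW hv) Wy di).
- move=> W u u' v oW WD hu hu' hv k y Wy.
  have [U [f [fU oW' Wy' WU WW]]] := germ oW WD Wy.
  have oO := flat_map_open hA hb fU oW' WU.
  have Oy : (flat_map b f @` (W `&` cot_over U)) (flat_map b f y) by exists y.
  have tu := transE u fU WU; have tu' := transE u' fU WU.
  have tv := transE v fU WU.
  have su := flat_series_holo fU oW' WU (sub_series WW hu).
  have su' := flat_series_holo fU oW' WU (sub_series WW hu').
  have sv := flat_series_holo fU oW' WU (sub_series WW hv).
  rewrite /sadd (star_flat k fU oW WD oW' WU WW hu hv tu tv Wy').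
  rewrite (star_flat k fU oW WD oW' WU WW hu' hv tu' tv Wy').
  rewrite -(moyal_addl k oO Oy su su' sv).
  apply: (star_flat k fU oW WD oW' WU WW (holo_sadd oW hu hu') hv _ tv Wy').
  by move=> j z Wz; rewrite /sadd (tu j z Wz) (tu' j z Wz).
- move=> W v u u' oW WD hv hu hu' k y Wy.
  have [U [f [fU oW' Wy' WU WW]]] := germ oW WD Wy.
  have oO := flat_map_open hA hb fU oW' WU.
  have Oy : (flat_map b f @` (W `&` cot_over U)) (flat_map b f y) by exists y.
  have tu := transE u fU WU; have tu' := transE u' fU WU.
  have tv := transE v fU WU.
  have su := flat_series_holo fU oW' WU (sub_series WW hu).
  have su' := flat_series_holo fU oW' WU (sub_series WW hu').
  have sv := flat_series_holo fU oW' WU (sub_series WW hv).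
  rewrite /sadd (star_flat k fU oW WD oW' WU WW hv hu tv tu Wy').
  rewrite (star_flat k fU oW WD oW' WU WW hv hu' tv tu' Wy').
  rewrite -(moyal_addr k oO Oy su su' sv).
  apply: (star_flat k fU oW WD oW' WU WW hv (holo_sadd oW hu hu') tv _ Wy').
  by move=> j z Wz; rewrite /sadd (tu j z Wz) (tu' j z Wz).
- move=> W c u v oW WD hu hv k y Wy.
  have [U [f [fU oW' Wy' WU WW]]] := germ oW WD Wy.
  have oO := flat_map_open hA hb fU oW' WU.
  have Oy : (flat_map b f @` (W `&` cot_over U)) (flat_map b f y) by exists y.
  have tu := transE u fU WU; have tv := transE v fU WU.
  have su := flat_series_holo fU oW' WU (sub_series WW hu).
  have sv := flat_series_holo fU oW' WU (sub_series WW hv).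
  rewrite (star_flat k fU oW WD oW' WU WW (holo_sscale c oW hu) hv
    (Hu := sscaleV c (flat_series f (W `&` cot_over U) u))
    _ tv Wy'); last first.
    by move=> j z Wz; rewrite /sscale /sscaleV; apply: eq_bigr => l _; rewrite -tu.
  rewrite (moyal_scalel c k oO Oy su sv) /sscale /sscaleV; apply: eq_bigr => l _.
  by rewrite (star_flat (k - l)%N fU oW WD oW' WU WW hu hv tu tv Wy').
- move=> W c v u oW WD hv hu k y Wy.
  have [U [f [fU oW' Wy' WU WW]]] := germ oW WD Wy.
  have oO := flat_map_open hA hb fU oW' WU.
  have Oy : (flat_map b f @` (W `&` cot_over U)) (flat_map b f y) by exists y.
  have tu := transE u fU WU; have tv := transE v fU WU.
  have su := flat_series_holo fU oW' WU (sub_series WW hu).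
  have sv := flat_series_holo fU oW' WU (sub_series WW hv).
  rewrite (star_flat k fU oW WD oW' WU WW hv (holo_sscale c oW hu)
    (Hv := sscaleV c (flat_series f (W `&` cot_over U) u))
    tv _ Wy'); last first.
    by move=> j z Wz; rewrite /sscale /sscaleV; apply: eq_bigr => l _; rewrite -tu.
  rewrite (moyal_scaler c k oO Oy sv su) /sscale /sscaleV; apply: eq_bigr => l _.
  by rewrite (star_flat (k - l)%N fU oW WD oW' WU WW hv hu tv tu Wy').
- move=> W u v w oW WD hu hv hw k y Wy.
  have [U [f [fU oW' Wy' WU WW]]] := germ oW WD Wy.
  have oO := flat_map_open hA hb fU oW' WU.
  have Oy : (flat_map b f @` (W `&` cot_over U)) (flat_map b f y) by exists y.
  have tu := transE u fU WU; have tv := transE v fU WU.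
  have tw := transE w fU WU.
  have su := flat_series_holo fU oW' WU (sub_series WW hu).
  have sv := flat_series_holo fU oW' WU (sub_series WW hv).
  have sw := flat_series_holo fU oW' WU (sub_series WW hw).
  (* The inner products are induced by Moyal-Weyl series on the image of the chart, which are passed
     on to the outer product. *)
  have uv j z Wz := star_flat j fU oW WD oW' WU WW hu hv tu tv (y := z) Wz.
  have vw j z Wz := star_flat j fU oW WD oW' WU WW hv hw tv tw (y := z) Wz.
  have huv := star_holo oW WD hu hv; have hvw := star_holo oW WD hv hw.
  rewrite (star_flat k fU oW WD oW' WU WW huv hw uv tw Wy').
  rewrite (star_flat k fU oW WD oW' WU WW hu hvw tu vw Wy').
  exact: (moyal_assoc k oO Oy su sv sw).
- move=> k i; have [N [P [hP PE]]] := polynomial_op_umoyal hA hb i k.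
  exists N, P; split=> [l|W u v y oW WD hu hv Wy di].
    apply: holo_sub (hP l) => z [Dz dz]; split=> //; exact: (DX Dz).
  by rewrite (hstar k oW WD hu hv Wy di) PE.
- move=> W u v y oW WD hu hv Wy.
  have [U [f [fU oW' Wy' WU WW]]] := germ oW WD Wy.
  have tu := transE u fU WU; have tv := transE v fU WU.
  rewrite (star_flat 0 fU oW WD oW' WU WW hu hv tu tv Wy') moyal_zero.
  by rewrite -(tu 0%N y Wy') -(tv 0%N y Wy').
- move=> W t oW WD ht.
  have h1 := holo_sconst oW (cot_holo_cst 1 oW); have h2 := holo_sconst oW ht.
  have unit1 (f : X -> C) (W' : set (cotangent A)) j z (_ : W' z) :
      sconst (cst 1) j z = sconstV (fun=> 1) j (flat_map b f z) by case: j.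
  have unit2 U f W' : flat_chart b U f -> W' `<=` cot_over U -> forall j z, W' z ->
      sconst t j z = sconstV (transport W' (flat_map b f) t) j (flat_map b f z).
    by move=> fU WU [|j] z Wz //=; rewrite (flat_transport hA hb fU _ WU Wz).
  split=> k y Wy.
  + have [U [f [fU oW' Wy' WU WW]]] := germ oW WD Wy.
    have oO := flat_map_open hA hb fU oW' WU.
    have Oy : (flat_map b f @` (W `&` cot_over U)) (flat_map b f y) by exists y.
    have st := flat_transport_holo hA hb fU oW' WU (holo_sub WW ht).
    rewrite (star_flat k fU oW WD oW' WU WW h1 h2
      (unit1 f (W `&` cot_over U)) (unit2 _ _ _ fU WU) Wy').
    by rewrite (moyal_unitl k oO Oy st) -(unit2 _ _ _ fU WU k _ Wy').
  + have [U [f [fU oW' Wy' WU WW]]] := germ oW WD Wy.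
    have oO := flat_map_open hA hb fU oW' WU.
    have Oy : (flat_map b f @` (W `&` cot_over U)) (flat_map b f y) by exists y.
    have st := flat_transport_holo hA hb fU oW' WU (holo_sub WW ht).
    rewrite (star_flat k fU oW WD oW' WU WW h2 h1
      (unit2 _ _ _ fU WU) (unit1 f (W `&` cot_over U)) Wy').
    by rewrite (moyal_unitr k oO Oy st) -(unit2 _ _ _ fU WU k _ Wy').
move=> W u v oW WD hu hv.
(* The commutator from order 2 on; only the orders 0 and 1 need a computation. *)
exists (fun k y => star W u v k.+2 y + (-1) * star W v u k.+2 y).
  move=> k; apply: cot_holoD => //; first exact: star_holo.
  by apply: cot_holoZ => //; exact: star_holo.
move=> i k y Wy di.
have [U [f [fU oW' Wy' WU WW]]] := germ oW WD Wy.
have oO := flat_map_open hA hb fU oW' WU.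
have Oy : (flat_map b f @` (W `&` cot_over U)) (flat_map b f y) by exists y.
have tu := transE u fU WU; have tv := transE v fU WU.
have su := flat_series_holo fU oW' WU (sub_series WW hu).
have sv := flat_series_holo fU oW' WU (sub_series WW hv).
case: k => [|[|k]]; last by rewrite mulN1r.
  rewrite (star_flat 0 fU oW WD oW' WU WW hu hv tu tv Wy').
  rewrite (star_flat 0 fU oW WD oW' WU WW hv hu tv tu Wy').
  by rewrite !moyal_zero mulrC subrr.
rewrite (star_flat 1 fU oW WD oW' WU WW hu hv tu tv Wy').
rewrite (star_flat 1 fU oW WD oW' WU WW hv hu tv tu Wy').
rewrite !moyal_one (moyal_coef1 oO Oy (su 0%N) (sv 0%N)).
rewrite (moyal_coef1 oO Oy (sv 0%N) (su 0%N)).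
have dE (w : cotangent A -> C) a : holo T W w ->
    'D_('e_a) (transport (W `&` cot_over U) (flat_map b f) w) (flat_map b f y) =
    cA b i a (cot_crd i y) * pderiv (A := T) i [:: 0] w y +
    cB b i a (cot_crd i y) * pderiv (A := T) i [:: 1] w y.
  by move=> hw; exact (flat_dword hA hb fU [:: a] oW' WU (holo_sub WW hw) Wy' di).
have AB : cA b i 0 (cot_crd i y) * cB b i 1 (cot_crd i y) = 1.
  rewrite /cA /cB /= /cot_crd pt20 (rep_crd hA)// mulVf//.
  exact (form_neq0 hb (DX (WD _ Wy)) di).
have A1 : cA b i 1 (cot_crd i y) = 0 by [].
rewrite (dE _ 0 (hu 0%N)) (dE _ 1 (hu 0%N)) (dE _ 0 (hv 0%N)) (dE _ 1 (hv 0%N)) A1.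
rewrite (poissonE _ _ di).
exact: (commutator_identity _ _ _ _ _ _ _ _ _ _ AB).
Qed.

End Quantization.
End LocalQuantization.

(** * Patching *)

Section PuncturedDisc.
Context {R : realType}.
Local Notation C := (cplx R).
Implicit Types (c d u v z w : C).

Lemma ReD u v : complex.Re (u + v) = complex.Re u + complex.Re v.
Proof. by case: u; case: v. Qed.

Lemma Re_rc (t : R) u : complex.Re (rc t * u) = t * complex.Re u.
Proof. by case: u => p q; rewrite /rc /= mul0r subr0. Qed.

Definition half_disc z (r : R) c : set C :=
  [set w | nm (w - z) < r /\ 0 < complex.Re (c * (w - z))].

Lemma half_disc_connected z (r : R) c : 0 < r -> nm c = 1 ->
  connected (half_disc z r c).
Proof.
move=> r0 c1; have c0 : c != 0 by rewrite -nm_gt0 c1.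
have cp : c * (z + rc (r / 2) * c^-1 - z) = rc (r / 2).
  by rewrite addrAC subrr add0r mulrCA mulfV// mulr1.
have np : nm (z + rc (r / 2) * c^-1 - z) = r / 2.
  rewrite addrAC subrr add0r nmM nmV c1 invr1 mulr1 nm_rc ger0_norm//.
  by rewrite divr_ge0// ltW.
move: (z + rc (r / 2) * c^-1) cp np => p cp np.
have Rp : complex.Re (c * (p - z)) = r / 2 by rewrite cp.
apply: (@star_shaped_connected R _ p) => [|w t [w1 w2] /andP[t0 t1]].
  by split; rewrite ?np ?Rp; lra.
have e : p + rc t * (w - p) - z = rc (1 - t) * (p - z) + rc t * (w - z).
  by rewrite /rc rmorphB rmorph1 /=; ring.
split; rewrite e; last first.
  rewrite mulrDr mulrCA (mulrCA c (rc t)) ReD !Re_rc Rp.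
  have [->|tn] := eqVneq t 0; first by rewrite subr0 mul1r mul0r addr0; lra.
  have tp : 0 < t by rewrite lt_def tn.
  have : 0 < t * complex.Re (c * (w - z)) by rewrite mulr_gt0.
  have : 0 <= (1 - t) * (r / 2) by rewrite mulr_ge0//; lra.
  lra.
apply: le_lt_trans (nmD _ _) _; rewrite !nmM !nm_rc np !ger0_norm//; last by lra.
have := nm_ge0 (w - z); move: (nm (w - z)) w1 => n w1 n0; nra.
Qed.

(** The offset of the witness from [z] is [r / 4] times [(1 - 'i) / c]; multiplied by [c] or by
    ['i * c] it has real part [r / 4]. *)
Lemma half_disc_meet z (r : R) c d : 0 < r -> nm c = 1 -> d = 'i * c ->
  half_disc z r c `&` half_disc z r d !=set0.
Proof.
move=> r0 c1 ->; have c0 : c != 0 by rewrite -nm_gt0 c1.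
have r4 : 0 < r / 4 by rewrite divr_gt0.
exists (z + rc (r / 4) * ((1 - 'i) * c^-1)).
have e : z + rc (r / 4) * ((1 - 'i) * c^-1) - z = rc (r / 4) * ((1 - 'i) * c^-1).
  by ring.
have n1 : nm (rc (r / 4) * ((1 - 'i) * c^-1)) < r.
  rewrite !nmM nm_rc gtr0_norm// nmV c1 invr1 mulr1.
  have ni : nm 'i = 1 :> R by rewrite nmE normCi.
  have := nmB (1 : C) 'i; rewrite nm1 ni.
  by move: (nm _) => n hn; nra.
have ii : 'i * 'i = -1 :> C by rewrite -expr2 sqrCi.
have e1 : c * (rc (r / 4) * ((1 - 'i) * c^-1)) = rc (r / 4) * (1 - 'i).
  by rewrite mulrCA [c * _]mulrCA mulfV// mulr1.
have e2 : 'i * c * (rc (r / 4) * ((1 - 'i) * c^-1)) = rc (r / 4) * ('i + 1).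
  by rewrite -mulrA e1 ['i * _]mulrCA mulrBr mulr1 ii opprK.
have R1 : complex.Re (1 - 'i : C) = 1 by rewrite /= oppr0 addr0.
have R2 : complex.Re ('i + 1 : C) = 1 by rewrite /= add0r.
by split; split; rewrite e// ?e1 ?e2 Re_rc ?R1 ?R2 mulr1.
Qed.

(** Four half-discs, each turned by a right angle from the previous one, cover the punctured disc
    and meet in succession; each is star-shaped around a point of its axis. *)
Lemma punctured_disc_connected z (r : R) : 0 < r ->
  connected [set w | nm (w - z) < r /\ w != z].
Proof.
move=> r0; have ni : nm 'i = 1 :> R by rewrite nmE normCi.
have ni' : nm (- 'i) = 1 :> R by rewrite nmN.
have n1' : nm (- 1 : C) = 1 by rewrite nmN nm1.
have -> : [set w | nm (w - z) < r /\ w != z] =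
    half_disc z r 1 `|` half_disc z r 'i `|` half_disc z r (- 1)
      `|` half_disc z r (- 'i).
  apply/seteqP; split=> [w [wr wz]|w].
    have uz : w - z != 0 by rewrite subr_eq0.
    have [h|h|h] := ltgtP (complex.Re (w - z)) 0.
    - left; right; split=> //; rewrite mulN1r.
      by case: (w - z) h => p q /=; rewrite oppr_gt0.
    - by left; left; left; split=> //; rewrite mul1r.
    have [k|k|k] := ltgtP (complex.Im (w - z)) 0.
    - left; left; right; split=> //.
      case: (w - z) k => p q /= k; rewrite mul0r mul1r sub0r; lra.
    - right; split=> //.
      case: (w - z) k => p q /= k; rewrite oppr0 mul0r sub0r mulN1r opprK; lra.
    case/negP: uz; apply/eqP; move: h k; case: (w - z) => p q /= -> ->.
    by [].
  have nz c : half_disc z r c w -> nm (w - z) < r /\ w != z.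
    move=> [h1 h2]; split=> //; apply/eqP => e.
    by move: h2; rewrite e subrr mulr0 ltxx.
  by move=> [[[]|]|] /nz.
apply: connectedU.
- have [w [w1 w2]] := @half_disc_meet z r (- 1) (- 'i) r0 n1' (esym (mulrN1 _)).
  by exists w; split=> //; right.
- apply: connectedU.
  + have ii : - 1 = 'i * 'i :> C by rewrite -expr2 sqrCi.
    have [w [w1 w2]] := @half_disc_meet z r 'i (- 1) r0 ni ii.
    by exists w; split=> //; right.
  + apply: connectedU.
    * exact: (@half_disc_meet z r 1 'i r0 (@nm1 R) (esym (mulr1 _))).
    * by apply: half_disc_connected => //; exact: nm1.
    * exact: half_disc_connected.
  + exact: half_disc_connected.
exact: half_disc_connected.
Qed.

End PuncturedDisc.

(** * Zeros of a holomorphic form and connectedness of their complement *)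

Section FormZeros.
Context {R : realType} {X : topologicalType}.
Local Notation C := (cplx R).
Variable A : atlas C X.
Hypothesis hA : complex_manifold A.
Variable b : X -> idx A -> C.
Hypothesis hb : holo_oneform b.
Local Notation X0 := (nonvanishing b).

(** The dichotomy of [zeros_isolated], carried to the surface. The second case provides a whole disc
    of coordinates, as needed to use connectedness of the punctured disc. *)
Lemma form_zeros (x : X) : (\forall x' \near x, ~ X0 x') \/
  exists (i : idx A) (r : R), [/\ dom i x, 0 < r & forall w, nm (w - crd i x) < r ->
    exists x', [/\ dom i x', crd i x' = w & (w != crd i x -> X0 x')]].
Proof.
have [i di] := mfd_cover hA x.
have oO : open (crd i @` (dom i `&` dom i)).
  exact: (open_chart hA i (mfd_dom_open hA i)).
have Oz : (crd i @` (dom i `&` dom i)) (crd i x) by exists x.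
have dO w : (crd (a := A) i @` (dom i `&` dom i)) w ->
    differentiable (rep (A := A) i (b ^~ i)) w.
  by move=> [x' [_ dx'] <-]; exact: (form_rep_diff hb dx').
have [r r0 H] := zeros_isolated oO Oz dO.
case: H => H.
  left; have h1 : nbhs (crd i x) [set w | nm (w - crd i x) < r].
    by apply/nbhs_nm; exists r.
  have h2 : \forall z \near x, nm (crd i z - crd i x) < r.
    exact: (mfd_crd_continuous hA di h1).
  have h3 : nbhs x (dom i).
    by apply: open_nbhs_nbhs; split => //; exact: mfd_dom_open.
  apply: filterS2 h2 h3 => z hz dz Xz.
  have := form_neq0 hb Xz dz.
  by have := H _ hz; rewrite (rep_crd hA)// => ->; rewrite eqxx.
right; have [s s0 sO] := open_disc oO Oz.
exists i, (Num.min r s); split=> //; first by rewrite lt_min r0.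
move=> w; rewrite lt_min => /andP[wr ws].
have [x' [dx' _] xw] := sO _ ws; exists x'; split=> // wz.
apply: (@nonvanishing_chart _ _ _ _ _ i).
by have := H _ wr wz; rewrite -xw (rep_crd hA).
Qed.

Hypothesis cX : connected [set: X].

Let clopen_full (S : set X) : S !=set0 -> (forall x, S x -> \forall z \near x, S z) ->
  (forall x, ~ S x -> \forall z \near x, ~ S z) -> forall x, S x.
Proof.
move=> S0 oS oN x; have E : S = [set: X].
  apply: cX => //; first by exists S; rewrite ?setTI ?openE.
  exists S; last by rewrite setTI.
  by rewrite -openC openE => z; exact: oN.
by rewrite E.
Qed.

(** Identity theorem: the points near which the form vanishes make up an open set, also closed by
    [form_zeros]; on a connected surface it would be everything as soon as it is nonempty. *)
Lemma near_nonvanishing (x : X) : X0 !=set0 -> ~ (\forall x' \near x, ~ X0 x').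
Proof.
move=> [x0 Xx0] h.
suff h0 : \forall x' \near x0, ~ X0 x' by exact: (nbhs_singleton h0 Xx0).
apply: (clopen_full (S := [set x : X | \forall x' \near x, ~ X0 x'])).
- by exists x.
- by move=> z; exact: nbhs_interior.
move=> z nz; case: (form_zeros z) => // -[i [r [di r0 H]]].
have h1 : nbhs (crd i z) [set w | nm (w - crd i z) < r].
  by apply/nbhs_nm; exists r.
have h2 : \forall y \near z, nm (crd i y - crd i z) < r.
  exact: (mfd_crd_continuous hA di h1).
have h3 : nbhs z (dom i).
  by apply: open_nbhs_nbhs; split => //; exact: mfd_dom_open.
apply: filterS2 h2 h3 => y hy dy.
have [->//|yz] := pselect (y = z).
have [x' [dx' e Xx']] := H _ hy.
have yx : y = x' by apply: (mfd_crd_inj hA dy dx').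
have ne : crd i y != crd i z.
  by apply/eqP => /(mfd_crd_inj hA dy di).
by move=> /nbhs_singleton; apply; rewrite yx; exact: Xx' ne.
Qed.

Lemma nonvanishing_connected : connected X0.
Proof.
move=> B B0 [C1 oC1 BE1] [C2 cC2 BE2].
have oX := nonvanishing_open hA hb.
have oB : open B by rewrite BE1; exact: openI.
have oN : open (X0 `&` ~` C2) by apply: openI => //; exact: closed_openC.
have NB x : (X0 `&` ~` C2) x <-> X0 x /\ ~ B x.
  rewrite BE2; split=> [[h1 h2]|[h1 h2]]; split=> //; first by case.
  by move=> h; apply: h2.
have X0n : X0 !=set0 by move: B0 => [x]; rewrite BE1 => -[Xx _]; exists x.
(* [B] is extended across the zeros of the form: a zero is included when the nonzero points around
   it lie in [B]. It remains to show that [S] is open and closed in [X]. *)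
pose S := [set x : X | \forall x' \near x, X0 x' -> B x'].
have SB x : B x -> S x.
  move=> Bx; have : nbhs x B by apply: open_nbhs_nbhs.
  by apply: filterS => z Bz _.
have far x : ~ S x -> \forall x' \near x, X0 x' -> ~ B x'.
  move=> nS; have [Xx|nX] := pselect (X0 x).
    have : nbhs x (X0 `&` ~` C2).
      apply: open_nbhs_nbhs; split => //; apply/NB; split=> // Bx.
      by apply: nS; exact: SB.
    by apply: filterS => z /NB[_ nB] _.
  case: (form_zeros x) => [|[i [r [di r0 H]]]].
    by apply: filterS => z nXz /nXz.
  have h1 : nbhs (crd i x) [set w | nm (w - crd i x) < r].
    by apply/nbhs_nm; exists r.
  have h2 : \forall y \near x, nm (crd i y - crd i x) < r.
    exact: (mfd_crd_continuous hA di h1).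
  have h3 : nbhs x (dom i).
    by apply: open_nbhs_nbhs; split => //; exact: mfd_dom_open.
  pose PD := [set w : C | nm (w - crd i x) < r /\ w != crd i x].
  have cPD : connected PD := punctured_disc_connected (z := crd i x) r0.
  apply: contrapT => nfar.
  have [y [Xy By yr dy]] : exists y,
      [/\ X0 y, B y, nm (crd i y - crd i x) < r & dom i y].
    apply: contrapT => nex; apply: nfar.
    apply: filterS2 h2 h3 => y yr dy Xy By; apply: nex; by exists y.
  have yx : crd i y != crd i x.
    by apply/eqP => /(mfd_crd_inj hA dy di) e; apply: nX; rewrite -e.
  (* The trace of [B] on the punctured disc is relatively open and closed, hence all of it as soon
     as it contains [crd i y]; but then [x] would be in [S]. *)
  pose E := PD `&` crd i @` (B `&` dom i).
  have EPD : E = PD.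
    apply: cPD.
    - by exists (crd i y); split; [split|exists y].
    - by exists (crd i @` (B `&` dom i)) => //; exact: (open_chart hA i oB).
    exists (~` (crd i @` ((X0 `&` ~` C2) `&` dom i))).
      by apply: open_closedC; exact: (open_chart hA i oN).
    apply/seteqP; split=> w [Pw h]; split=> //.
      move: h => [z [Bz dz] <-] [z' [/NB[_ nB] dz'] /(mfd_crd_inj hA dz' dz) e].
      by apply: nB; rewrite e.
    have [wr wx] := Pw; have [x' [dx' e Xx']] := H _ wr.
    exists x' => //; split=> //; apply: contrapT => nB; apply: h.
    by exists x' => //; split=> //; apply/NB; split=> //; exact: Xx'.
  apply: nS; apply: filterS2 h2 h3 => z zr dz Xz.
  have zx : crd i z != crd i x.
    by apply/eqP => /(mfd_crd_inj hA dz di) e; apply: nX; rewrite -e.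
  have : E (crd i z) by rewrite EPD.
  by move=> [_ [z' [Bz' dz'] /(mfd_crd_inj hA dz' dz) <-]].
have SX x : S x.
  apply: clopen_full.
  - by move: B0 => [z Bz]; exists z; exact: SB.
  - by move=> z; exact: nbhs_interior.
  (* Were [z'] in [S], the nonzero points around it would be both in [B] and outside; there would be
     none, against [near_nonvanishing]. *)
  move=> z /far/nbhs_interior; apply: filterS => z' h1 h2.
  apply: (near_nonvanishing (x := z') X0n).
  by apply: filterS2 h1 h2 => t k1 k2 Xt; apply: (k1 Xt); exact: k2.
apply/seteqP; split=> x; first by rewrite BE1 => -[].
by move=> Xx; exact: nbhs_singleton (SX x) Xx.
Qed.

End FormZeros.

(** * The global product and the theorem *)

Section Universality.
Context {R : realType} {X : topologicalType}.
Local Notation C := (cplx R).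
Variable A : atlas C X.
Hypothesis hA : complex_manifold A.
Variable b : X -> idx A -> C.
Hypothesis hb : holo_oneform b.
Local Notation T := (cot_atlas A).

(** Near [y] both sides equal the product pulled back by one flat chart, whose definition involves
    neither [i] nor [j]. *)
Lemma umoyal_chart (i j : idx A) (W : set (cotangent A))
    (u v : nat -> cotangent A -> C) k y : open W ->
  W `<=` cot_over (nonvanishing b) -> holo_series T W u -> holo_series T W v ->
  W y -> dom i (base y) -> dom j (base y) ->
  umoyal hA hb i u v k y = umoyal hA hb j u v k y.
Proof.
move=> oW WX hu hv Wy di dj.
have [U [f [Uy fU]]] := flat_chart_exists hA hb (WX _ Wy).
have oW' : open (W `&` cot_over U).
  by apply: openI => //; apply: (base_open hA); case: fU.
have WW : W `&` cot_over U `<=` W by move=> z [].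
have WU : W `&` cot_over U `<=` cot_over U by move=> z [].
have hu' : holo_series T (W `&` cot_over U) u by move=> l; exact: holo_sub WW (hu l).
have hv' : holo_series T (W `&` cot_over U) v by move=> l; exact: holo_sub WW (hv l).
have Wy' : (W `&` cot_over U) y by [].
rewrite -(flat_umoyal hA hb fU k oW' WU hu' hv' Wy' di).
exact: (flat_umoyal hA hb fU k oW' WU hu' hv' Wy' dj).
Qed.

(** A chart is chosen separately at each point; by [umoyal_chart] any other chart around the point
    gives the same value. *)
Definition global_star (W : set (cotangent A)) (u v : nat -> cotangent A -> C)
    (k : nat) (y : cotangent A) : C :=
  umoyal hA hb (sval (cid (mfd_cover hA (base y)))) u v k y.

Lemma global_starE (i : idx A) (W : set (cotangent A))
    (u v : nat -> cotangent A -> C) k y : open W ->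
  W `<=` cot_over (nonvanishing b) -> holo_series T W u -> holo_series T W v ->
  W y -> dom i (base y) -> global_star W u v k y = umoyal hA hb i u v k y.
Proof.
move=> oW WX hu hv Wy di; apply: (umoyal_chart k oW WX hu hv Wy) di.
by case: cid.
Qed.

End Universality.

Theorem proposition3p2 (R : realType) (X : topologicalType)
    (A : atlas (cplx R) X) (g : nat) (beta : X -> idx A -> cplx R)
    (hX : compact_riemann_surface A)
    (hgenus : has_genus A g) (hg : (1 <= g)%N)
    (hbeta : holo_oneform beta) (hbeta0 : beta <> (fun _ _ => 0)) :
  let X0 := nonvanishing beta in
  let F := flat_map beta in
  [/\ (forall x, X0 x ->
         exists (U : set X) (f : X -> cplx R), U x /\ flat_chart beta U f),
      (forall (U : set X) (f : X -> cplx R), flat_chart beta U f ->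
         holo_embedding (cot_atlas A) (cot_over U) (F f) /\
         deformation_quantization (@liouville R X A) (cot_over U)
           (pullback_moyal (F f))),
      (forall (U U' : set X) (f f' : X -> cplx R),
         flat_chart beta U f -> flat_chart beta U' f' ->
         forall (W : set (cotangent A)) (u v : nat -> cotangent A -> cplx R),
           open W -> W `<=` cot_over U `&` cot_over U' ->
           holo_series (cot_atlas A) W u -> holo_series (cot_atlas A) W v ->
           eq_on W (pullback_moyal (F f) W u v) (pullback_moyal (F f') W u v)) &
      exists star : set (cotangent A) ->
          (nat -> cotangent A -> cplx R) -> (nat -> cotangent A -> cplx R) ->
          nat -> cotangent A -> cplx R,
        deformation_quantization (@liouville R X A) (cot_over X0) star /\
        (forall (U : set X) (f : X -> cplx R), flat_chart beta U f ->
         forall (W : set (cotangent A)) (u v : nat -> cotangent A -> cplx R),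
           open W -> W `<=` cot_over U ->
           holo_series (cot_atlas A) W u -> holo_series (cot_atlas A) W v ->
           eq_on W (star W u v) (pullback_moyal (F f) W u v))].
Proof.
move=> X0 F; have [hA cX _] := hX.
split.
- by move=> x; exact: flat_chart_exists.
- move=> U f fU; have [oU cU UX _ _] := fU; split.
    exact: (flat_map_embedding hA hbeta fU).
  refine (star_quantization (hA := hA) (hb := hbeta) oU cU UX _) => i W u v k y oW WU hu hv Wy di.
  exact: (flat_umoyal hA hbeta fU k oW WU hu hv Wy di).
- move=> U U' f f' fU fU' W u v oW WU hu hv k y Wy.
  have [i di] := mfd_cover hA (base y).
  have WU1 : W `<=` cot_over U by move=> z /WU[].
  have WU2 : W `<=` cot_over U' by move=> z /WU[].
  rewrite (flat_umoyal hA hbeta fU k oW WU1 hu hv Wy di).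
  by rewrite (flat_umoyal hA hbeta fU' k oW WU2 hu hv Wy di).
exists (global_star hA hbeta); split.
  refine (star_quantization (hA := hA) (hb := hbeta) (nonvanishing_open hA hbeta)
    (nonvanishing_connected hA hbeta cX) (fun _ h => h) _) => i W u v k y oW WX hu hv Wy di.
  exact: (global_starE hA hbeta k oW WX hu hv Wy di).
move=> U f fU W u v oW WU hu hv k y Wy; have [i di] := mfd_cover hA (base y).
have WX : W `<=` cot_over (nonvanishing beta).
  by move=> z /WU; case: fU => _ _ UX _ _; exact: UX.
rewrite (flat_umoyal hA hbeta fU k oW WU hu hv Wy di).
exact: (global_starE hA hbeta k oW WX hu hv Wy di).
Qed.
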